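(* Let $X$ be a complex Banach space, $k\in\mathbb{Z}$ and $m\in\mathbb{N}_0$. The Hankel space $B^s_{(k)}((0,\infty);X)$ is continuously embedded in $C^m_{(k)\mathrm b}([0,\infty);X)$ for $s>m+1$.
   Context: For $j\in\mathbb{Z}$, $\mathcal{D}_j:=\frac{\mathrm d}{\mathrm dr}+\frac jr$ and $\mathcal{D}_j^n:=\mathcal{D}_{j-(n-1)}\cdots\mathcal{D}_{j-1}\mathcal{D}_j$. $C^m_{(k)\mathrm b}([0,\infty);X)$ is the space of $f:[0,\infty)\to X$ such that for all $0\le i\le n\le m$ the function $\mathcal{D}_{-k+i}^{\,n-i}\mathcal{D}_k^{\,i}f$ is continuous on $[0,\infty)$ (after continuous extension to $r=0$) and bounded, and $(k+n-2i)\mathcal{D}_{-k+i}^{\,n-i}\mathcal{D}_k^{\,i}f|_{r=0}=0$; its norm is $\max_{0\le i\le n\le m}\sup_{r\ge0}\|\mathcal{D}_{-k+i}^{\,n-i}\mathcal{D}_k^{\,i}f(r)\|$. $\mathscr S_{(k)}([0,\infty);\mathbb{C})$ is the space of scalar functions $\phi$ satisfying the same continuity and vanishing conditions for all $0\le i\le n$, $n\in\mathbb{N}_0$, and $\sup_{r\ge0}r^l|\mathcal{D}_{-k+i}^{\,n-i}\mathcal{D}_k^{\,i}\phi(r)|<\infty$ for all $l\in\mathbb{N}_0$. $L_1^2((0,\infty);X)$ has norm $\|f\|_{L_1^2}^2=2\pi\int_0^\infty\|f(r)\|^2r\,\mathrm dr$. On $\mathscr S_{(k)}([0,\infty);\mathbb{C})$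 the Hankel transform is $\mathcal{H}_k[\phi](\rho):=\int_0^\infty\phi(r)J_k(\rho r)\,r\,\mathrm dr$ ($J_k$ the Bessel function of the first kind), and it maps this space to itself; for $f\in L_1^2((0,\infty);X)$, $\mathcal{H}_k[f]$ is the $k$-index tempered radial distribution $\phi\mapsto2\pi\int_0^\infty f(r)\mathcal{H}_k[\phi](r)\,r\,\mathrm dr$, identified with a function $h$ when it equals $\phi\mapsto2\pi\int_0^\infty h(\rho)\phi(\rho)\,\rho\,\mathrm d\rho$. For $s\ge0$, $$B^s_{(k)}((0,\infty);X):=\{f\in L_1^2((0,\infty);X)\mid(1+\rho^2)^{\frac s2}\mathcal{H}_k[f]\in L_1^2((0,\infty);X)\},\qquad\|f\|_{B^s_{(k)}}=\left(\int_0^\infty(1+\rho^2)^s\|\mathcal{H}_k[f](\rho)\|^2\,\rho\,\mathrm d\rho\right)^{1/2}.$$ *)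

(* Defs.v *)
From HB Require Import structures.
From mathcomp Require Import all_boot all_order all_algebra.
From mathcomp Require Import complex.
From mathcomp Require Import all_classical all_reals all_analysis.

Set Implicit Arguments.
Unset Strict Implicit.
Unset Printing Implicit Defensive.

Import Order.TTheory GRing.Theory Num.Theory.
Import numFieldNormedType.Exports.

Local Open Scope classical_set_scope.
Local Open Scope complex_scope.
Local Open Scope ring_scope.

(* Norms of normed R[i]-modules take values in R[i]; [rnorm] is the same
   (real, nonnegative) number as an element of R. *)
Definition rnorm (R : realType) (X : normedModType R[i]) (x : X) : R :=
  complex.Re `|x|.

(** Bochner integral; the library only integrates extended real functions. *)
Section Bochner.
Context d (T : measurableType d) (R : realType) (X : normedModType R[i]).
Variables (mu : {measure set T -> \bar R}) (D : set T).
Implicit Types (f s : T -> X).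

Definition simple_fun s :=
  finite_set (range s) /\ forall x, measurable (s @^-1` [set x]).

Definition simple_integrable s :=
  simple_fun s /\ forall x, x != 0 -> (mu (D `&` s @^-1` [set x]) < +oo)%E.

(* The level set of x = 0 may have infinite measure; its term vanishes since
   [fine +oo = 0] and the vector is 0. *)
Definition simple_integral s : X :=
  \sum_(x \in range s) (fine (mu (D `&` s @^-1` [set x])))%:C *: x.

Definition strongly_measurable f := exists2 s : nat -> T -> X,
  (forall n, simple_fun (s n)) &
  {ae mu, forall t, D t -> s n t @[n --> \oo] --> f t}.

Definition is_bochner_integral f (v : X) := strongly_measurable f /\
  exists s : nat -> T -> X,
    [/\ forall n, simple_integrable (s n),
        (\int[mu]_(t in D) (rnorm (f t - s n t))%:E)%E @[n --> \oo] --> 0%E &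
        simple_integral (s n) @[n --> \oo] --> v].

Definition bochner_integrable f := exists v, is_bochner_integral f v.

Definition bochner_integral f : X := xget 0 (is_bochner_integral f).

End Bochner.

(** Functions on [0, oo) or (0, oo) are represented by functions on R whose
    values outside the interval are never used. *)
Section DifferentialOperators.
Context (R : realType) (X : normedModType R[i]).
Implicit Types (f : R -> X) (r : R) (j k : int) (n i : nat).

(* X is a module over R[i] and not over R, so the library's derivative along
   a real variable does not apply. *)
Definition diff_quot f r (t : R) : X := (t^-1)%:C *: (f (r + t) - f r).

Definition rderivable f r := cvg (diff_quot f r t @[t --> 0^']).

Definition rderive f r : X := lim (diff_quot f r t @[t --> 0^']).

Definition Dop j f : R -> X := fun r => rderive f r + (j%:~R / r)%:C *: f r.

Fixpoint Dpow j n f : R -> X :=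
  if n is n'.+1 then Dop (j - n'%:Z) (Dpow j n' f) else f.

Definition Dmix k n i f : R -> X := Dpow (- k + i%:Z) (n - i) (Dpow k i f).

(* If the limit does not exist, the value at 0 is arbitrary and the extension
   is not continuous at 0. *)
Definition ext0 f : R -> X :=
  fun r => if r == 0 then lim (f t @[t --> 0^'+]) else f r.

(* The second condition says that all the iterated derivatives of order at
   most m exist on (0, oo): each one of order n < m that occurs is
   differentiable there. *)
Definition regular_upto k m f :=
  [/\ {within `[0, +oo[, continuous f},
      forall n i, (i <= n < m)%N -> forall r, 0 < r -> rderivable (Dmix k n i f) r &
      forall n i, (i <= n <= m)%N ->
        {within `[0, +oo[, continuous (ext0 (Dmix k n i f))} /\
        (k + n%:Z - 2 * i%:Z)%:~R *: ext0 (Dmix k n i f) 0 = 0].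

Definition Cb k m f := regular_upto k m f /\
  forall n i, (i <= n <= m)%N ->
    exists M : R, forall r, 0 <= r -> rnorm (ext0 (Dmix k n i f) r) <= M.

Definition Cb_norm k m f : R :=
  \big[Num.max/0]_(n < m.+1) \big[Num.max/0]_(i < n.+1)
    sup [set rnorm (ext0 (Dmix k n i f) r) | r in `[0, +oo[].

End DifferentialOperators.

(* R[i]^o is R[i] as a normed space over itself. *)
Definition schwartz (R : realType) (k : int) (phi : R -> R[i]^o) :=
  (forall m, regular_upto k m phi) /\
  forall n i l, (i <= n)%N -> exists M : R, forall r, 0 <= r ->
    r ^+ l * rnorm (ext0 (Dmix k n i phi) r) <= M.

(* For n >= 0, J_n(x) = sum_j (-1)^j / (j! (j + n)!) (x / 2)^(2j + n), and
   J_(-n) = (-1)^n J_n. *)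
Definition besselJ (R : realType) (k : int) (x : R) : R :=
  let J (n : nat) : R := limn (series (fun j : nat =>
    (-1) ^+ j / (j`! * (j + n)`!)%:R * (x / 2) ^+ (2 * j + n))) in
  match k with
  | Posz n => J n
  | Negz n => (-1) ^+ n.+1 * J n.+1
  end.

Definition hankel (R : realType) (k : int) (phi : R -> R[i]^o) : R -> R[i]^o :=
  fun rho =>
    (\int[lebesgue_measure]_(r in `]0%R, +oo[)
       (complex.Re (phi r) * besselJ k (rho * r) * r))%R +i*
    (\int[lebesgue_measure]_(r in `]0%R, +oo[)
       (complex.Im (phi r) * besselJ k (rho * r) * r))%R.

Section HankelSpaces.
Context (R : realType) (X : normedModType R[i]).
Implicit Types (f h : R -> X) (phi : R -> R[i]^o) (k : int) (s : R).

Let leb : {measure set (measurableTypeR R) -> \bar R} := @lebesgue_measure R.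

Definition L12_normsq f : \bar R :=
  ((2 * pi)%:E * \int[leb]_(r in `]0%R, +oo[) (rnorm (f r) ^+ 2 * r)%:E)%E.

Definition L12 f :=
  strongly_measurable leb `]0%R, +oo[ f /\ (L12_normsq f < +oo)%E.

(* The scalar factors are gathered on the left: f is X-valued. *)
Definition dist_integrable f phi :=
  bochner_integrable leb `]0%R, +oo[ (fun r => (phi r * r%:C) *: f r).

Definition dist f phi : X := (2 * pi)%:C *:
  bochner_integral leb `]0%R, +oo[ (fun r => (phi r * r%:C) *: f r).

(* The tempered radial distribution H_k[f] : phi |-> dist f (hankel k phi) is
   the function h. *)
Definition is_hankel_transform k f h := forall phi, schwartz k phi ->
  [/\ dist_integrable f (hankel k phi), dist_integrable h phi &
      dist f (hankel k phi) = dist h phi].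

(* Such an h is unique up to a null set in (0, oo); we choose one. *)
Definition hankel_transform k f : R -> X :=
  xget (fun=> 0) (is_hankel_transform k f).

Definition hankel_space k s f :=
  [/\ L12 f, (exists h, is_hankel_transform k f h) &
      L12 (fun rho =>
        ((1 + rho ^+ 2) `^ (s / 2))%:C *: hankel_transform k f rho)].

Definition hankel_space_norm k s f : R := Num.sqrt (fine
  (\int[leb]_(rho in `]0%R, +oo[)
    ((1 + rho ^+ 2) `^ s * rnorm (hankel_transform k f rho) ^+ 2 * rho)%:E)%E).

End HankelSpaces.

(* Main.v *)
(** Put h = H_k[f]. Since s > m + 1, Cauchy-Schwarz against
    (1 + rho^2)^((m - s) / 2), which is square integrable for rho d rho, shows
    that F rho = (1 + rho^2)^(m / 2) rho h(rho) is integrable, with L1 norm at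
    most C |f|_(B^s). Let g be the inverse transform
    g r = int h(rho) J_k(r rho) rho d rho. Each operator D_j maps
    r |-> J_j(r rho) to rho J_(j-1)(r rho), so every mixed derivative of g of
    order n is, up to sign, r |-> int rho^n h(rho) J_l(r rho) rho d rho with
    l = +-(k + n - 2i). As |J_l| <= 1, dominated convergence makes it continuous
    and bounded by |F|_1, and J_l(0) = 0 for l <> 0 gives the vanishing
    conditions.

    To see that g = f, test against the Gaussians r^|k| e^(-b r^2): their Hankel
    transforms are again Gaussians, so the hypothesis on f and Fubini's theorem
    give int r^(|k|+1) e^(-a r^2) (f - g)(r) dr = 0 for all a > 0. Polynomials
    in e^(-a r^2) approximate indicators of rays, hence f = g almost
    everywhere. *)

From HB Require Import structures.
Require Import Defs.
From mathcomp Require Import all_boot all_order all_algebra finmap.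
From mathcomp Require Import complex.
From mathcomp Require Import all_classical all_reals all_analysis.
From mathcomp Require Import ring lra zify.
From mathcomp Require Import measurable_realfun.

Set Implicit Arguments.
Unset Strict Implicit.
Unset Printing Implicit Defensive.

Import Order.TTheory GRing.Theory Num.Theory.
Import numFieldNormedType.Exports.
Import HBSimple HBNNSimple.

Local Open Scope classical_set_scope.
Local Open Scope ring_scope.
Local Open Scope complex_scope.

(** All integrals over rho are taken of one fixed integrable vector function, [F], against scalar
    weights rho^n (1 + rho^2)^(-m/2) J_l(r rho), which stay bounded by 1 as long as n <= m.
    Continuity, differentiation under the integral and Fubini's theorem thus become statements on
    bounded scalar weights, while the vector function stays fixed. A difference quotient in r costs
    one more power of rho, so an integral of order n is differentiated only for n < m.

    The values lie in an arbitrary Banach space, and the identification f = g avoids functionals: if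
    all integrals of [G] over measurable sets vanish, any simple function close to [G] in L1 has
    itself a small L1 norm. As f - g need not be integrable, it is first multiplied by r^(|k|+1)
    e^(-r^2).

    The embedding constant is (K + 1) / 2 with K = 1 / (2 (s - m - 1)), the integral of (1 +
    rho^2)^(m - s) rho. It comes from u v <= l u^2 / 2 + v^2 / (2 l) with a single choice of l,
    which gives (K + 1) / 2 in place of the optimal sqrt K. *)

Section RealNorm.
Context (R : realType) (X : normedModType R[i]).
Implicit Types (x y : X) (a : R).

Lemma rnormE x : `|x| = (rnorm x)%:C.
Proof. by rewrite /rnorm RRe_real// normr_real. Qed.

Lemma rnorm_ge0 x : 0 <= rnorm x.
Proof. by rewrite -ler0c -rnormE normr_ge0. Qed.

Lemma rnorm0 : rnorm (0 : X) = 0.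
Proof. by rewrite /rnorm normr0. Qed.

Lemma rnorm0_eq0 x : rnorm x = 0 -> x = 0.
Proof. by move=> h; apply: normr0_eq0; rewrite rnormE h. Qed.

Lemma rnorm_gt0 x : (0 < rnorm x) = (x != 0).
Proof.
rewrite lt_neqAle rnorm_ge0 andbT eq_sym; congr (~~ _).
by apply/eqP/eqP => [/rnorm0_eq0//|->]; rewrite rnorm0.
Qed.

Lemma rnormN x : rnorm (- x) = rnorm x.
Proof. by rewrite /rnorm normrN. Qed.

Lemma rnormB x y : rnorm (x - y) = rnorm (y - x).
Proof. by rewrite /rnorm distrC. Qed.

Lemma ler_rnormD x y : rnorm (x + y) <= rnorm x + rnorm y.
Proof. by rewrite -lecR rmorphD/= -!rnormE ler_normD. Qed.

Lemma ler_rnorm_sum (I : Type) (r : seq I) (F : I -> X) :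
  rnorm (\sum_(i <- r) F i) <= \sum_(i <- r) rnorm (F i).
Proof.
elim/big_rec2: _ => [|i y x _ h]; first by rewrite rnorm0.
by apply: (le_trans (ler_rnormD _ _)); rewrite lerD2l.
Qed.

Lemma rnormZ a x : rnorm (a%:C *: x) = `|a| * rnorm x.
Proof.
apply: complexI; rewrite -rnormE normrZ rnormE rmorphM/=; congr (_ * _).
by rewrite normc_def/= expr0n/= addr0 sqrtr_sqr.
Qed.

(** A positive element of R[i] is real, so the complex-valued radii of balls in [X] and the real
    ones are the same. Through this equivalence limits in [X] are handled by real squeezing. *)
Lemma cvg_rnormP (T : Type) (F : set_system T) {FF : Filter F} (f : T -> X) (l : X) :
  f t @[t --> F] --> l <-> rnorm (f t - l) @[t --> F] --> 0.
Proof.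
split.
- move/cvgrPdist_lt => h; apply/cvgrPdist_lt => e e0.
  have := h e%:C; rewrite ltcR => /(_ e0); apply: filterS => t.
  by rewrite rnormE ltcR rnormB sub0r normrN (ger0_norm (rnorm_ge0 _)).
- move/cvgrPdist_lt => h; apply/cvgrPdist_lt => e e0.
  have eE : e = (complex.Re e)%:C by rewrite RRe_real// gtr0_real.
  rewrite eE; have := h (complex.Re e).
  rewrite eE ltcR in e0 => /(_ e0); apply: filterS => t.
  by rewrite rnormE ltcR rnormB sub0r normrN (ger0_norm (rnorm_ge0 _)).
Qed.

Lemma cvg_rnorm (T : Type) (F : set_system T) {FF : Filter F} (f : T -> X) (l : X) :
  f t @[t --> F] --> l -> rnorm (f t) @[t --> F] --> rnorm l.
Proof.
move/cvg_rnormP/cvgrPdist_le => h; apply/cvgrPdist_le => e /h.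
apply: filterS => t; rewrite sub0r normrN (ger0_norm (rnorm_ge0 _)).
apply: le_trans; rewrite ler_norml; apply/andP; split.
  by rewrite lerNl opprB lerBlDr -{1}(subrK l (f t)) ler_rnormD.
by rewrite lerBlDr rnormB -{1}(subrK (f t) l) ler_rnormD.
Qed.

(** Uses u f - a l = (u - a) f + a (f - l); the norms of f converge, so both terms tend to 0. *)
Lemma cvg_rscale (T : Type) (F : set_system T) {FF : Filter F} (u : T -> R)
  (f : T -> X) a (l : X) : u t @[t --> F] --> a -> f t @[t --> F] --> l ->
  (u t)%:C *: f t @[t --> F] --> a%:C *: l.
Proof.
move=> ua fl; apply/cvg_rnormP.
have h : `|u t - a| * rnorm (f t) + `|a| * rnorm (f t - l) @[t --> F] --> (0 : R).
  rewrite (_ : (0 : R) = `|a - a| * rnorm l + `|a| * 0); last first.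
    by rewrite subrr normr0 mul0r mulr0 addr0.
  apply: cvgD; apply: cvgM; [|exact: cvg_rnorm|exact: cvg_cst|exact/cvg_rnormP].
  by apply: cvg_norm; apply: cvgB => //; exact: cvg_cst.
apply: squeeze_cvgr (cvg_cst (0 : R)) h.
apply: nearW => t; rewrite rnorm_ge0/= -!rnormZ.
apply: le_trans (ler_rnormD _ _); rewrite rmorphB/= scalerBl scalerBr.
by rewrite addrA subrK.
Qed.

Lemma cvg_rnorm_unique (T : Type) (F : set_system T) {FF : ProperFilter F}
  (f : T -> X) (l l' : X) : f t @[t --> F] --> l -> f t @[t --> F] --> l' -> l = l'.
Proof. by move=> h1 h2; apply: (cvg_unique _ h1 h2); exact: norm_hausdorff. Qed.

End RealNorm.

(** * Functions with finitely many values *)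

Section FiniteRange.
Context d (T : measurableType d).

(** [A] may be any set, because only the finitely many level sets over [range u] intersected with
    [A] count. Hence simple functions can be composed with arbitrary maps. *)
Lemma finite_range_preimage (Y : choiceType) (u : T -> Y) (A : set Y) :
  finite_set (range u) -> (forall y, measurable (u @^-1` [set y])) ->
  measurable (u @^-1` A).
Proof.
move=> fu mu.
have -> : u @^-1` A = \bigcup_(y in range u `&` A) (u @^-1` [set y]).
  apply/seteqP; split => [t/= At|t [y [_ Ay]/= ->//]].
  by exists (u t).
apply: fin_bigcup_measurable => //; exact: finite_setIl.
Qed.

Lemma finite_range_comp (Y : Type) (Z : Type) (u : T -> Y) (f : Y -> Z) :
  finite_set (range u) -> finite_set (range (f \o u)).
Proof.
move=> fu; have -> : range (f \o u) = f @` range u by rewrite image_comp.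
exact: finite_image.
Qed.

Lemma finite_range_pair (Y Z : Type) (u : T -> Y) (v : T -> Z) :
  finite_set (range u) -> finite_set (range v) ->
  finite_set (range (fun t => (u t, v t))).
Proof.
move=> fu fv; apply: sub_finite_set (finite_setX fu fv).
by move=> _ [t _ <-] /=; split; exists t.
Qed.

Lemma level_set_pair (Y Z : Type) (u : T -> Y) (v : T -> Z) :
  (forall y, measurable (u @^-1` [set y])) ->
  (forall z, measurable (v @^-1` [set z])) ->
  forall p, measurable ((fun t => (u t, v t)) @^-1` [set p]).
Proof.
move=> mu mv [y z].
rewrite (_ : _ @^-1` _ = u @^-1` [set y] `&` v @^-1` [set z]); first exact: measurableI.
by apply/seteqP; split => t /= [-> ->].
Qed.

End FiniteRange.

(** * Bochner integral *)

Section SimpleFunctions.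
Context d (T : measurableType d) (R : realType) (X : normedModType R[i]).
Variables (mu : {measure set T -> \bar R}) (D : set T).
Hypothesis mD : measurable D.
Implicit Types (s : T -> X).

Lemma simple_fun_comp (Y : choiceType) (u : T -> Y) (f : Y -> X) :
  finite_set (range u) -> (forall y, measurable (u @^-1` [set y])) ->
  simple_fun (f \o u).
Proof.
move=> fu mu'; split; first exact: finite_range_comp.
by move=> x; rewrite comp_preimage; apply: finite_range_preimage.
Qed.

Lemma simple_fun_op2 (Y Z : choiceType) (u : T -> Y) (v : T -> Z) (f : Y -> Z -> X) :
  finite_set (range u) -> (forall y, measurable (u @^-1` [set y])) ->
  finite_set (range v) -> (forall y, measurable (v @^-1` [set y])) ->
  simple_fun (fun t : T => f (u t) (v t)).
Proof.
move=> fu mu' fv mv.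
pose uv t := (u t, v t); rewrite -[fun t => _]/((fun p => f p.1 p.2) \o uv).
apply: simple_fun_comp; first exact: finite_range_pair.
exact: level_set_pair.
Qed.

Lemma simple_fun_cst (x : X) : simple_fun (fun _ : T => x).
Proof.
split; first by apply: sub_finite_set (finite_set1 x) => _ [t _ <-].
move=> y; have [->|yx] := eqVneq y x.
  by rewrite (_ : _ @^-1` _ = setT)//; apply/seteqP; split.
rewrite (_ : _ @^-1` _ = set0)//; apply/seteqP; split => // t /= xy.
by rewrite xy eqxx in yx.
Qed.

Lemma simple_fun_measurable d' (S : measurableType d') s (f : X -> S) (A : set T) :
  measurable A -> simple_fun s -> measurable_fun A (f \o s).
Proof.
move=> mA [fs ms] _ B mB; apply: measurableI => //.
by rewrite comp_preimage; apply: finite_range_preimage.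
Qed.

Lemma simple_integralE s (r : seq X) : uniq r -> (forall t, s t \in r) ->
  simple_integral mu D s =
  \sum_(x <- r) (fine (mu (D `&` s @^-1` [set x])))%:C *: x.
Proof.
move=> ur sr; rewrite /simple_integral; apply: fsbig_fwiden => //.
  by move=> _ [t _ <-]; exact: sr.
move=> x /= [_ nx]; rewrite (_ : D `&` _ = set0) ?measure0 ?scale0r//.
by apply/seteqP; split => // t [_ /= st]; apply: nx; exists t.
Qed.

(** A level set of [f \o u] is a disjoint union of level sets of [u], so the sum over [r] is
    regrouped by the value of [f]. Since [fine] is additive on finite measures only, finiteness is
    asked wherever [f y] is nonzero; the terms with [f y = 0] vanish anyway. *)
Lemma simple_integral_comp (Y : choiceType) (u : T -> Y) (f : Y -> X) (r : seq Y) :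
  (forall y, measurable (u @^-1` [set y])) -> uniq r -> (forall t, u t \in r) ->
  (forall y, f y != 0 -> (mu (D `&` u @^-1` [set y]) < +oo)%E) ->
  simple_integral mu D (f \o u) =
  \sum_(y <- r) (fine (mu (D `&` u @^-1` [set y])))%:C *: f y.
Proof.
move=> mu' ur rr ufin.
pose r' := undup (map f r).
rewrite (@simple_integralE _ r') ?undup_uniq//; last first.
  by move=> t; rewrite mem_undup; apply: map_f; exact: rr.
transitivity (\sum_(x <- r') \sum_(y <- r | f y == x)
    (fine (mu (D `&` u @^-1` [set y])))%:C *: f y).
  apply: eq_bigr => x _; have [->|x0] := eqVneq x 0.
    by rewrite scaler0 big1// => y /eqP ->; rewrite scaler0.
  transitivity ((\sum_(y <- r | f y == x)
      (fine (mu (D `&` u @^-1` [set y]))))%:C *: x); last first.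
    by rewrite rmorph_sum/= scaler_suml; apply: eq_bigr => y /eqP ->.
  congr (_%:C *: _).
  rewrite (_ : D `&` _ = \bigcup_(y in [set` [seq y <- r | f y == x]]) (D `&` u @^-1` [set y])); last first.
    apply/seteqP; split => [t [Dt /= fx]|t [y /=]].
      by exists (u t) => //=; rewrite mem_filter fx eqxx rr.
    by rewrite mem_filter => /andP[/eqP <- _] [Dt /= ->].
  rewrite measure_fin_bigcup//; last 2 first.
    by move=> y z _ _ [t [[_ /= <-] [_ /= <-]]].
    by move=> y _; exact: measurableI.
  rewrite -fsbig_seq ?filter_uniq// big_filter sum_fine// => y /eqP fy.
  by rewrite ge0_fin_numE// ufin// fy.
rewrite (exchange_big_dep predT)//=; apply: eq_big_seq => y yr.
under eq_bigl do rewrite eq_sym.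
by rewrite -big_filter filter_pred1_uniq ?undup_uniq ?mem_undup ?map_f// big_seq1.
Qed.

Lemma finite_range_seq (Y : choiceType) (u : T -> Y) : finite_set (range u) ->
  exists r : seq Y, uniq r /\ forall t, u t \in r.
Proof.
move=> fu; exists (enum_fset (fset_set (range u))).
split=> [|t]; first exact: fset_uniq.
suff : u t \in fset_set (range u) by [].
by rewrite in_fset_set// inE; exists t.
Qed.

Lemma simple_range s : simple_fun s ->
  exists r : seq X, uniq r /\ forall t, s t \in r.
Proof. by move=> [fs _]; exact: finite_range_seq. Qed.

Lemma integral_finite_range (Y : choiceType) (u : T -> Y) (phi : Y -> R) (r : seq Y)
    (A : set T) : measurable A -> (forall y, measurable (u @^-1` [set y])) ->
  uniq r -> (forall t, u t \in r) -> (forall y, 0 <= phi y) ->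
  (\int[mu]_(t in A) (phi (u t))%:E =
   \sum_(y <- r) (phi y)%:E * mu (A `&` u @^-1` [set y]))%E.
Proof.
move=> mA mu' ur rr phi0.
transitivity (\int[mu]_(t in A) \sum_(y <- r)
    ((phi y)%:E * (\1_(u @^-1` [set y]) t)%:E))%E.
  apply: eq_integral => t _; rewrite sumEFin; congr EFin.
  rewrite (bigD1_seq (u t))//= indicE mem_set// mulr1 big1 ?addr0// => y yu.
  by rewrite indicE memNset ?mulr0//= => /esym/eqP; apply/negP.
rewrite ge0_integral_sum//; last 2 first.
  by move=> y; apply/measurable_EFinP; apply: measurable_funM => //; exact: measurable_indic.
  by move=> y t _; rewrite -EFinM lee_fin mulr_ge0.
apply: eq_bigr => y _; rewrite ge0_integralZl//.
- by rewrite integral_indic// setIC.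
- by apply/measurable_EFinP; exact: measurable_indic.
- by rewrite lee_fin phi0.
Qed.

Lemma integral_rnorm_simple s (r : seq X) (A : set T) : measurable A ->
  simple_fun s -> uniq r -> (forall t, s t \in r) ->
  (\int[mu]_(t in A) (rnorm (s t))%:E =
   \sum_(x <- r) (rnorm x)%:E * mu (A `&` s @^-1` [set x]))%E.
Proof.
by move=> mA [_ ms] ur rr; apply: integral_finite_range => // x; exact: rnorm_ge0.
Qed.

Lemma rnorm_simple_integral s : simple_integrable mu D s ->
  ((rnorm (simple_integral mu D s))%:E <= \int[mu]_(t in D) (rnorm (s t))%:E)%E.
Proof.
move=> [ss sfin]; have [r [ur rr]] := simple_range ss.
rewrite (simple_integralE ur rr) (integral_rnorm_simple _ ss ur rr)//.
have -> : (\sum_(x <- r) (rnorm x)%:E * mu (D `&` s @^-1` [set x]) =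
    (\sum_(x <- r) rnorm ((fine (mu (D `&` s @^-1` [set x])))%:C *: x))%:E)%E.
  rewrite -sumEFin; apply: eq_bigr => x _.
  have [->|x0] := eqVneq x 0; first by rewrite scaler0 rnorm0 mul0e.
  rewrite rnormZ ger0_norm ?fine_ge0// mulrC EFinM fineK//.
  by rewrite ge0_fin_numE// sfin.
by rewrite lee_fin ler_rnorm_sum.
Qed.

(** Off the union of the supports of [s1] and [s2] the value is [f 0 0 = 0], and both supports have
    finite measure. *)
Lemma simple_integrable_op2 (f : X -> X -> X) (s1 s2 : T -> X) : f 0 0 = 0 ->
  simple_integrable mu D s1 -> simple_integrable mu D s2 ->
  simple_integrable mu D (fun t => f (s1 t) (s2 t)).
Proof.
move=> f0 [[f1 m1] i1] [[f2 m2] i2].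
split; first exact: simple_fun_op2.
move=> x x0; set A := _ @^-1` _.
have mA : measurable A by exact: (simple_fun_op2 f f1 m1 f2 m2).2.
have fin (s : T -> X) : simple_integrable mu D s ->
    (mu (D `&` s @^-1` (~` [set (0%R : X)])) < +oo)%E.
  move=> [[fs ms] si].
  have -> : D `&` s @^-1` (~` [set (0%R : X)]) =
      \bigcup_(y in range s `&` ~` [set 0]) (D `&` s @^-1` [set y]).
    apply/seteqP; split => [t [Dt st]|t [y [_ y0] [Dt /= sy]]].
      by exists (s t).
    by split => //; rewrite /preimage/= sy.
  rewrite measure_fin_bigcup//.
  - rewrite fsbig_finite; last exact: finite_setIl.
    rewrite big_seq_cond; apply: lte_sum_pinfty => y /andP[+ _].
    rewrite in_fset_set ?inE; last exact: finite_setIl.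
    by move=> [_ /eqP y0]; exact: si.
  - exact: finite_setIl.
  - by move=> y z _ _ [t [[_ /= <-] [_ /= <-]]].
  - by move=> y _; exact: measurableI.
have m0 (s : T -> X) : simple_fun s -> measurable (D `&` s @^-1` (~` [set (0%R : X)])).
  by move=> [fs ms]; apply: measurableI => //; exact: finite_range_preimage.
apply: (@le_lt_trans _ _ (mu ((D `&` s1 @^-1` (~` [set (0%R : X)])) `|`
    (D `&` s2 @^-1` (~` [set (0%R : X)]))))).
  apply: le_measure; rewrite ?inE.
  - exact: measurableI.
  - by apply: measurableU; exact: m0.
  move=> t [Dt] /= At; have [s10|/eqP s10] := eqVneq (s1 t) 0; last by left.
  right; split => //= s20; move: At; rewrite /A/= s10 s20 f0 => /esym/eqP.
  by apply/negP.
apply: (le_lt_trans (measureU2 _ _ _)); try exact: m0.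
by apply: lte_add_pinfty; exact: fin.
Qed.

(** All three integrals become sums over the level sets of the pair of [s1] and [s2], where the
    linearity of [f] acts term by term. *)
Lemma simple_integral_op2 (f : X -> X -> X) (s1 s2 : T -> X) :
  f 0 0 = 0 -> (forall (a : R[i]) x y, a *: f x y = f (a *: x) (a *: y)) ->
  (forall x x' y y', f (x + x') (y + y') = f x y + f x' y') ->
  simple_integrable mu D s1 -> simple_integrable mu D s2 ->
  simple_integral mu D (fun t => f (s1 t) (s2 t)) =
  f (simple_integral mu D s1) (simple_integral mu D s2).
Proof.
move=> f0 fZ fD i1 i2; have [[f1 m1] _] := i1; have [[f2 m2] _] := i2.
pose u t := (s1 t, s2 t).
have mu' : forall y, measurable (u @^-1` [set y]) by exact: level_set_pair.
have fu : finite_set (range u) by exact: finite_range_pair.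
have [r [ur rr]] := finite_range_seq fu.
have fin y : y != 0 -> (mu (D `&` u @^-1` [set y]) < +oo)%E.
  move=> y0; have : (y.1 != 0) || (y.2 != 0).
    by move: y0; apply: contraR; rewrite negb_or !negbK; case: y => y1 y2 /= /andP[/eqP -> /eqP ->].
  case/orP => yn0.
    apply: le_lt_trans (i1.2 _ yn0); apply: le_measure; rewrite ?inE; try exact: measurableI.
    by move=> t [Dt] /= <-.
  apply: le_lt_trans (i2.2 _ yn0); apply: le_measure; rewrite ?inE; try exact: measurableI.
  by move=> t [Dt] /= <-.
have E (g : X * X -> X) : g 0 = 0 -> simple_integral mu D (g \o u) =
    \sum_(y <- r) (fine (mu (D `&` u @^-1` [set y])))%:C *: g y.
  move=> g0; apply: simple_integral_comp => // y gy; apply: fin.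
  by apply: contra_neq gy => ->.
rewrite (E (fun p => f p.1 p.2))// (E fst)// (E snd)//.
elim: (r : seq _) => [|y q IH]; first by rewrite !big_nil f0.
by rewrite !big_cons fD IH fZ.
Qed.

End SimpleFunctions.

(** * Strong measurability *)

Section StronglyMeasurable.
Context d (T : measurableType d) (R : realType) (X : normedModType R[i]).
Implicit Types (f g : T -> X) (u : T -> R).

(** Convergence is asked everywhere, in contrast with [strongly_measurable]: limits are then
    measurable without completeness of the measure. [strongly_measurableP] passes from one notion to
    the other. *)
Definition smeasurable f := exists2 s : nat -> T -> X,
  (forall n, simple_fun (s n)) & forall t, s n t @[n --> \oo] --> f t.

Lemma simple_smeasurable f : simple_fun f -> smeasurable f.
Proof. by move=> sf; exists (fun=> f) => // t; exact: cvg_cst. Qed.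

Lemma smeasurable_op2 (Y Z : normedModType R[i]) (f : T -> Y) (g : T -> Z)
    (op : Y -> Z -> X) :
  (forall (u : nat -> Y) (v : nat -> Z) y z, u n @[n --> \oo] --> y -> v n @[n --> \oo] --> z ->
    op (u n) (v n) @[n --> \oo] --> op y z) ->
  (exists2 s : nat -> T -> Y, (forall n, simple_fun (s n)) &
     forall t, s n t @[n --> \oo] --> f t) ->
  (exists2 s : nat -> T -> Z, (forall n, simple_fun (s n)) &
     forall t, s n t @[n --> \oo] --> g t) ->
  smeasurable (fun t => op (f t) (g t)).
Proof.
move=> opc [s1 ss1 c1] [s2 ss2 c2].
exists (fun n t => op (s1 n t) (s2 n t)); last by move=> t; exact: opc.
by move=> n; have [? ?] := ss1 n; have [? ?] := ss2 n; exact: simple_fun_op2.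
Qed.

Lemma smeasurableD f g : smeasurable f -> smeasurable g ->
  smeasurable (fun t => f t + g t).
Proof. by apply: (smeasurable_op2 (op := fun x y => x + y)) => *; exact: cvgD. Qed.

Lemma smeasurableB f g : smeasurable f -> smeasurable g ->
  smeasurable (fun t => f t - g t).
Proof. by apply: (smeasurable_op2 (op := fun x y => x - y)) => *; exact: cvgB. Qed.

Lemma smeasurableZ (u : T -> R) f : measurable_fun setT u -> smeasurable f ->
  smeasurable (fun t => (u t)%:C *: f t).
Proof.
move=> mu' [s ss cs].
have /measurable_EFinP mu := mu'.
have [v cv] := approximation_sfun measurableT mu.
exists (fun n t => (v n t)%:C *: s n t).
  move=> n; have [? ?] := ss n.
  by apply: (simple_fun_op2 (fun (a : R) x => a%:C *: x)) => // y.
by move=> t; apply: cvg_rscale => //; have /fine_cvgP[] := cv t I.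
Qed.

Lemma smeasurable_rnorm f (A : set T) : measurable A -> smeasurable f ->
  measurable_fun A (fun t => rnorm (f t)).
Proof.
move=> mA [s ss cs]; apply: (@measurable_fun_cvg _ _ _ _ (fun n t => rnorm (s n t))).
  by move=> n; exact: (simple_fun_measurable (@rnorm R X)).
by move=> t _; apply: cvg_rnorm.
Qed.

Lemma smeasurable_indic f (A : set T) : measurable A -> smeasurable f ->
  smeasurable (fun t => (\1_A t : R)%:C *: f t).
Proof. by move=> mA sf; apply: smeasurableZ => //; exact: measurable_indic. Qed.

Variables (mu : {measure set T -> \bar R}) (D : set T).
Hypothesis mD : measurable D.

(** With N the exceptional null set, [f] and its approximants are multiplied by the indicator of D
    minus N; they then converge everywhere, to 0 off that set. *)
Lemma strongly_measurableP f : strongly_measurable mu D f ->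
  exists2 g, smeasurable g & {ae mu, forall t, D t -> f t = g t}.
Proof.
move=> [s ss [N [mN N0 sub]]].
have mDN : measurable (D `\` N) by exact: measurableD.
exists (fun t => (\1_(D `\` N) t : R)%:C *: f t).
  exists (fun n t => (\1_(D `\` N) t : R)%:C *: s n t).
    move=> n; have [? ?] := ss n.
    apply: (simple_fun_op2 (fun (a : R) x => a%:C *: x)) => //.
    by move=> y; exact: (measurable_sfunP (indic_nnsfun R mDN)).
  move=> t; rewrite indicE; have [tDN|tDN] := boolP (t \in _).
    have [Dt Nt] := set_mem tDN.
    apply: cvgZ; first exact: cvg_cst.
    by apply: contrapT => h; apply: Nt; apply: sub => /= /(_ Dt).
  rewrite scale0r.
  rewrite (_ : (fun n => _) = fun=> 0); first exact: cvg_cst.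
  by apply/funext => n; rewrite scale0r.
exists N; split => // t /= h; apply: contrapT => Nt; apply: h => Dt.
by rewrite indicE mem_set ?scale1r.
Qed.

Lemma smeasurable_strongly f g : smeasurable g ->
  {ae mu, forall t, D t -> f t = g t} -> strongly_measurable mu D f.
Proof.
move=> [s ss cs] fg; exists s => //; apply: filterS fg => t fg Dt.
by rewrite fg.
Qed.

(** [f] and [g] may be nonmeasurable, as are the norms met when a Bochner integrand is changed on a
    null set. The integral is a supremum over simple functions below the integrand, and each of
    these can be set to 0 on the null set without changing its own integral. *)
Lemma integral_ae_eq (f g : T -> R) : (forall t, D t -> 0 <= f t) ->
  (forall t, D t -> 0 <= g t) -> {ae mu, forall t, D t -> f t = g t} ->
  (\int[mu]_(t in D) (f t)%:E = \int[mu]_(t in D) (g t)%:E)%E.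
Proof.
move=> f0 g0 fg.
suff le (f' g' : T -> R) : (forall t, D t -> 0 <= f' t) -> (forall t, D t -> 0 <= g' t) ->
    {ae mu, forall t, D t -> f' t = g' t} ->
    (\int[mu]_(t in D) (f' t)%:E <= \int[mu]_(t in D) (g' t)%:E)%E.
  apply/eqP; rewrite eq_le !le//.
  by apply: filterS fg => t fg Dt; rewrite fg.
move=> {f0 g0 fg}f0 g0 [N [mN N0 sub]].
rewrite ge0_integralE//= ge0_integralE//=.
apply: ge_ereal_sup => _ [h /= hf <-].
pose h' := mul_nnsfun h (indic_nnsfun R (measurableC mN)).
have hh' : sintegral mu h = sintegral mu h'.
  rewrite -!integralT_nnsfun; apply: ge0_ae_eq_integral => //.
  - by apply/measurable_EFinP.
  - by apply/measurable_EFinP.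
  - by move=> t _; rewrite lee_fin.
  - by move=> t _; rewrite lee_fin.
  exists N; split => // t /= ht; apply: contrapT => Nt; apply: ht => _.
  by rewrite /= mindicE mem_set// mulr1.
rewrite hh'; apply: ereal_sup_ubound; exists h' => //= t.
rewrite mindicE; have [/set_mem Nt|_] := boolP (t \in _).
  rewrite mulr1; apply: (le_trans (hf t)); rewrite !patchE; case: ifP => // /set_mem Dt.
  by rewrite lee_fin; suff -> : f' t = g' t by []; apply: contrapT => h0; apply: Nt; apply: sub => /= /(_ Dt).
by rewrite mulr0 patchE; case: ifP => // /set_mem Dt; rewrite lee_fin g0.
Qed.

End StronglyMeasurable.

(** * Linearity, norm bound, uniqueness and approximation *)

Section BochnerIntegral.
Context d (T : measurableType d) (R : realType) (X : normedModType R[i]).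
Variables (mu : {measure set T -> \bar R}) (D : set T).
Hypothesis mD : measurable D.
Implicit Types (f g : T -> X) (v w : X).

Definition L1norm f : \bar R := (\int[mu]_(t in D) (rnorm (f t))%:E)%E.

Definition L1dist f g : \bar R := L1norm (fun t => f t - g t).

Lemma L1norm_ge0 f : (0 <= L1norm f)%E.
Proof. by apply: integral_ge0 => t _; rewrite lee_fin rnorm_ge0. Qed.

Lemma L1normD_le (c1 c2 : R) f g h : smeasurable f -> smeasurable g -> smeasurable h ->
  0 <= c1 -> 0 <= c2 ->
  (forall t, D t -> rnorm (h t) <= c1 * rnorm (f t) + c2 * rnorm (g t)) ->
  (L1norm h <= c1%:E * L1norm f + c2%:E * L1norm g)%E.
Proof.
move=> mf mg mh c10 c20 le.
have m k : smeasurable k -> measurable_fun D (fun t => (rnorm (k t))%:E).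
  by move=> mk; apply/measurable_EFinP; exact: smeasurable_rnorm.
have p (c : R) (k : T -> X) t : 0 <= c -> (0 <= c%:E * (rnorm (k t))%:E)%E.
  by move=> c0; rewrite -EFinM lee_fin mulr_ge0// rnorm_ge0.
rewrite /L1norm -!ge0_integralZl//; try exact: m;
  try (by move=> t _; rewrite lee_fin rnorm_ge0).
rewrite -ge0_integralD//; try (by move=> t _; exact: p);
  try (by apply: measurable_funeM; exact: m).
apply: ge0_le_integral => //.
- by move=> t _; rewrite lee_fin rnorm_ge0.
- exact: m.
- by apply: emeasurable_funD; apply: measurable_funeM; exact: m.
Qed.

Lemma ae_L1normB f f' (s : T -> X) :
  {ae mu, forall t, D t -> f t = f' t} ->
  L1dist f s = L1dist f' s.
Proof.
move=> ff'; apply: integral_ae_eq => //; try (by move=> t _; rewrite rnorm_ge0).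
by apply: filterS ff' => t ff' Dt; rewrite ff'.
Qed.

Lemma is_bochner_integral_ae f g v : {ae mu, forall t, D t -> f t = g t} ->
  is_bochner_integral mu D f v -> is_bochner_integral mu D g v.
Proof.
move=> fg [sf [s [hi fs sv]]]; split.
  have [h mh fh] := strongly_measurableP mD sf.
  apply: (smeasurable_strongly mh); apply: filterS2 fg fh => t fg fh Dt.
  by rewrite -fg// fh.
exists s; split => //; apply: cvg_trans fs; apply: near_eq_cvg; apply: nearW => n.
exact: ae_L1normB.
Qed.

Lemma is_bochner_integral_smeasurable f v : is_bochner_integral mu D f v ->
  exists g, [/\ smeasurable g, {ae mu, forall t, D t -> f t = g t} &
    is_bochner_integral mu D g v].
Proof.
move=> bf; have [g mg fg] := strongly_measurableP mD bf.1.
by exists g; split => //; exact: is_bochner_integral_ae bf.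
Qed.

(** For large n the L1 distance from [f] to the simple integrable [s n] is finite, and the triangle
    inequality applies. *)
Lemma bochner_L1norm_lty f v : smeasurable f -> is_bochner_integral mu D f v ->
  (L1norm f < +oo)%E.
Proof.
move=> mf [_ [s [hi fs _]]].
have /fine_cvgP[fin _] := fs; near \oo => n.
have L1s : (L1norm (s n) < +oo)%E.
  have [[fr ms] si] := hi n; have [r [ur rr]] := simple_range (hi n).1.
  rewrite /L1norm (integral_rnorm_simple mu mD (hi n).1 ur rr).
  apply: lte_sum_pinfty => x _; have [->|x0] := eqVneq x 0.
    by rewrite rnorm0 mul0e.
  by rewrite lte_mul_pinfty// ?lee_fin ?rnorm_ge0// si.
have : (L1dist f (s n) < +oo)%E.
  by rewrite -ge0_fin_numE ?L1norm_ge0//; near: n.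
move=> L1f; apply: (@le_lt_trans _ _ (1%:E * L1dist f (s n) + 1%:E * L1norm (s n))%E).
  apply: L1normD_le => //.
  - by apply: smeasurableB => //; apply: simple_smeasurable; exact: (hi n).1.
  - by apply: simple_smeasurable; exact: (hi n).1.
  - move=> t _; rewrite !mul1r; apply: le_trans (ler_rnormD _ _).
    by rewrite subrK.
by rewrite !mul1e; exact: lte_add_pinfty.
Unshelve. all: by end_near. Qed.

Lemma rnorm_bochner_le f v : smeasurable f -> is_bochner_integral mu D f v ->
  ((rnorm v)%:E <= L1norm f)%E.
Proof.
move=> mf bf; have ffin := bochner_L1norm_lty mf bf; have [_ [s [hi fs sv]]] := bf.
have h : (L1norm f + L1dist f (s n) @[n --> \oo] --> L1norm f + 0)%E.
  apply: cvgeD => //; first by rewrite fin_num_adde_defl.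
  exact: cvg_cst.
rewrite -[leRHS]adde0.
apply: (@lee_cvg_to _ _ _ _ (fun n => (rnorm (simple_integral mu D (s n)))%:E) _ _ _ _ h).
  by apply: cvg_EFin; [exact: nearW|exact: cvg_rnorm sv].
apply: nearW => n.
apply: (le_trans (rnorm_simple_integral mD (hi n))).
rewrite -[L1norm f]mul1e -[L1dist _ _]mul1e.
apply: L1normD_le => //.
- by apply: smeasurableB => //; apply: simple_smeasurable; exact: (hi n).1.
- by apply: simple_smeasurable; exact: (hi n).1.
- move=> t _; rewrite !mul1r -(rnormN (f t - s n t)).
  by apply: le_trans (ler_rnormD _ _); rewrite opprB addrC subrK.
Qed.

Lemma is_bochner_integral_comb (a b : R) f g v w :
  is_bochner_integral mu D f v -> is_bochner_integral mu D g w ->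
  is_bochner_integral mu D (fun t => a%:C *: f t + b%:C *: g t) (a%:C *: v + b%:C *: w).
Proof.
move=> /is_bochner_integral_smeasurable[f' [mf ff' bf]].
move=> /is_bochner_integral_smeasurable[g' [mg gg' bg]].
have mlc f1 g1 : smeasurable f1 -> smeasurable g1 ->
    smeasurable (fun t => a%:C *: f1 t + b%:C *: g1 t).
  by move=> m1 m2; apply: smeasurableD; apply: smeasurableZ => //; exact: measurable_cst.
apply: (@is_bochner_integral_ae (fun t => a%:C *: f' t + b%:C *: g' t)).
  by apply: filterS2 ff' gg' => t h1 h2 Dt; rewrite h1// h2.
have [_ [s [hi fs sv]]] := bf; have [_ [s' [hi' gs sw]]] := bg.
split; first by apply: (smeasurable_strongly (mlc _ _ mf mg)); exact: nearW.
exists (fun n t => a%:C *: s n t + b%:C *: s' n t); split.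
- by move=> n; apply: (simple_integrable_op2 mD (f := fun x y => a%:C *: x + b%:C *: y)) => //; rewrite !scaler0 addr0.
- have h : ((`|a|%:E * L1dist f' (s n) + `|b|%:E * L1dist g' (s' n))%E
      @[n --> \oo] --> 0%E).
    rewrite [X in _ --> X](_ : _ = `|a|%:E * 0 + `|b|%:E * 0)%E; last first.
      by rewrite !mule0 adde0.
    by apply: cvgeD; [rewrite !mule0|apply: cvgeZl|apply: cvgeZl].
  apply: squeeze_cvge (cvg_cst 0%E) h; apply: nearW => n; rewrite L1norm_ge0/=.
  have ms1 := simple_smeasurable (hi n).1; have ms2 := simple_smeasurable (hi' n).1.
  apply: L1normD_le => //; [exact: smeasurableB|exact: smeasurableB| |].
    by apply: smeasurableB; exact: mlc.
  move=> t _; rewrite -!rnormZ; apply: le_trans (ler_rnormD _ _).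
  by rewrite !scalerBr opprD addrACA.
- have -> : (fun n => simple_integral mu D (fun t => a%:C *: s n t + b%:C *: s' n t)) =
      (fun n => a%:C *: simple_integral mu D (s n) + b%:C *: simple_integral mu D (s' n)).
    apply/funext => n.
    apply: (simple_integral_op2 mD (f := fun x y => a%:C *: x + b%:C *: y)) => //.
    + by rewrite !scaler0 addr0.
    + by move=> c x y; rewrite scalerDr !scalerA [c * _]mulrC [c * _]mulrC.
    + by move=> x x' y y'; rewrite !scalerDr addrACA.
  by apply: cvgD; apply: cvgZ => //; exact: cvg_cst.
Qed.

(** By linearity [v - w] is an integral of the zero function, so the norm bound makes it 0. This
    gives [bochner_integral] its meaning. *)
Lemma is_bochner_integral_unique f v w :
  is_bochner_integral mu D f v -> is_bochner_integral mu D f w -> v = w.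
Proof.
move=> /is_bochner_integral_smeasurable[g [mg fg bv]] bw'.
have bw := is_bochner_integral_ae fg bw'.
have := is_bochner_integral_comb 1 (-1) bv bw.
set h := fun t => _; move=> bh.
have h0 t : h t = 0 by rewrite /h rmorphN/= scale1r scaleN1r subrr.
have mh : smeasurable h.
  apply: simple_smeasurable; rewrite (_ : h = fun=> 0); last exact/funext.
  exact: simple_fun_cst.
have := rnorm_bochner_le mh bh.
rewrite /L1norm integral0_eq => [|t _]; last by rewrite h0 rnorm0.
rewrite lee_fin rmorphN/= scale1r scaleN1r => le0.
apply/eqP; rewrite -subr_eq0; apply/eqP/rnorm0_eq0/eqP.
by rewrite eq_le le0 rnorm_ge0.
Qed.

Lemma bochner_integralE f v : is_bochner_integral mu D f v ->
  bochner_integral mu D f = v.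
Proof.
move=> bv; apply: (@is_bochner_integral_unique f) => //.
exact: (@xgetPex _ 0 (is_bochner_integral mu D f) (ex_intro _ v bv)).
Qed.

Lemma bochner_integralP f : bochner_integrable mu D f ->
  is_bochner_integral mu D f (bochner_integral mu D f).
Proof. by move=> [v bv]; rewrite (bochner_integralE bv). Qed.

Lemma simple_integrable_lty (s : T -> X) : simple_fun s -> (L1norm s < +oo)%E ->
  simple_integrable mu D s.
Proof.
move=> ss fin; split => // x x0.
have [r [ur rr]] := simple_range ss.
have [xr|xr] := boolP (x \in r); last first.
  rewrite (_ : D `&` _ = set0) ?measure0//.
  by apply/seteqP; split => // t [_ /= sx]; rewrite -sx rr in xr.
move: fin; rewrite /L1norm (integral_rnorm_simple mu mD ss ur rr).
rewrite (bigD1_seq x)//= => fin.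
have {fin} : ((rnorm x)%:E * mu (D `&` s @^-1` [set x]) < +oo)%E.
  apply: le_lt_trans fin; rewrite leeDl// sume_ge0// => y _.
  by rewrite mule_ge0// lee_fin rnorm_ge0.
apply: contraTT; rewrite -!leNgt !leye_eq => /eqP ->.
by rewrite gt0_muley// lte_fin rnorm_gt0.
Qed.

(** The approximants are cut to 0 where their norm exceeds twice that of [f], which makes 3 |f| a
    dominating function. Where [f t] is nonzero the cut is eventually inactive, as |f t| < 2 |f t|;
    where [f t = 0] it forces the value 0. *)
Lemma smeasurable_approx f : smeasurable f -> (L1norm f < +oo)%E ->
  exists2 s : nat -> T -> X, (forall n, simple_integrable mu D (s n)) &
    L1dist f (s n) @[n --> \oo] --> 0%E.
Proof.
move=> mf ffin; have [s ss cs] := mf.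
pose A n := [set t | rnorm (s n t) <= 2 * rnorm (f t)].
have mA n : measurable (A n).
  have m : measurable_fun setT (fun t => 2 * rnorm (f t) - rnorm (s n t)).
    apply: measurable_funB; last exact: (simple_fun_measurable (@rnorm R X)).
    by apply: measurable_funM => //; exact: smeasurable_rnorm.
  have := m measurableT `[0, +oo[%classic (measurable_itv _).
  rewrite setTI; congr measurable; apply/seteqP; split => t /=.
    by rewrite in_itv/= andbT subr_ge0.
  by rewrite /A/= in_itv/= andbT subr_ge0.
pose s' n t := (\1_(A n) t : R)%:C *: s n t.
have ss' n : simple_fun (s' n).
  have [? ?] := ss n; apply: (simple_fun_op2 (fun (a : R) x => a%:C *: x)) => //.
  by move=> y; exact: (measurable_sfunP (indic_nnsfun R (mA n))).
have le2 n t : rnorm (s' n t) <= 2 * rnorm (f t).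
  rewrite /s' rnormZ indicE; have [/set_mem At|_] := boolP (t \in _).
    by rewrite normr1 mul1r.
  by rewrite normr0 mul0r mulr_ge0// rnorm_ge0.
have cs' t : s' n t @[n --> \oo] --> f t.
  have [f0|f0] := eqVneq (f t) 0.
    rewrite f0 (_ : (fun n => _) = fun=> 0); first exact: cvg_cst.
    apply/funext => n; apply: rnorm0_eq0; apply/eqP; rewrite eq_le rnorm_ge0 andbT.
    by apply: (le_trans (le2 n t)); rewrite f0 rnorm0 mulr0.
  apply: cvg_trans (cs t); apply: near_eq_cvg.
  have f2 : rnorm (f t) < 2 * rnorm (f t) by rewrite ltr_pMl ?rnorm_gt0// ltr1n.
  have [N _ hN] := cvgr_lt _ (cvg_rnorm (cs t)) _ f2.
  exists N => // n Nn /=; have h := hN _ Nn.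
  by rewrite /s' indicE mem_set ?scale1r//; exact: ltW.
exists s'.
  move=> n; apply: simple_integrable_lty => //.
  apply: (@le_lt_trans _ _ (2%:E * L1norm f + 0%:E * L1norm f)%E).
    apply: L1normD_le => //; first exact: simple_smeasurable.
    by move=> t _; rewrite mul0r addr0.
  by rewrite mul0e adde0 lte_mul_pinfty// lee_fin.
have ms n : smeasurable (fun t => f t - s' n t).
  by apply: smeasurableB => //; exact: simple_smeasurable.
have := @dominated_convergence _ T R mu D mD
  (fun n t => (rnorm (f t - s' n t))%:E) (cst 0%E) (fun t => (3 * rnorm (f t))%:E).
case.
- by move=> n; apply/measurable_EFinP; exact: smeasurable_rnorm.
- exact: measurable_cst.
- apply: nearW => t _; apply: cvg_EFin; first exact: nearW.
  rewrite -[X in _ --> X](rnorm0 X) -(subrr (f t)); apply: cvg_rnorm.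
  by apply: cvgB => //; exact: cvg_cst.
- apply/integrableP; split.
    by apply/measurable_EFinP; apply: measurable_funM => //; exact: smeasurable_rnorm.
  under eq_integral do rewrite gee0_abs ?lee_fin ?mulr_ge0 ?rnorm_ge0// EFinM.
  rewrite ge0_integralZl//.
  + by rewrite lte_mul_pinfty// lee_fin.
  + by apply/measurable_EFinP; exact: smeasurable_rnorm.
  + by move=> t _; rewrite lee_fin rnorm_ge0.
- apply: nearW => t n _; rewrite gee0_abs ?lee_fin ?rnorm_ge0//.
  apply: le_trans (ler_rnormD _ _) _; rewrite rnormN.
  have -> : 3 * rnorm (f t) = rnorm (f t) + 2 * rnorm (f t) by ring.
  by rewrite lerD2l.
by move=> _ _; rewrite integral0.
Qed.

End BochnerIntegral.

(** * Existence of the Bochner integral in a complete space *)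

Section BochnerExistence.
Context d (T : measurableType d) (R : realType) (X : completeNormedModType R[i]).
Variables (mu : {measure set T -> \bar R}) (D : set T).
Hypothesis mD : measurable D.
Implicit Types (f g : T -> X).

Lemma cauchy_rnorm_cvg (u : nat -> X) :
  (forall e : R, 0 < e -> exists N, forall n m, (N <= n)%N -> (N <= m)%N ->
     rnorm (u n - u m) < e) -> cvgn u.
Proof.
move=> h; apply: cauchy_cvg; apply: cauchy_exP => e e0.
have eE : e = (complex.Re e)%:C by rewrite RRe_real// gtr0_real.
have [|N hN] := h (complex.Re e); first by rewrite -ltcR -eE.
exists (u N); exists N => // n /= Nn.
by rewrite -ball_normE /ball_/= rnormE eE ltcR; exact: hN.
Qed.

(** The integrals of the simple approximants form a Cauchy sequence, since two of them differ by at
    most the sum of the L1 distances to [f]. *)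
Lemma bochner_exists f : smeasurable f -> (L1norm mu D f < +oo)%E ->
  bochner_integrable mu D f.
Proof.
move=> mf ffin; have [s si cs] := smeasurable_approx mD mf ffin.
have ms n := simple_smeasurable (si n).1.
suff /cvg_ex[v cv] : cvgn (fun n => simple_integral mu D (s n)).
  exists v; split; last by exists s.
  by apply: (smeasurable_strongly mf); exact: nearW.
apply: cauchy_rnorm_cvg => e e0.
have /fine_cvgP[fin /cvgrPdist_lt/(_ (e / 2))] := cs.
rewrite divr_gt0// => /(_ isT) h.
have [N _ hN] := filterI fin h.
exists N => n m Nn Nm; have [fn hn] := hN _ Nn; have [fm hm] := hN _ Nm.
move: hn hm; rewrite /= !sub0r !normrN !ger0_norm ?fine_ge0 ?L1norm_ge0// => hn hm.
have -> : simple_integral mu D (s n) - simple_integral mu D (s m) =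
    simple_integral mu D (fun t => s n t - s m t).
  symmetry; apply: (simple_integral_op2 mD (f := fun x y => x - y)) => //.
  - by rewrite subrr.
  - by move=> a x y; rewrite scalerBr.
  - by move=> x x' y y'; rewrite opprD addrACA.
rewrite -lte_fin.
apply: (le_lt_trans (rnorm_simple_integral mD (simple_integrable_op2 mD (f := fun x y => x - y) (subrr 0) (si n) (si m)))).
apply: (@le_lt_trans _ _ (L1dist mu D f (s n) + L1dist mu D f (s m))%E).
  rewrite -[L1dist mu D f (s n)]mul1e -[L1dist mu D f (s m)]mul1e.
  apply: L1normD_le => //; try exact: smeasurableB.
  move=> t _; rewrite !mul1r (rnormB (f t) (s n t)).
  by apply: le_trans (ler_rnormD _ _); rewrite addrA subrK.
rewrite -(fineK fn) -(fineK fm) -EFinD lte_fin [ltRHS](splitr e).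
exact: ltrD.
Qed.

End BochnerExistence.

(** * Scalar functions times a fixed vector *)

Section ScalarTimesVector.
Context d (T : measurableType d) (R : realType) (X : normedModType R[i]).
Variables (mu : {measure set T -> \bar R}) (D : set T).
Hypothesis mD : measurable D.

Lemma simple_integral_scalar (g : {nnsfun T >-> R}) (x : X) :
  simple_integrable mu D (fun t => (g t)%:C *: x) ->
  simple_integral mu D (fun t => (g t)%:C *: x) =
  (fine (\int[mu]_(t in D) (g t)%:E))%:C *: x.
Proof.
move=> si; have [x0|x0] := eqVneq x 0.
  rewrite x0 scaler0 /simple_integral fsbig1// => _ [t _ <-].
  by rewrite !scaler0.
have mg y : measurable (g @^-1` [set y]) by exact: measurable_sfunP.
have [r [ur rr]] := finite_range_seq (fimfunP g).
have fin y : y != 0 -> (mu (D `&` g @^-1` [set y]) < +oo)%E.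
  move=> y0; have yx : (y%:C *: x) != 0.
    by rewrite scaler_eq0 negb_or x0 andbT; apply: contra_neq y0 => /complexI.
  apply: le_lt_trans (si.2 _ yx); apply: le_measure; rewrite ?inE.
  - exact: measurableI.
  - by apply: measurableI => //; exact: (si.1).2.
  - by move=> t [Dt /= <-].
rewrite (@simple_integral_comp _ _ _ _ _ _ mD _ g (fun y => y%:C *: x) r)//; last first.
  by move=> y yx; apply: fin; apply: contra_neq yx => ->; rewrite scale0r.
(* [integral_finite_range] wants a weight that is nonnegative on all of R, hence the absolute value;
   the values of [g] are nonnegative, and a negative [y] in [r] has an empty level set. *)
rewrite (_ : \int[mu]_(t in D) _ = \sum_(y <- r) (`|y|%:E * mu (D `&` g @^-1` [set y])))%E; last first.
  rewrite -(@integral_finite_range _ _ _ _ _ g (fun y => `|y|) r)//.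
  by apply: eq_integral => t _; rewrite ger0_norm.
rewrite -sum_fine => [|y _]; last first.
  have [->|y0] := eqVneq y 0; first by rewrite normr0 mul0e.
  by rewrite fin_numM// ge0_fin_numE// fin.
rewrite rmorph_sum/= scaler_suml; apply: eq_bigr => y _.
have [y0|y0|->] := ltgtP y 0; last by rewrite scale0r scaler0 normr0 mul0e scale0r.
  rewrite (_ : D `&` _ = set0) ?measure0 ?scale0r ?mule0 ?scale0r//.
  by apply/seteqP; split => // t [_ /= gy]; have : 0 <= g t by []; rewrite gy leNgt y0.
rewrite fineM//=; last by rewrite ge0_fin_numE// fin// gt_eqF.
by rewrite gtr0_norm// scalerA -rmorphM/= mulrC.
Qed.

Lemma is_bochner_integral_ge0_scalar (u : T -> R) (x : X) : measurable_fun setT u ->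
  (forall t, 0 <= u t) -> (\int[mu]_(t in D) (u t)%:E < +oo)%E ->
  is_bochner_integral mu D (fun t => (u t)%:C *: x)
    ((fine (\int[mu]_(t in D) (u t)%:E))%:C *: x).
Proof.
move=> mu_ u0 ufin.
have muE : measurable_fun setT (EFin \o u) by exact/measurable_EFinP.
have mfu : measurable_fun D (EFin \o u) by apply: measurable_funS muE.
have [g [gnd gu]] := approximation measurableT muE (fun t _ => u0 t).
have gc t : g n t @[n --> \oo] --> u t by have /fine_cvgP[] := gu t I.
have gle n t : g n t <= u t.
  rewrite -(cvg_lim _ (gc t))//; apply: nondecreasing_cvgn_le.
    by move=> p q pq; exact/lefP/gnd.
  by apply/cvg_ex; exists (u t).
have mg n : measurable_fun D (EFin \o g n).
  by apply/measurable_EFinP; apply: measurable_funTS.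
have iu : mu.-integrable D (EFin \o u).
  apply/integrableP; split => //.
  by under eq_integral do rewrite gee0_abs ?lee_fin//.
have gfin n : (\int[mu]_(t in D) (g n t)%:E < +oo)%E.
  apply: le_lt_trans ufin; apply: ge0_le_integral => //.
  - by move=> t _; rewrite lee_fin.
  - exact: mg.
  - by move=> t _; rewrite lee_fin.
have gule : {ae mu, forall t n, D t -> (`|(g n t)%:E| <= (u t)%:E)%E}.
  by apply: nearW => t n _; rewrite /= ger0_norm// lee_fin.
have ae_gu : {ae mu, forall t, D t -> (EFin \o g^~ t) n @[n --> \oo] --> (u t)%:E}.
  by apply: nearW => t _; exact: gu.
have [_ d0 d1] := dominated_convergence mD mg mfu ae_gu iu gule.
have Lg n : L1norm mu D (fun t => (g n t)%:C *: x) =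
    ((rnorm x)%:E * \int[mu]_(t in D) (g n t)%:E)%E.
  rewrite /L1norm -ge0_integralZl//.
  - by apply: eq_integral => t _; rewrite rnormZ ger0_norm// mulrC EFinM.
  - exact: mg.
  - by move=> t _; rewrite lee_fin.
  - by rewrite lee_fin rnorm_ge0.
have si n : simple_integrable mu D (fun t => (g n t)%:C *: x).
  apply: simple_integrable_lty => //.
    by apply: (simple_fun_comp (fun a : R => a%:C *: x)).
  by rewrite Lg lte_mul_pinfty// lee_fin rnorm_ge0.
have mux : smeasurable (fun t => (u t)%:C *: x).
  by apply: smeasurableZ => //; apply: simple_smeasurable; exact: simple_fun_cst.
split; first by apply: (smeasurable_strongly mux); exact: nearW.
exists (fun n t => (g n t)%:C *: x); split => //.
- have h : ((rnorm x)%:E * \int[mu]_(t in D) `|(g n t)%:E - (u t)%:E|)%E @[n --> \oo] --> 0%E.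
    by rewrite -(mule0 (rnorm x)%:E); apply: cvgeZl.
  apply: cvg_trans h; apply: near_eq_cvg; apply: nearW => n.
  rewrite -ge0_integralZl//.
  + apply: eq_integral => t _; rewrite -scalerBl -rmorphB/= rnormZ mulrC EFinM.
    by rewrite distrC.
  + apply: measurableT_comp => //; apply: emeasurable_funB => //; exact: mg.
  + by rewrite lee_fin rnorm_ge0.
- under eq_fun do rewrite simple_integral_scalar//.
  apply: cvg_rscale; last exact: cvg_cst.
  apply: fine_cvg; rewrite fineK//.
  by rewrite ge0_fin_numE// integral_ge0// => t _; rewrite lee_fin.
Qed.

Lemma is_bochner_integral_scalar (u : T -> R) (x : X) : measurable_fun setT u ->
  mu.-integrable D (EFin \o u) ->
  is_bochner_integral mu D (fun t => (u t)%:C *: x)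
    ((fine (\int[mu]_(t in D) (u t)%:E))%:C *: x).
Proof.
move=> mu_ iu.
have ip := integrable_funrpos mD iu; have im := integrable_funrneg mD iu.
have fin (w : T -> R) : mu.-integrable D (EFin \o w) -> (\int[mu]_(t in D) (w t)%:E < +oo)%E.
  by move=> iw; rewrite ltey_eq; have := integrable_fin_num mD iw => /= ->.
have bp := is_bochner_integral_ge0_scalar x (measurable_funrpos mu_) (funrpos_ge0 u) (fin _ ip).
have bm := is_bochner_integral_ge0_scalar x (measurable_funrneg mu_) (funrneg_ge0 u) (fin _ im).
have := is_bochner_integral_comb mD 1 (-1) bp bm.
rewrite !scale1r rmorphN/= scaleN1r -scalerBl -rmorphB/=.
rewrite -fineB; try exact: (integrable_fin_num mD).
rewrite -integralB_EFin// => h.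
have -> : (\int[mu]_(t in D) (u t)%:E = \int[mu]_(t in D) ((u^\+ t)%:E - (u^\- t)%:E))%E.
  by apply: eq_integral => t _; rewrite -EFinB -[in LHS](funrposBneg u).
apply: is_bochner_integral_ae h => //; apply: nearW => t _.
by rewrite !scale1r scaleN1r -scalerBl -rmorphB/= -[in RHS](funrposBneg u).
Qed.

End ScalarTimesVector.

(** * Integrals of a vector function against scalar weights *)

Section WeightedIntegral.
Context d (T : measurableType d) (R : realType) (X : completeNormedModType R[i]).
Variables (mu : {measure set T -> \bar R}) (D : set T).
Hypothesis mD : measurable D.
Implicit Types (F G : T -> X) (w : T -> R).

(** The bound is local to [D], as powers of rho are controlled for rho > 0 only, while measurability
    is global to fit [smeasurableZ]. *)
Definition bounded_weight w := measurable_fun setT w /\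
  exists C : R, forall t, D t -> `|w t| <= C.

Lemma bounded_weight_comb (a b : R) w1 w2 : bounded_weight w1 -> bounded_weight w2 ->
  bounded_weight (fun t => a * w1 t + b * w2 t).
Proof.
move=> [m1 [C1 b1]] [m2 [C2 b2]]; split.
  by apply: measurable_funD; apply: measurable_funM.
exists (`|a| * C1 + `|b| * C2) => t Dt; apply: (le_trans (ler_normD _ _)).
by rewrite !normrM lerD// ler_wpM2l// ?b1 ?b2.
Qed.

Lemma bounded_weightM w1 w2 : bounded_weight w1 -> bounded_weight w2 ->
  bounded_weight (fun t => w1 t * w2 t).
Proof.
move=> [m1 [C1 b1]] [m2 [C2 b2]]; split; first exact: measurable_funM.
by exists (C1 * C2) => t Dt; rewrite normrM ler_pM// ?b1 ?b2.
Qed.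

Lemma bounded_weight_cst (a : R) : bounded_weight (fun=> a).
Proof. by split; [exact: measurable_cst|exists `|a|]. Qed.

Lemma bounded_weight_indic (A : set T) : measurable A ->
  bounded_weight (\1_A : T -> R).
Proof.
move=> mA; split; first exact: measurable_indic.
by exists 1 => t _; rewrite indicE; case: (_ \in _); rewrite ?normr1 ?normr0.
Qed.

(** [F] carries the integrability and [w] the parameters: limits, derivatives and Fubini act on the
    weight alone. *)
Definition wint F w := bochner_integral mu D (fun t => (w t)%:C *: F t).

Section FixedVectorFunction.
Variable F : T -> X.
Hypotheses (mF : smeasurable F) (F1 : (L1norm mu D F < +oo)%E).

Let L1F_fin : L1norm mu D F \is a fin_num.
Proof. by rewrite ge0_fin_numE// L1norm_ge0. Qed.

Lemma L1norm_weight_le w (C : R) : measurable_fun setT w ->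
  (forall t, D t -> `|w t| <= C) -> 0 <= C ->
  (L1norm mu D (fun t => (w t)%:C *: F t) <= C%:E * L1norm mu D F)%E.
Proof.
move=> mw wC C0; rewrite -[leRHS]adde0 -(mul0e (L1norm mu D F)).
apply: L1normD_le => //; first exact: smeasurableZ.
by move=> t Dt; rewrite mul0r addr0 rnormZ ler_wpM2r ?rnorm_ge0// wC.
Qed.

Lemma wintP w : bounded_weight w ->
  is_bochner_integral mu D (fun t => (w t)%:C *: F t) (wint F w).
Proof.
move=> [mw [C wC]]; apply: bochner_integralP => //; apply: bochner_exists => //.
  exact: smeasurableZ.
apply: (@le_lt_trans _ _ (`|C|%:E * L1norm mu D F)%E).
  by apply: L1norm_weight_le => // t Dt; apply: (le_trans (wC t Dt)); exact: ler_norm.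
by rewrite lte_mul_pinfty// lee_fin.
Qed.

Lemma rnorm_wint w (C : R) : measurable_fun setT w ->
  (forall t, D t -> `|w t| <= C) -> 0 <= C ->
  rnorm (wint F w) <= C * fine (L1norm mu D F).
Proof.
move=> mw wC C0; have bw : bounded_weight w by split => //; exists C.
rewrite -lee_fin EFinM fineK//; apply: le_trans (L1norm_weight_le mw wC C0).
by apply: rnorm_bochner_le (wintP bw) => //; exact: smeasurableZ.
Qed.

Lemma wint_comb (a b : R) w1 w2 : bounded_weight w1 -> bounded_weight w2 ->
  wint F (fun t => a * w1 t + b * w2 t) = a%:C *: wint F w1 + b%:C *: wint F w2.
Proof.
move=> b1 b2; apply: (bochner_integralE mD).
have := is_bochner_integral_comb mD a b (wintP b1) (wintP b2).
rewrite (_ : (fun t => a%:C *: _ + _) = (fun t => (a * w1 t + b * w2 t)%:C *: F t))//.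
by apply/funext => t; rewrite !scalerA rmorphD/= !rmorphM/= scalerDl.
Qed.

Lemma wintZ (a : R) w : bounded_weight w -> wint F (fun t => a * w t) = a%:C *: wint F w.
Proof.
move=> bw; have := wint_comb a 0 bw bw.
rewrite scale0r addr0 => <-; congr wint; apply/funext => t.
by rewrite mul0r addr0.
Qed.

Lemma wintB w1 w2 : bounded_weight w1 -> bounded_weight w2 ->
  wint F (fun t => w1 t - w2 t) = wint F w1 - wint F w2.
Proof.
move=> b1 b2; have := wint_comb 1 (-1) b1 b2.
rewrite rmorphN/= scaleN1r scale1r => <-; congr wint; apply/funext => t.
by rewrite mul1r mulN1r.
Qed.

Lemma wintD w1 w2 : bounded_weight w1 -> bounded_weight w2 ->
  wint F (fun t => w1 t + w2 t) = wint F w1 + wint F w2.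
Proof.
move=> b1 b2.
have -> : (fun t => w1 t + w2 t) = (fun t => 1 * w1 t + 1 * w2 t).
  by apply/funext => t; rewrite !mul1r.
by rewrite (wint_comb 1 1 b1 b2) rmorph1; congr (_ + _); exact: scale1r.
Qed.

(** Dominated convergence for the real functions |W n - w| |F|, at most 2 C |F|; their integrals
    bound the norm of the difference of the two vector integrals. *)
Lemma wint_cvg (W : nat -> T -> R) w (C : R) :
  (forall n, measurable_fun setT (W n)) -> measurable_fun setT w ->
  (forall n t, D t -> `|W n t| <= C) ->
  (forall t, D t -> W n t @[n --> \oo] --> w t) ->
  wint F (W n) @[n --> \oo] --> wint F w.
Proof.
move=> mW mw WC Ww.
have wC t : D t -> `|w t| <= C.
  move=> Dt; have h : `|W n t| @[n --> \oo] --> `|w t| by apply: cvg_norm; exact: Ww.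
  rewrite -(cvg_lim _ h)//; apply: limr_le; first by apply/cvg_ex; exists `|w t|.
  by apply: nearW => n; exact: WC.
have bW n : bounded_weight (W n) by split => //; exists C => t; exact: WC.
have bw : bounded_weight w by split => //; exists C.
apply/cvg_rnormP.
have mFD : measurable_fun D (fun t => rnorm (F t)) by exact: smeasurable_rnorm.
have iF : mu.-integrable D (fun t => (2 * C * rnorm (F t))%:E).
  apply: (integrableZl mD (2 * C) (f := fun t => (rnorm (F t))%:E)).
  apply/integrableP; split; first exact/measurable_EFinP.
  by under eq_integral do rewrite gee0_abs ?lee_fin ?rnorm_ge0//.
have mq n : measurable_fun D (fun t => (`|W n t - w t| * rnorm (F t))%:E).
  apply/measurable_EFinP; apply: measurable_funM => //; apply: measurableT_comp => //.
  by apply: measurable_funB; exact: measurable_funTS.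
have cq : {ae mu, forall t, D t -> (`|W n t - w t| * rnorm (F t))%:E @[n --> \oo] --> cst 0%E t}.
  apply: nearW => t Dt; apply: cvg_EFin; first exact: nearW.
  rewrite -(mul0r (rnorm (F t))); apply: cvgM; last exact: cvg_cst.
  rewrite -[X in _ --> X](normr0 R) -(subrr (w t)); apply: cvg_norm.
  by apply: cvgB; [exact: Ww|exact: cvg_cst].
have bq : {ae mu, forall t n, D t ->
    (`|(`|W n t - w t| * rnorm (F t))%:E| <= (2 * C * rnorm (F t))%:E)%E}.
  apply: nearW => t n Dt; rewrite gee0_abs ?lee_fin ?mulr_ge0 ?rnorm_ge0//.
  rewrite ler_wpM2r ?rnorm_ge0//; apply: (le_trans (ler_normB _ _)).
  by rewrite mulr_natl mulr2n lerD// ?WC ?wC.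
have [_ _] := dominated_convergence mD mq (measurable_cst _) cq iF bq.
rewrite integral0 => h.
have hf : fine (\int[mu]_(t in D) (`|W n t - w t| * rnorm (F t))%:E)%E @[n --> \oo] --> (0 : R).
  exact: fine_cvg.
apply: squeeze_cvgr (cvg_cst (0 : R)) hf; apply: nearW => n.
rewrite rnorm_ge0/= -wintB//.
have bd : bounded_weight (fun t => W n t - w t).
  have := bounded_weight_comb 1 (-1) (bW n) bw.
  by under eq_fun do rewrite mul1r mulN1r.
have E : L1norm mu D (fun t => (W n t - w t)%:C *: F t) =
    (\int[mu]_(t in D) (`|W n t - w t| * rnorm (F t))%:E)%E.
  by apply: eq_integral => t _; rewrite rnormZ.
rewrite -E -lee_fin fineK.
  by apply: rnorm_bochner_le (wintP bd) => //; apply: smeasurableZ => //; exact: bd.1.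
rewrite ge0_fin_numE ?L1norm_ge0//.
apply: (bochner_L1norm_lty mD _ (wintP bd)).
by apply: smeasurableZ => //; exact: bd.1.
Qed.

End FixedVectorFunction.

Lemma eq_wint F w1 w2 : (forall t, D t -> w1 t = w2 t) -> smeasurable F ->
  (L1norm mu D F < +oo)%E -> bounded_weight w1 -> wint F w1 = wint F w2.
Proof.
move=> w12 mF F1 bw; symmetry; apply: (bochner_integralE mD).
apply: is_bochner_integral_ae (wintP mF F1 bw) => //.
by apply: nearW => t Dt; rewrite w12.
Qed.

(** * Functions whose integrals over all measurable sets vanish *)

Section Vanishing.
Variable G : T -> X.
Hypotheses (mG : smeasurable G) (G1 : (L1norm mu D G < +oo)%E).
Hypothesis G0 : forall A, measurable A -> wint G (\1_A) = 0.

(** On a level set E of [s] with value x, the integral of [G] is 0, so that of [G - s] is -mu(E) x.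
    Hence mu(E) |x| is at most the integral of |G - s| over E; then sum over the values. *)
Let L1norm_approx_le (s : T -> X) : simple_integrable mu D s ->
  (L1norm mu D s <= L1dist mu D G s)%E.
Proof.
move=> si; have ss := si.1; have [r [ur rr]] := simple_range ss.
have ms := simple_smeasurable ss.
have mGs : smeasurable (fun t => G t - s t) by exact: smeasurableB.
have mE x : measurable (s @^-1` [set x]) by exact: ss.2.
have -> : L1dist mu D G s = (\sum_(x <- r) L1norm mu D (fun t => (\1_(s @^-1` [set x]) t : R)%:C *: (G t - s t)%R))%E.
  rewrite /L1dist /L1norm -ge0_integral_sum//.
  - apply: eq_integral => t _; rewrite sumEFin; congr EFin.
    rewrite (bigD1_seq (s t))//= indicE mem_set// scale1r big1 ?addr0// => x xs.
    by rewrite indicE memNset ?scale0r ?rnorm0//= => /esym/eqP; apply/negP.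
  - move=> x; apply/measurable_EFinP; apply: smeasurable_rnorm => //.
    exact: smeasurable_indic.
  - by move=> x t _; rewrite lee_fin rnorm_ge0.
rewrite /L1norm (integral_rnorm_simple mu mD ss ur rr); apply: lee_sum => x _.
have [->|x0] := eqVneq x 0.
  by rewrite rnorm0 mul0e integral_ge0// => t _; rewrite lee_fin rnorm_ge0.
have fin := si.2 _ x0.
have i1 : mu.-integrable D (EFin \o (\1_(s @^-1` [set x]) : T -> R)).
  apply/integrableP; split; first by apply/measurable_EFinP; exact: measurable_indic.
  rewrite (_ : \int[mu]_(t in D) _ = \int[mu]_(t in D) (\1_(s @^-1` [set x]) t)%:E)%E.
    by rewrite integral_indic// setIC.
  by apply: eq_integral => t _; rewrite /= indicE; case: (_ \in _); rewrite ?normr1 ?normr0.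
have b1 := is_bochner_integral_scalar mD x (measurable_indic (mE x)) i1.
have b0 := wintP mG G1 (bounded_weight_indic (mE x)).
have b2 : is_bochner_integral mu D (fun t => (\1_(s @^-1` [set x]) t : R)%:C *: (G t - s t))
    (1%:C *: wint G \1_(s @^-1` [set x]) +
     (-1)%:C *: ((fine (\int[mu]_(t in D) (\1_(s @^-1` [set x]) t)%:E))%:C *: x)).
  apply: is_bochner_integral_ae (is_bochner_integral_comb mD 1 (-1) b0 b1) => //.
  apply: nearW => t _; rewrite scale1r rmorphN/= scaleN1r -scalerBr indicE.
  have [/set_mem <-//|] := boolP (t \in _).
  by rewrite !scale0r.
have := rnorm_bochner_le mD (smeasurable_indic (mE x) mGs) b2.
rewrite G0// scaler0 add0r rmorphN/= scaleN1r rnormN rnormZ.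
rewrite integral_indic// ger0_norm ?fine_ge0// setIC EFinM fineK; last by rewrite ge0_fin_numE.
by rewrite muleC.
Qed.

(** For simple s_n tending to [G] in L1, |G| <= |G - s_n| + |s_n| and [L1norm_approx_le] bound the
    L1 norm of [G] by twice a null sequence. *)
Lemma smeasurable_eq0 : {ae mu, forall t, D t -> G t = 0}.
Proof.
have [s si cs] := smeasurable_approx mD mG G1.
have ms n := simple_smeasurable (si n).1.
have G0le : (L1norm mu D G <= 0)%E.
  have h : (L1dist mu D G (s n) + L1dist mu D G (s n) @[n --> \oo] --> 0)%E.
    by rewrite -[X in _ --> X](adde0 0%E); apply: cvgeD.
  apply: (@lee_cvg_to _ _ _ _ (fun=> L1norm mu D G) _ _ _ _ h); first exact: cvg_cst.
  apply: nearW => n.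
  apply: (@le_trans _ _ (L1dist mu D G (s n) + L1norm mu D (s n))%E); last first.
    by apply: leeD2l; exact: L1norm_approx_le.
  rewrite -[L1dist _ _ _ _]mul1e -[X in (_ + X)%E]mul1e.
  apply: L1normD_le => //; first exact: smeasurableB.
  by move=> t _; rewrite !mul1r; apply: le_trans (ler_rnormD _ _); rewrite subrK.
have mn : measurable_fun D (fun t => (rnorm (G t))%:E).
  by apply/measurable_EFinP; exact: smeasurable_rnorm.
have := (ae_eq_integral_abs mu mD mn).1.
under eq_integral do rewrite gee0_abs ?lee_fin ?rnorm_ge0//.
move=> /(_ _)[]; first by apply/eqP; rewrite eq_le G0le L1norm_ge0.
move=> N [mN N0 sub]; exists N; split => // t /= h; apply: sub => /= h'; apply: h => Dt.
by apply: rnorm0_eq0; have [] := h' Dt.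
Qed.

End Vanishing.

End WeightedIntegral.

Lemma integrable_weight_indic d (T : measurableType d) (R : realType)
    (mu : {measure set T -> \bar R}) (D E : set T) (w : T -> R) :
  measurable D -> measurable E -> (mu (D `&` E) < +oo)%E -> bounded_weight D w ->
  mu.-integrable D (fun t => (w t * \1_E t)%:E).
Proof.
move=> mD mE fin [mw [C wC]].
have m : measurable_fun D (fun t => (w t * \1_E t)%:E).
  apply/measurable_EFinP; apply: measurable_funTS.
  by apply: measurable_funM => //; exact: measurable_indic.
apply/integrableP; split => //.
apply: (@le_lt_trans _ _ (\int[mu]_(t in D) (`|C|%:E * (\1_E t)%:E))%E).
  apply: ge0_le_integral => //.
  - exact: measurableT_comp.
  - by apply: measurable_funeM; apply/measurable_EFinP; exact: measurable_indic.
  - move=> t Dt; rewrite -EFinM lee_fin normrM indicE.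
    case: (t \in E); rewrite ?normr0 ?mulr0// normr1 !mulr1.
    by rewrite (le_trans (wC _ Dt))// ler_norm.
rewrite ge0_integralZl//; last by apply/measurable_EFinP; exact: measurable_indic.
by rewrite integral_indic// setIC lte_mul_pinfty.
Qed.

(** * Fubini's theorem for Bochner integrals against a bounded kernel *)

Section BochnerFubini.
Context d (T : measurableType d) (R : realType) (X : completeNormedModType R[i]).
Variables (mu : {sigma_finite_measure set T -> \bar R}) (D : set T).
Hypothesis mD : measurable D.
Variables (psi phi : T -> R) (W : T -> T -> R) (C C' : R).
Hypotheses (mpsi : measurable_fun setT psi) (ipsi : mu.-integrable D (EFin \o psi)).
Hypotheses (mphi : measurable_fun setT phi).
Hypothesis mW : measurable_fun setT (fun p : T * T => W p.1 p.2).
Hypothesis WC : forall r t, D r -> D t -> `|W r t| <= C.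
Hypothesis phiC : forall t, D t -> `|phi t| <= C'.
Hypothesis phiE : forall t, D t -> (\int[mu]_(r in D) (psi r * W r t)%:E = (phi t)%:E)%E.

Let mWr r : measurable_fun setT (W r).
Proof. exact: (measurableT_comp mW (measurable_pair1 r)). Qed.

Let bW r : D r -> bounded_weight D (W r).
Proof. by move=> Dr; split => //; exists C => t; exact: WC. Qed.

Let bphi : bounded_weight D phi.
Proof. by split => //; exists C'. Qed.

(** [e] is the partial integral of the product integrand, hence measurable on the whole space; its
    explicit formula is only claimed on [D]. The finite measure of [E] inside [D] makes the bounded
    kernel integrable on the product. *)
Lemma bochner_fubini_scalar (E : set T) : measurable E -> (mu (D `&` E) < +oo)%E ->
  exists2 e : T -> R, measurable_fun setT e /\ mu.-integrable D (EFin \o e) &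
    (forall r, D r -> e r = psi r * fine (\int[mu]_(t in D) (W r t * \1_E t)%:E)%E) /\
    fine (\int[mu]_(r in D) (e r)%:E)%E = fine (\int[mu]_(t in D) (phi t * \1_E t)%:E)%E.
Proof.
move=> mE Efin; have mDE : measurable (D `&` E) by exact: measurableI.
(* Extended by 0 outside D and the part of [E] in [D], so that Fubini's theorem applies on the full
   product space. *)
pose K (p : T * T) := (psi p.1 * \1_D p.1) * (W p.1 p.2 * \1_(D `&` E) p.2).
have mK : measurable_fun setT K.
  apply: measurable_funM; apply: measurable_funM => //.
  - exact: (measurableT_comp mpsi).
  - exact: (measurableT_comp (measurable_indic mD)).
  - exact: (measurableT_comp (measurable_indic mDE)).
have mKE : measurable_fun setT (EFin \o K) by exact/measurable_EFinP.
have Kle r t : `|K (r, t)| <= `|psi r * \1_D r| * (`|C| * \1_(D `&` E) t).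
  rewrite /K/= normrM; have [Dr|nDr] := pselect (D r); last first.
    by rewrite (indicE _ D) memNset// mulr0 normr0 !mul0r.
  rewrite ler_wpM2l// normrM; have [DEt|nDEt] := pselect ((D `&` E) t); last first.
    by rewrite (indicE _ (D `&` E)) memNset// normr0 !mulr0.
  rewrite (indicE _ (D `&` E)) mem_set// normr1 !mulr1.
  by apply: (le_trans (WC Dr DEt.1)); exact: ler_norm.
have mpD : measurable_fun setT (fun r => `|psi r * \1_D r|).
  by apply: measurableT_comp => //; apply: measurable_funM => //; exact: measurable_indic.
have mCE : measurable_fun setT (fun t => (`|C| * \1_(D `&` E) t)%:E).
  by apply/measurable_EFinP; apply: measurable_funM => //; exact: measurable_indic.
have mKr r : measurable_fun setT (fun t => (K (r, t))%:E).
  exact: (measurableT_comp mKE (measurable_pair1 r)).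
have I1 : (\int[mu]_t (`|C| * \1_(D `&` E) t)%:E = `|C|%:E * mu (D `&` E))%E.
  under eq_integral do rewrite EFinM.
  rewrite ge0_integralZl//; last by apply/measurable_EFinP; exact: measurable_indic.
  by rewrite integral_indic// setIT.
have absK r : (\int[mu]_t `|(K (r, t))%:E| <= (`|psi r * \1_D r|)%:E * (`|C|%:E * mu (D `&` E)))%E.
  rewrite -I1 -ge0_integralZl//.
  apply: ge0_le_integral => //.
  - exact: measurableT_comp.
  - by apply: measurable_funeM.
  - by move=> t _; rewrite -EFinM lee_fin Kle.
have CEfin : (`|C|%:E * mu (D `&` E))%E \is a fin_num by rewrite fin_numM// ge0_fin_numE.
have I2 : (\int[mu]_r (`|psi r * \1_D r|)%:E < +oo)%E.
  have := (integrableP _ _ _ ipsi).2; rewrite integral_mkcond.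
  congr (_ < _)%E; apply: eq_integral => r _; rewrite patchE/=.
  by rewrite (indicE _ D); case: (r \in D); rewrite ?mulr1// mulr0 normr0.
have iK : ((mu \x mu)%E.-integrable setT (EFin \o K))%E.
  apply/integrable12ltyP => //=.
  apply: (@le_lt_trans _ _ (\int[mu]_r ((`|C|%:E * mu (D `&` E)) * (`|psi r * \1_D r|)%:E))%E).
    apply: ge0_le_integral => //.
    - by move=> r _; apply: integral_ge0.
    - apply: (measurable_fun_fubini_tonelli_F (fun p => `|(K p)%:E|%E)) => //.
      exact: measurableT_comp.
    - by apply: measurable_funeM; apply/measurable_EFinP.
    - by move=> r _; rewrite muleC; exact: absK.
  rewrite ge0_integralZl//.
  - by rewrite lte_mul_pinfty// mule_ge0.
  - by apply/measurable_EFinP.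
  - by rewrite mule_ge0.
have Ffin r : (fubini_F mu (EFin \o K) r) \is a fin_num.
  rewrite /fubini_F/= -integral_fin_num_abs//; last by apply/measurable_EFinP; exact: mKr.
  apply: (le_lt_trans (absK r)).
  by rewrite -(fineK CEfin) -EFinM ltry.
have iW r : D r -> mu.-integrable D (fun t => (W r t * \1_E t)%:E).
  by move=> Dr; apply: integrable_weight_indic => //; exact: bW.
have FE r : D r -> fubini_F mu (EFin \o K) r =
    ((psi r)%:E * \int[mu]_(t in D) (W r t * \1_E t)%:E)%E.
  move=> Dr; rewrite -integralZl//; last exact: iW.
  rewrite [RHS]integral_mkcond; apply: eq_integral => t _.
  rewrite patchE /K/= !indicE in_setI (mem_set Dr) mulr1.
  by case: (t \in D) => /=; rewrite ?mulr0 ?mulr0// -EFinM.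
have GE t : fubini_G mu (EFin \o K) t = ((fun t => (phi t * \1_E t)%:E) \_ D) t.
  rewrite patchE /fubini_G/=; case: ifPn => [Dt|Dt]; last first.
    rewrite integral0_eq// => r _; rewrite /K/= (indicE _ (D `&` E)) in_setI (negbTE Dt).
    by rewrite !mulr0.
  have Dt' := set_mem Dt.
  rewrite mulrC EFinM -phiE// -integralZl//; last first.
    apply/integrableP; split.
      apply/measurable_EFinP; apply: measurable_funTS; apply: measurable_funM => //.
      exact: (measurableT_comp mW (measurable_pair2 t)).
    apply: (@le_lt_trans _ _ (`|C|%:E * \int[mu]_(r in D) `|(psi r)%:E|)%E); last first.
      rewrite lte_mul_pinfty//.
      by have := (integrableP _ _ _ ipsi).2.
    rewrite -ge0_integralZl//; last first.
      by apply: measurableT_comp => //; exact: (integrableP _ _ _ ipsi).1.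
    apply: ge0_le_integral => //.
    - apply: measurableT_comp => //; apply/measurable_EFinP; apply: measurable_funTS; apply: measurable_funM => //.
      exact: (measurableT_comp mW (measurable_pair2 t)).
    - apply: measurable_funeM; apply: measurableT_comp => //; exact: (integrableP _ _ _ ipsi).1.
    - move=> r Dr /=; rewrite -EFinM lee_fin normrM mulrC ler_wpM2r//.
      by apply: (le_trans (WC Dr Dt')); exact: ler_norm.
  rewrite [RHS]integral_mkcond; apply: eq_integral => r _.
  rewrite patchE /K/= !indicE in_setI Dt/=.
  case: (r \in D); rewrite ?mulr1 ?mulr0 ?mul0r// -EFinM.
  by congr EFin; ring.
exists (fun r => fine (fubini_F mu (EFin \o K) r)).
  split.
    apply/measurable_EFinP; rewrite (_ : EFin \o _ = fubini_F mu (EFin \o K)).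
      exact: (measurable_int _ (integrable_fubini_F iK)).
    by apply/funext => r /=; rewrite fineK.
  apply: (@integrableS _ _ _ _ setT) => //.
  apply: eq_integrable (integrable_fubini_F iK) => // r _.
  by rewrite /= fineK.
split=> [r Dr|].
  by rewrite FE// fineM//; exact: integrable_fin_num (iW _ Dr).
have -> : (\int[mu]_(r in D) (fine (fubini_F mu (EFin \o K) r))%:E)%E =
    (\int[mu]_r fubini_F mu (EFin \o K) r)%E.
  rewrite integral_mkcond; apply: eq_integral => r _; rewrite patchE fineK//.
  case: ifPn => // Dr; rewrite /fubini_F/= integral0_eq// => t _.
  by rewrite /K/= (indicE _ D) (negbTE Dr) !(mulr0, mul0r).
rewrite integral12_prod_meas1// -integral21_prod_meas1//.
rewrite [in RHS]integral_mkcond; congr fine; apply: eq_integral => t _; exact: GE.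
Qed.

Lemma wintDl (F G : T -> X) (w : T -> R) : smeasurable F -> smeasurable G ->
  (L1norm mu D F < +oo)%E -> (L1norm mu D G < +oo)%E -> bounded_weight D w ->
  wint mu D (fun t => F t + G t) w = wint mu D F w + wint mu D G w.
Proof.
move=> mF mG F1 G1 bw; apply: (bochner_integralE mD).
have := is_bochner_integral_comb mD 1 1 (wintP mD mF F1 bw) (wintP mD mG G1 bw).
rewrite [X in is_bochner_integral _ _ _ X](_ : _ = wint mu D F w + wint mu D G w); last first.
  by rewrite rmorph1; congr (_ + _); exact: scale1r.
apply: is_bochner_integral_ae => //; apply: nearW => t _.
by rewrite scalerDr rmorph1; congr (_ + _); exact: scale1r.
Qed.

Lemma wint_dist_le (F G : T -> X) (w : T -> R) (c : R) : smeasurable F -> smeasurable G ->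
  (L1norm mu D F < +oo)%E -> (L1norm mu D G < +oo)%E -> measurable_fun setT w ->
  (forall t, D t -> `|w t| <= c) -> 0 <= c ->
  ((rnorm (wint mu D F w - wint mu D G w))%:E <= c%:E * L1dist mu D F G)%E.
Proof.
move=> mF mG F1 G1 mw wc c0; have bw : bounded_weight D w by split => //; exists c.
have mFG : smeasurable (fun t => F t - G t) by exact: smeasurableB.
have b : is_bochner_integral mu D (fun t => (w t)%:C *: (F t - G t))
    (wint mu D F w - wint mu D G w).
  have := is_bochner_integral_comb mD 1 (-1) (wintP mD mF F1 bw) (wintP mD mG G1 bw).
  rewrite [X in is_bochner_integral _ _ _ X](_ : _ = wint mu D F w - wint mu D G w); last first.
    by rewrite rmorphN rmorph1 scaleN1r; congr (_ - _); exact: scale1r.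
  apply: is_bochner_integral_ae => //; apply: nearW => t _.
  by rewrite scalerBr rmorphN rmorph1 scaleN1r; congr (_ - _); exact: scale1r.
apply: (le_trans (rnorm_bochner_le mD (smeasurableZ mw mFG) b)).
exact: L1norm_weight_le.
Qed.

Let fub (F : T -> X) :=
  is_bochner_integral mu D (fun r => (psi r)%:C *: wint mu D F (W r)) (wint mu D F phi).

Let fubD F G : smeasurable F -> smeasurable G ->
  (L1norm mu D F < +oo)%E -> (L1norm mu D G < +oo)%E ->
  fub F -> fub G -> fub (fun t => F t + G t).
Proof.
move=> mF mG F1 G1 fF fG; rewrite /fub wintDl//.
have := is_bochner_integral_comb mD 1 1 fF fG.
rewrite [X in is_bochner_integral _ _ _ X](_ : _ = wint mu D F phi + wint mu D G phi); last first.
  by rewrite rmorph1; congr (_ + _); exact: scale1r.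
apply: is_bochner_integral_ae => //; apply: nearW => r Dr.
by rewrite wintDl ?scalerDr ?rmorph1; [congr (_ + _); exact: scale1r|..|exact: bW].
Qed.

Let wint_indic (E : set T) (x : X) w : measurable E -> (mu (D `&` E) < +oo)%E ->
  bounded_weight D w ->
  wint mu D (fun t => (\1_E t : R)%:C *: x) w = (fine (\int[mu]_(t in D) (w t * \1_E t)%:E)%E)%:C *: x.
Proof.
move=> mE fin bw; apply: (bochner_integralE mD).
have := is_bochner_integral_scalar mD x _ (integrable_weight_indic mD mE fin bw).
rewrite (_ : (fun t => (w t * \1_E t)%:C *: x) = (fun t => (w t)%:C *: ((\1_E t)%:C *: x))).
  by apply; apply: measurable_funM; [exact: bw.1|exact: measurable_indic].
by apply/funext => t; rewrite scalerA -rmorphM.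
Qed.

Let fub_indic (E : set T) (x : X) : measurable E -> (mu (D `&` E) < +oo)%E ->
  fub (fun t => (\1_E t : R)%:C *: x).
Proof.
move=> mE fin; rewrite /fub wint_indic//.
have [e [me ie] [eE <-]] := bochner_fubini_scalar mE fin.
apply: is_bochner_integral_ae (is_bochner_integral_scalar mD x me ie) => //.
apply: nearW => r Dr; rewrite wint_indic//; last exact: bW.
by rewrite eE// rmorphM/= scalerA.
Qed.

Let fub_simple (s : T -> X) : simple_integrable mu D s -> fub s.
Proof.
move=> si; have [r [ur rr]] := simple_range si.1.
(* The value 0 is discarded because its level set may have infinite measure. *)
pose q := [seq x <- r | x != 0].
have -> : s = fun t => \sum_(x <- q) (\1_(s @^-1` [set x]) t : R)%:C *: x.
  apply/funext => t; have [s0|s0] := eqVneq (s t) 0.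
    rewrite /q big_filter s0 big1// => x x0; rewrite indicE memNset ?scale0r//=.
    by rewrite s0 => /esym/eqP; apply/negP.
  rewrite (bigD1_seq (s t)) ?filter_uniq ?mem_filter ?s0//= indicE mem_set// scale1r big1 ?addr0// => x xs.
  by rewrite indicE memNset ?scale0r//= => /esym/eqP; apply/negP.
have mE x : measurable (s @^-1` [set x]) by exact: si.1.2.
have q0 x : x \in q -> x != 0 by rewrite mem_filter => /andP[].
suff H : [/\ smeasurable (fun t => \sum_(x <- q) (\1_(s @^-1` [set x]) t : R)%:C *: x),
    (L1norm mu D (fun t => \sum_(x <- q) (\1_(s @^-1` [set x]) t : R)%:C *: x)%R < +oo)%E &
    fub (fun t => \sum_(x <- q) (\1_(s @^-1` [set x]) t : R)%:C *: x)] by case: H.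
elim: q q0 => [|x q IH] q0.
  under eq_fun do rewrite big_nil.
  have m0 : smeasurable (fun _ : T => 0 : X) by apply: simple_smeasurable; exact: simple_fun_cst.
  split => //; first by rewrite /L1norm integral0_eq// => t _; rewrite rnorm0.
  have f0 := fub_indic 0 measurable0 (_ : (mu (D `&` set0) < +oo)%E).
  rewrite (_ : (fun=> 0) = (fun t => (\1_(@set0 T) t : R)%:C *: (0 : X))); last first.
    by apply/funext => t; rewrite scaler0.
  by apply: f0; rewrite setI0 measure0.
have [m1 l1 f1] := IH (fun y yq => q0 y (mem_behead (s := x :: q) yq)).
under eq_fun do rewrite big_cons.
have x0 : x != 0 by apply: q0; rewrite mem_head.
have fin := si.2 _ x0.
have m2 : smeasurable (fun t => (\1_(s @^-1` [set x]) t : R)%:C *: x).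
  by apply: smeasurable_indic => //; apply: simple_smeasurable; exact: simple_fun_cst.
have l2 : (L1norm mu D (fun t => ((\1_(s @^-1` [set x]) t : R)%:C *: x)%R) < +oo)%E.
  rewrite /L1norm; under eq_integral do rewrite rnormZ mulrC EFinM ger0_norm//.
  rewrite ge0_integralZl ?integral_indic//.
  - by rewrite setIC lte_mul_pinfty// lee_fin rnorm_ge0.
  - by apply/measurable_EFinP; exact: measurable_indic.
  - by rewrite lee_fin rnorm_ge0.
split; first exact: smeasurableD.
  apply: (@le_lt_trans _ _ (1%:E * L1norm mu D (fun t => ((\1_(s @^-1` [set x]) t : R)%:C *: x)%R) +
      1%:E * L1norm mu D (fun t => \sum_(x <- q) (\1_(s @^-1` [set x]) t : R)%:C *: x)%R)%E).
    apply: L1normD_le => //; first exact: smeasurableD.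
    by move=> t _; rewrite !mul1r ler_rnormD.
  by rewrite !mul1e lte_add_pinfty.
exact: (fubD m2 m1 l2 l1 (fub_indic x (mE x) fin) f1).
Qed.

(* Both sides are continuous in F for the L1 norm, which reduces the identity
   to simple functions F and so to Fubini's theorem for scalars. *)
Lemma bochner_fubini (F : T -> X) : smeasurable F -> (L1norm mu D F < +oo)%E ->
  smeasurable (fun r => wint mu D F (W r)) ->
  is_bochner_integral mu D (fun r => (psi r)%:C *: wint mu D F (W r)) (wint mu D F phi).
Proof.
move=> mF F1 mg; have [s si cs] := smeasurable_approx mD mF F1.
have ms n := simple_smeasurable (si n).1.
have Ls n : (L1norm mu D (s n) < +oo)%E.
  have b : is_bochner_integral mu D (s n) (simple_integral mu D (s n)).
    split; first by apply: (smeasurable_strongly (ms n)); exact: nearW.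
    exists (fun=> s n); split => //; last exact: cvg_cst.
    rewrite (_ : (fun n => _) = fun=> 0%E); first exact: cvg_cst.
    by apply/funext => k; rewrite integral0_eq// => t _; rewrite subrr rnorm0.
  exact: bochner_L1norm_lty b.
pose g r := wint mu D F (W r).
have mpg : smeasurable (fun r => (psi r)%:C *: g r) by exact: smeasurableZ.
have C0 : 0 <= `|C| by [].
have ip : (\int[mu]_(r in D) `|(psi r)%:E| < +oo)%E := (integrableP _ _ _ ipsi).2.
have mpn : measurable_fun D (fun r => `|(psi r)%:E|%E).
  by apply: measurableT_comp => //; exact: (integrableP _ _ _ ipsi).1.
have Lpg : (L1norm mu D (fun r => ((psi r)%:C *: g r)%R) < +oo)%E.
  apply: (@le_lt_trans _ _ ((`|C| * fine (L1norm mu D F))%:E * \int[mu]_(r in D) `|(psi r)%:E|)%E); last first.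
    by rewrite lte_mul_pinfty// lee_fin mulr_ge0// fine_ge0// L1norm_ge0.
  rewrite -ge0_integralZl//; last by rewrite lee_fin mulr_ge0// fine_ge0// L1norm_ge0.
  apply: ge0_le_integral => //.
  - by move=> r _; rewrite lee_fin rnorm_ge0.
  - by apply/measurable_EFinP; exact: smeasurable_rnorm.
  - exact: measurable_funeM.
  - move=> r Dr; rewrite rnormZ -EFinM lee_fin mulrC ler_wpM2r//.
    by apply: rnorm_wint => // t Dt; apply: (le_trans (WC Dr Dt)); exact: ler_norm.
(* Domination by |C| |F|_1 |psi| gives some integral [v]; it is identified by comparing both sides
   with those for the simple function [s n]. *)
have [v bv] := bochner_exists mD mpg Lpg.
suff <- : v = wint mu D F phi by [].
have phil n : ((rnorm (wint mu D (s n) phi - wint mu D F phi))%:E <= `|C'|%:E * L1dist mu D F (s n))%E.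
  by rewrite rnormB; apply: wint_dist_le => // t Dt; apply: (le_trans (phiC Dt)); exact: ler_norm.
have vl n : ((rnorm (v - wint mu D (s n) phi))%:E <=
    (`|C|%:E * \int[mu]_(r in D) `|(psi r)%:E|) * L1dist mu D F (s n))%E.
  have [h [mh ah bh]] := is_bochner_integral_smeasurable mD (fub_simple (si n)).
  have b := is_bochner_integral_comb mD 1 (-1) bv bh.
  move: b; rewrite [X in is_bochner_integral _ _ _ X](_ : _ = v - wint mu D (s n) phi); last first.
    by rewrite rmorphN rmorph1 scaleN1r; congr (_ - _); exact: scale1r.
  set k := (fun t => _) => b.
  have kE : k = (fun r => (psi r)%:C *: g r - h r).
    by apply/funext => r; rewrite /k rmorphN rmorph1 scaleN1r; congr (_ - _); exact: scale1r.
  have mk : smeasurable k by rewrite kE; exact: smeasurableB.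
  apply: (le_trans (rnorm_bochner_le mD mk b)).
  have L0 : (0 <= `|C|%:E * L1dist mu D F (s n))%E by rewrite mule_ge0// L1norm_ge0.
  rewrite muleAC -ge0_integralZl//.
  apply: ae_ge0_le_integral => //.
  - by move=> r _; rewrite lee_fin rnorm_ge0.
  - by apply/measurable_EFinP; exact: smeasurable_rnorm.
  - by move=> r _; rewrite mule_ge0.
  - exact: measurable_funeM.
  apply: filterS ah => r ah Dr; rewrite kE -ah// -scalerBr rnormZ EFinM muleC.
  apply: lee_wpmul2r; first by rewrite lee_fin.
  apply: wint_dist_le; [by []|exact: ms|by []|exact: Ls|exact: mWr| |by []].
  by move=> t Dt; apply: (le_trans (WC Dr Dt)); exact: ler_norm.
have h : ((`|C|%:E * \int[mu]_(r in D) `|(psi r)%:E|) * L1dist mu D F (s n) +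
    `|C'|%:E * L1dist mu D F (s n) @[n --> \oo] --> 0)%E.
  rewrite [X in _ --> X](_ : _ = (`|C|%:E * \int[mu]_(r in D) `|(psi r)%:E|) * 0 + `|C'|%:E * 0)%E; last first.
    by rewrite !mule0 adde0.
  apply: cvgeD; first by rewrite !mule0.
    by apply: cvgeZl => //; rewrite fin_numM// ge0_fin_numE// integral_ge0.
  exact: cvgeZl.
have : ((rnorm (v - wint mu D F phi))%:E <= 0)%E.
  apply: (@lee_cvg_to _ _ _ _ (fun=> (rnorm (v - wint mu D F phi))%:E) _ _ _ _ h).
    exact: cvg_cst.
  apply: nearW => n; apply: le_trans (leeD (vl n) (phil n)).
  rewrite -EFinD lee_fin; apply: le_trans (ler_rnormD _ _).
  by rewrite addrA subrK.
rewrite lee_fin => le0; apply/eqP; rewrite -subr_eq0; apply/eqP/rnorm0_eq0/eqP.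
by rewrite eq_le le0 rnorm_ge0.
Qed.

End BochnerFubini.

(** * Uniqueness from Gaussian moments *)

Section StepPolynomials.
Context (R : realType).
Implicit Types (u p q x : R).

(** With q = p^2, induction gives n p^n (1 - p) <= 1 - p^n, so n q^n is at most p^n / (1 - p). *)
Lemma natmul_expr_cvg0 q : 0 <= q < 1 -> n%:R * q ^+ n @[n --> \oo] --> (0 : R).
Proof.
move=> /andP[q0 q1]; pose p := Num.sqrt q.
have p0 : 0 <= p by exact: sqrtr_ge0.
have p1 : p < 1 by rewrite -sqrtr1 ltr_sqrt.
have pq : q = p * p by rewrite -expr2 sqr_sqrtr.
have le n : n%:R * p ^+ n * (1 - p) <= 1 - p ^+ n.
  elim: n => [|n IH]; first by rewrite mul0r mul0r expr0 subrr.
  have pn0 : 0 <= p ^+ n by exact: exprn_ge0.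
  have pn1 : p ^+ n <= 1 by apply: exprn_ile1 => //; exact: ltW.
  have h1 := ler_wpM2l p0 IH.
  have h2 : 0 <= (1 - p) * (1 - p * p ^+ n).
    apply: mulr_ge0; rewrite subr_ge0; first exact: ltW.
    by apply: mulr_ile1 => //; exact: ltW.
  by rewrite -natr1 exprS; nra.
have h : p ^+ n * (1 - p)^-1 @[n --> \oo] --> (0 : R).
  rewrite -(mul0r (1 - p)^-1); apply: cvgM; last exact: cvg_cst.
  by apply: cvg_expr; rewrite ger0_norm.
apply: squeeze_cvgr (cvg_cst (0 : R)) h; apply: nearW => n.
rewrite mulr_ge0 ?exprn_ge0//= pq exprMn mulrCA ler_wpM2l ?exprn_ge0//.
rewrite -[leRHS]mul1r ler_pdivlMr ?subr_gt0//.
by apply: (le_trans (le n)); rewrite lerBlDr lerDl exprn_ge0.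
Qed.

Lemma bernoulli_sub x (N : nat) : 0 <= x <= 1 -> 1 - N%:R * x <= (1 - x) ^+ N.
Proof.
move=> /andP[x0 x1]; elim: N => [|N IH]; first by rewrite mul0r subr0 expr0.
rewrite exprS -natr1.
have : 0 <= N%:R * x * x by rewrite !mulr_ge0.
have : (1 - x) * (1 - N%:R * x) <= (1 - x) * (1 - x) ^+ N.
  by rewrite ler_wpM2l// subr_ge0.
by nra.
Qed.

(** The upper counterpart of [bernoulli_sub]: together they force (1 - x)^N towards 1 when N x is
    small and towards 0 when N x is large. *)
Lemma bernoulli_inv x (N : nat) : 0 <= x <= 1 -> (1 - x) ^+ N * (1 + N%:R * x) <= 1.
Proof.
move=> /andP[x0 x1]; elim: N => [|N IH]; first by rewrite expr0 mul0r addr0 mulr1.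
rewrite exprS -natr1.
have e0 : 0 <= (1 - x) ^+ N by rewrite exprn_ge0// subr_ge0.
apply: le_trans IH; rewrite -mulrA mulrCA ler_wpM2l//.
have : 0 <= N%:R * x * x by rewrite !mulr_ge0.
by nra.
Qed.

(* For 0 <= u <= 1 these polynomials in u tend to the indicator of u < 1/2. *)
Definition step_poly n : {poly R} := (1 - 'X^n) ^+ (n * 2 ^ n).

Lemma step_polyE n u : (step_poly n).[u] = (1 - u ^+ n) ^+ (n * 2 ^ n).
Proof. by rewrite /step_poly horner_exp hornerD hornerN hornerC hornerXn. Qed.

Lemma step_poly_itv n u : 0 <= u <= 1 -> 0 <= (step_poly n).[u] <= 1.
Proof.
move=> /andP[u0 u1]; rewrite step_polyE.
have : 0 <= 1 - u ^+ n by rewrite subr_ge0 exprn_ile1.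
have : 1 - u ^+ n <= 1 by rewrite lerBlDr lerDl exprn_ge0.
by move=> h1 h2; rewrite exprn_ge0//= exprn_ile1.
Qed.

(** With N = n 2^n and x = u^n, the product N x is n (2u)^n, which tends to 0 for 2u < 1. *)
Lemma step_poly_cvg1 u : 0 <= u < 2^-1 -> (step_poly n).[u] @[n --> \oo] --> (1 : R).
Proof.
move=> /andP[u0 u2].
have h : 1 - n%:R * (2 * u) ^+ n @[n --> \oo] --> (1 : R).
  rewrite -[X in _ --> X]subr0; apply: cvgB; first exact: cvg_cst.
  by apply: natmul_expr_cvg0; rewrite mulr_ge0//=; lra.
apply: squeeze_cvgr h (cvg_cst (1 : R)); apply: nearW => n.
have u1 : u <= 1 by lra.
have /andP[_ ->] := @step_poly_itv n u (ltac:(rewrite u0 u1; done)).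
rewrite andbT step_polyE; apply: le_trans (bernoulli_sub _ _).
  by rewrite natrM natrX exprMn mulrA.
by rewrite exprn_ge0//= exprn_ile1.
Qed.

(** Here N x = n (2u)^n >= n, so the value is at most 1 / (n + 1). The factor n in the exponent
    settles the boundary case u = 1/2. *)
Lemma step_poly_cvg0 u : 2^-1 <= u <= 1 -> (step_poly n).[u] @[n --> \oo] --> (0 : R).
Proof.
move=> /andP[u2 u1]; have u0 : 0 <= u by lra.
have h : n.+1%:R^-1 @[n --> \oo] --> (0 : R) by exact: cvg_harmonic.
apply: squeeze_cvgr (cvg_cst (0 : R)) h; apply: nearW => n.
have /andP[-> _] := @step_poly_itv n u (ltac:(rewrite u0 u1; done)).
rewrite step_polyE /= -[leRHS]mul1r ler_pdivlMr ?ltr0n//.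
have x01 : 0 <= u ^+ n <= 1 by rewrite exprn_ge0//= exprn_ile1.
apply: le_trans (bernoulli_inv (n * 2 ^ n) x01).
rewrite ler_wpM2l//.
  by rewrite exprn_ge0// subr_ge0; case/andP: x01.
rewrite -nat1r lerD2l natrM natrX -mulrA -exprMn ler_peMr//.
by rewrite exprn_ege1//; lra.
Qed.

End StepPolynomials.

(** * From Gaussian moments to rays, and from rays to Borel sets *)

Section GaussianUniqueness.
Context (R : realType) (X : completeNormedModType R[i]).
Implicit Types (F G : measurableTypeR R -> X).

(** Composing [g] with real simple functions that converge to the identity gives simple functions
    converging to [g] by continuity. *)
Lemma continuous_smeasurable (g : R -> X) : (forall r, g t @[t --> r] --> g r) ->
  smeasurable (g : measurableTypeR R -> X).
Proof.
move=> cg.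
have mid : measurable_fun [set: measurableTypeR R] (fun r : measurableTypeR R => (r : R)%:E).
  by apply/measurable_EFinP; exact: measurable_id.
have [q cq] := approximation_sfun measurableT mid.
exists (fun n t => g (q n t)).
  by move=> n; apply: (simple_fun_comp g).
move=> t; have /fine_cvgP[_ h] := cq t I.
exact: (cvg_comp _ _ h (cg t)).
Qed.

Section Rays.
Variables (mu : {measure set (measurableTypeR R) -> \bar R}) (D : set (measurableTypeR R)).
Hypothesis mD : measurable D.
Variable G : measurableTypeR R -> X.
Hypotheses (mG : smeasurable G) (G1 : (L1norm mu D G < +oo)%E).

(** The sets over which [G] integrates to 0 form a Dynkin system, by linearity and [wint_cvg]; the
    open rays are stable under intersection and generate the Borel sets. *)
Lemma wint_indic_eq0 : (forall c, wint mu D G \1_(`]c, +oo[%classic) = 0) ->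
  forall A, measurable A -> wint mu D G (\1_A) = 0.
Proof.
move=> G0 A mA.
have bi B : measurable B -> bounded_weight D (\1_B : measurableTypeR R -> R) by exact: bounded_weight_indic.
have cvg0 (B : nat -> set (measurableTypeR R)) B' : (forall n, measurable (B n)) -> measurable B' ->
    (forall n, wint mu D G \1_(B n) = 0) ->
    (forall t, (\1_(B n) t : R) @[n --> \oo] --> (\1_B' t : R)) -> wint mu D G \1_B' = 0.
  move=> mB mB' B0 cB.
  have h : wint mu D G \1_(B n) @[n --> \oo] --> wint mu D G \1_B'.
    apply: (@wint_cvg _ _ _ _ _ _ mD G mG G1 (fun n => \1_(B n)) _ 1) => //.
    by move=> n t _; rewrite indicE; case: (_ \in _); rewrite ?normr1 ?normr0.
  apply: (cvg_rnorm_unique h); under eq_fun do rewrite B0; exact: cvg_cst.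
(* The whole line is the increasing limit of the rays starting at -n. *)
have GT : wint mu D G \1_setT = 0.
  apply: (cvg0 (fun n => `]- n%:R, +oo[%classic)) => //.
  move=> t; apply: (@cvg_trans _ ((1 : R) @[_ --> \oo])); last first.
    by rewrite indicT; exact: cvg_cst.
  apply: near_eq_cvg; near=> n; rewrite indicE mem_set//= in_itv/= andbT.
  rewrite ltrNl; apply: (@lt_le_trans _ _ n%:R) => //.
  near: n; exact: nbhs_infty_gtr.
pose P B := wint mu D G \1_B = 0.
have ind2 (B C : set (measurableTypeR R)) : measurable B -> measurable C -> B `<=` C ->
    P B -> P C -> P (C `\` B).
  move=> mB mC BC PB PC; rewrite /P (_ : \1_(C `\` B) = (fun t => \1_C t - \1_B t)).
    by rewrite wintB//; try exact: bi; rewrite PB PC subrr.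
  apply/funext => t; rewrite !indicE in_setD.
  have [tB|tB] := boolP (t \in B); last by rewrite subr0 andbT.
  by rewrite (mem_set (BC _ (set_mem tB))) andbF subrr.
have dyn := @dynkin_induction _ (measurableTypeR R) (@RGenOInfty.G R) P
  (RGenOInfty.measurableE R).
have sA : <<s @RGenOInfty.G R >> A by move: mA; rewrite RGenOInfty.measurableE.
suff : P A by [].
apply: (dyn _ GT _ _ _ A sA).
- move=> _ _ [a ->] [b ->]; exists (Num.max a b); apply/seteqP; split => t /=.
    by rewrite !in_itv/= !andbT gt_max => -[-> ->].
  by rewrite !in_itv/= !andbT gt_max => /andP[-> ->].
- by move=> _ [a ->]; exact: G0.
- by move=> B mB PB; rewrite -setTD; exact: (ind2 B setT mB measurableT (fun _ _ => I) PB GT).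
- move=> B mB tB PB.
  have mU n : measurable (\big[setU/set0]_(i < n) B i) by exact: bigsetU_measurable.
  apply: (cvg0 (fun n => \big[setU/set0]_(i < n) B i)).
  + exact: mU.
  + exact: bigcup_measurable.
  + elim=> [|n IH].
      by rewrite big_ord0 -(setDv setT); exact: (ind2 setT setT measurableT measurableT (fun _ _ => I) GT GT).
    rewrite big_ord_recr/=.
    rewrite (_ : \1_(_ `|` _) = (fun t => \1_(\big[setU/set0]_(i < n) B i) t + \1_(B n) t)).
      by rewrite (wintD mD mG G1 (bi _ (mU n)) (bi _ (mB n))) IH PB addr0.
    apply/funext => t; rewrite !indicE in_setU.
    have [tn|tn] := boolP (t \in B n); last by rewrite orbF addr0.
    rewrite orbT memNset ?add0r// -bigcup_mkord => -[i /= iN Bit].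
    have := tB i n I I (ex_intro _ t (conj Bit (set_mem tn))).
    by move=> ein; rewrite ein ltnn in iN.
  move=> t; rewrite !indicE; have [/set_mem[i _ Bit]|tN] := boolP (t \in \bigcup_k B k).
    apply: (@cvg_trans _ ((1 : R) @[_ --> \oo])); last exact: cvg_cst.
    apply: near_eq_cvg; exists i.+1 => // n /= iN; rewrite indicE mem_set// -bigcup_mkord.
    by exists i.
  apply: (@cvg_trans _ ((0 : R) @[_ --> \oo])); last exact: cvg_cst.
  apply: near_eq_cvg; apply: nearW => n; rewrite indicE memNset// -bigcup_mkord => -[i _ Bit].
  by move/negP: tN; apply; rewrite inE; exists i.
Unshelve. all: by end_near. Qed.

End Rays.

Let mu : {measure set (measurableTypeR R) -> \bar R} := @lebesgue_measure R.
Let D : set (measurableTypeR R) := `]0%R, +oo[%classic.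

Lemma gaussian_moments_eq0 G : smeasurable G -> (L1norm mu D G < +oo)%E ->
  (forall a : R, 0 <= a -> wint mu D G (fun r => expR (- (a * r ^+ 2))) = 0) ->
  {ae mu, forall r, D r -> G r = 0}.
Proof.
move=> mG G1 G0.
have mD : measurable D by exact: measurable_itv.
apply: smeasurable_eq0 => //; apply: wint_indic_eq0 => // c.
have bg a : 0 <= a -> bounded_weight D (fun r : measurableTypeR R => expR (- (a * r ^+ 2))).
  move=> a0; split.
    apply: measurableT_comp => //; apply: measurableT_comp => //.
    by apply: measurable_funM => //; exact: measurable_funX.
  by exists 1 => r _; rewrite ger0_norm ?expR_ge0// -expR0 ler_expR oppr_le0 mulr_ge0// sqr_ge0.
(* The i-th power of e^(-a r^2) is the Gaussian of parameter i a, so every monomial integrates to 0;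
   i = 0 is why the hypothesis includes a = 0. *)
have Gp a (p : {poly R}) : 0 <= a ->
    bounded_weight D (fun r : measurableTypeR R => p.[expR (- (a * r ^+ 2))]) /\
    wint mu D G (fun r => p.[expR (- (a * r ^+ 2))]) = 0.
  move=> a0.
  suff [H1 H2] : bounded_weight D (fun r : measurableTypeR R => \sum_(i < size p) p`_i * expR (- (a * r ^+ 2)) ^+ i) /\
      wint mu D G (fun r => \sum_(i < size p) p`_i * expR (- (a * r ^+ 2)) ^+ i) = 0.
    by under eq_fun do rewrite horner_coef.
  have mon i : bounded_weight D (fun r : measurableTypeR R => p`_i * expR (- (a * r ^+ 2)) ^+ i) /\
      wint mu D G (fun r => p`_i * expR (- (a * r ^+ 2)) ^+ i) = 0.
    have -> : (fun r => p`_i * expR (- (a * r ^+ 2)) ^+ i) =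
        (fun r => p`_i * expR (- ((i%:R * a) * r ^+ 2))).
      by apply/funext => r; rewrite -expRM_natl mulrN mulrA.
    have ia : 0 <= i%:R * a by rewrite mulr_ge0.
    split; first by apply: bounded_weightM => //; [exact: bounded_weight_cst|exact: bg].
    by rewrite wintZ ?G0 ?scaler0//; exact: bg.
  elim: (size p) => [|n [IH1 IH2]].
    under eq_fun do rewrite big_ord0.
    have b0 := bounded_weight_cst D (0 : R).
    split => //; have := wintZ mD mG G1 0 b0.
    by rewrite scale0r => <-; congr wint; apply/funext => t; rewrite mul0r.
  under eq_fun do rewrite big_ord_recr/=.
  have [m1 m2] := mon n.
  split; last by rewrite wintD// IH2 m2 addr0.
  have := bounded_weight_comb 1 1 IH1 m1.
  by congr bounded_weight; apply/funext => t; rewrite !mul1r.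
(* For c <= 0 the ray contains [D], and its indicator agrees there with the Gaussian of parameter
   0. *)
have [c0|c0] := leP c 0.
  transitivity (wint mu D G (fun r => expR (- (0 * r ^+ 2)))); last exact: G0.
  symmetry; apply: eq_wint => //; last exact: bg.
  move=> r; rewrite /D/= in_itv/= andbT => r0.
  by rewrite mul0r oppr0 expR0 indicE mem_set//= in_itv/= andbT (le_lt_trans c0).
(* Chosen so that e^(-a c^2) = 1/2: then r > c exactly when [u r] < 1/2, the threshold of
   [step_poly]. *)
pose a : R := ln 2 / c ^+ 2.
have ln2 : 0 < ln 2 :> R by rewrite ln_gt0// ltr1n.
have a0 : 0 <= a by rewrite divr_ge0 ?sqr_ge0// ltW.
pose u (r : R) := expR (- (a * r ^+ 2)).
have u0 r : 0 <= u r by exact: expR_ge0.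
have u1 r : u r <= 1 by rewrite -expR0 ler_expR oppr_le0 mulr_ge0// sqr_ge0.
have half : 2^-1 = expR (- ln 2) :> R by rewrite expRN lnK// posrE.
have cv : wint mu D G (fun r => (step_poly R n).[u r]) @[n --> \oo] --> wint mu D G \1_`]c, +oo[.
  apply: (@wint_cvg _ _ _ _ _ _ mD G mG G1 (fun n r => (step_poly R n).[u r]) _ 1) => //.
  - by move=> n; exact: (Gp a (step_poly R n) a0).1.1.
  - move=> n r _; have /andP[h1 h2] := @step_poly_itv _ n (u r) (introT andP (conj (u0 r) (u1 r))).
    by rewrite ger0_norm.
  move=> r; rewrite /D/= in_itv/= andbT => r0; rewrite indicE.
  have c2 : 0 < c ^+ 2 by rewrite exprn_gt0.
  have [cr|rc] := ltP c r.
    rewrite mem_set/= ?in_itv/= ?andbT//; apply: step_poly_cvg1; rewrite u0/= half ltr_expR ltrN2.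
    rewrite /a mulrAC ltr_pdivlMr// ltr_pM2l// ltr_pXn2r// nnegrE ltW//.
  rewrite memNset/= ?in_itv/= ?andbT; last by apply/negP; rewrite -leNgt.
  apply: step_poly_cvg0; rewrite u1 andbT half ler_expR lerN2.
  by rewrite /a mulrAC ler_pdivrMr// ler_pM2l// ler_pXn2r// nnegrE ltW.
apply: (cvg_rnorm_unique cv); under eq_fun do rewrite (Gp a _ a0).2.
exact: cvg_cst.
Qed.

End GaussianUniqueness.

(** * Bessel functions and the Hankel transform of Gaussians *)

Section BesselSeries.
Context (R : realType).
Implicit Types (x y : R) (n j : nat).

Arguments besselJ : simpl never.

Definition bessel_coeff n j : R := (-1) ^+ j / (j`! * (j + n)`!)%:R.

(* J_n(x) = (x / 2)^n * bessel_entire n ((x / 2)^2) *)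
Definition bessel_entire n y : R := limn (pseries (bessel_coeff n) y).

Lemma bessel_coeff_le n j : `|bessel_coeff n j| <= (n`!%:R)^-1 * (j`!%:R)^-1.
Proof.
rewrite /bessel_coeff normrM normrX normrN1 expr1n mul1r normfV ger0_norm//.
rewrite -invfM lef_pV2 ?posrE ?mulr_gt0 ?ltr0n ?muln_gt0 ?fact_gt0//.
by rewrite -natrM ler_nat mulnC leq_mul// leq_fact// leq_addl.
Qed.

Lemma bessel_coeff_cvg n y : cvgn (pseries (bessel_coeff n) y).
Proof.
apply: normed_cvg; apply: (@series_le_cvg _ _ (fun j => (n`!%:R)^-1 * exp_coeff `|y| j)).
- by move=> j /=; rewrite normr_ge0.
- by move=> j; rewrite mulr_ge0// exp_coeff_ge0.
- move=> j /=; rewrite normrM normrX /exp_coeff/= mulrCA mulrC.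
  by rewrite ler_wpM2l ?exprn_ge0// bessel_coeff_le.
- rewrite (_ : (fun j => _) = (n`!%:R)^-1 *: exp_coeff `|y|)//.
  by apply: is_cvg_seriesZ; exact: is_cvg_series_exp_coeff.
Qed.

Arguments bessel_coeff_cvg : clear implicits.

Lemma pseries_diffs_bessel n : pseries_diffs (bessel_coeff n) = - bessel_coeff n.+1.
Proof.
apply/funext => j; rewrite /pseries_diffs /bessel_coeff/= fctE/= exprS mulN1r.
rewrite !mulNr mulrN; congr (- _).
have f1 : (j`!%:R : R) != 0 by rewrite pnatr_eq0 -lt0n fact_gt0.
have f2 : ((j + n.+1)`!%:R : R) != 0 by rewrite pnatr_eq0 -lt0n fact_gt0.
have f3 : (j.+1%:R : R) != 0 by rewrite pnatr_eq0.
by rewrite addSnnS factS !natrM; field; rewrite f1 f2 nat1r f3.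
Qed.

Lemma pseriesN (f : nat -> R) y : pseries (- f) y = - pseries f y.
Proof.
apply/funext => n; rewrite -[RHS]/(- (pseries f y n)) /pseries /series/= -sumrN.
by apply: eq_bigr => i _; exact: mulNr.
Qed.

Lemma is_derive_bessel_entire n y : is_derive y 1 (bessel_entire n) (- bessel_entire n.+1 y).
Proof.
have cN k z : cvgn (pseries (- bessel_coeff k) z).
  by rewrite pseriesN; apply: is_cvgN; exact: bessel_coeff_cvg.
have := @pseries_snd_diffs R (bessel_coeff n) (`|y| + 1) y.
rewrite pseries_diffs_bessel pseries_diffsN pseries_diffs_bessel opprK.
move=> /(_ (bessel_coeff_cvg _ _) (cN _ _) (bessel_coeff_cvg _ _)).
rewrite [X in _ < X]ger0_norm ?addr_ge0// ltrDl ltr01 => /(_ isT).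
by rewrite pseriesN limN//; exact: bessel_coeff_cvg.
Qed.

Lemma bessel_entire_rec n y :
  bessel_entire n y = n.+1%:R * bessel_entire n.+1 y - y * bessel_entire n.+2 y.
Proof.
(* The recurrence is exact on partial sums if the last series has one term fewer, since the factor y
   raises the degree by one. *)
have fin N : pseries (bessel_coeff n) y N.+1 = n.+1%:R * pseries (bessel_coeff n.+1) y N.+1
    - y * pseries (bessel_coeff n.+2) y N.
  elim: N => [|N IH].
    rewrite /pseries /series/= !big_nat1 big_geq// mulr0 subr0 !expr0 !mulr1.
    have f1 : (n`!%:R : R) != 0 by rewrite pnatr_eq0 -lt0n fact_gt0.
    have f3 : (n.+1%:R : R) != 0 by rewrite pnatr_eq0.
    rewrite /bessel_coeff expr0 !add0n fact0 !mul1n factS natrM; field.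
    by rewrite f1 nat1r f3.
  have S (f : nat -> R) M : pseries f y M.+1 = pseries f y M + f M * y ^+ M.
    by rewrite /pseries/series/= big_nat_recr.
  rewrite S IH [in RHS]S [X in _ = _ - y * X]S.
  suff -> : bessel_coeff n N.+1 = n.+1%:R * bessel_coeff n.+1 N.+1 - bessel_coeff n.+2 N.
    by rewrite exprS; ring.
  rewrite /bessel_coeff exprS mulN1r !mulNr.
  rewrite (_ : (N.+1 + n.+1) = (N + n.+2))%N; last by lia.
  rewrite (_ : (N.+1 + n) = (N + n).+1)%N; last by lia.
  rewrite (_ : (N + n.+2) = (N + n).+2)%N; last by lia.
  rewrite !factS.
  have f1 : (N`!%:R : R) != 0 by rewrite pnatr_eq0 -lt0n fact_gt0.
  have f2 : ((N + n)`!%:R : R) != 0 by rewrite pnatr_eq0 -lt0n fact_gt0.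
  rewrite !natrM -!natr1 natrD.
  by field; rewrite f1 f2 -natrD !natr1 !pnatr_eq0.
have L (f : nat -> R) : cvgn f -> f N.+1 @[N --> \oo] --> limn f.
  by move=> cf; rewrite (cvg_shiftS f).
have c1 := L _ (bessel_coeff_cvg n y).
have c2 := L _ (bessel_coeff_cvg n.+1 y).
have c3 : pseries (bessel_coeff n.+2) y N @[N --> \oo] --> bessel_entire n.+2 y.
  exact: bessel_coeff_cvg.
have c4 : n.+1%:R * pseries (bessel_coeff n.+1) y N.+1 - y * pseries (bessel_coeff n.+2) y N @[N --> \oo] -->
   n.+1%:R * bessel_entire n.+1 y - y * bessel_entire n.+2 y.
  by apply: cvgB; apply: cvgM => //; exact: cvg_cst.
move: c1; under eq_fun do rewrite fin.
by move=> c1; exact: (cvg_unique _ c1 c4).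
Qed.

Lemma bessel_entire0 n : bessel_entire n 0 = (n`!%:R)^-1.
Proof.
apply: cvg_lim => //; apply: cvg_near_cst; exists 1%N => // -[//|N] _.
rewrite /pseries /series/= big_nat_recl// big1 => [|i _]; last by rewrite expr0n mulr0.
by rewrite addr0 expr0 mulr1 /bessel_coeff expr0 fact0 mul1n add0n mul1r.
Qed.

Lemma bessel_entire_le n y : `|bessel_entire n y| <= (n`!%:R)^-1 * expR `|y|.
Proof.
have c := bessel_coeff_cvg n y.
have cn : `|pseries (bessel_coeff n) y N| @[N --> \oo] --> `|bessel_entire n y|.
  by apply: cvg_norm; exact: c.
have ce : (n`!%:R)^-1 * series (exp_coeff `|y|) N @[N --> \oo] --> (n`!%:R)^-1 * expR `|y|.
  by apply: cvgM; [exact: cvg_cst|exact: is_cvg_series_exp_coeff].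
apply: (ler_cvg_to cn ce); apply: nearW => N.
rewrite /pseries /series/=; apply: (le_trans (ler_norm_sum _ _ _)).
rewrite mulr_sumr; apply: ler_sum => j _.
rewrite normrM normrX /exp_coeff/=.
apply: le_trans (ler_wpM2r _ (bessel_coeff_le n j)) _; first exact: exprn_ge0.
by rewrite -mulrA ler_wpM2l// mulrC.
Qed.

Lemma besselJ_natE n x : besselJ (Posz n) x = (x / 2) ^+ n * bessel_entire n ((x / 2) ^+ 2).
Proof.
rewrite /besselJ /bessel_entire.
have c : (x / 2) ^+ n * pseries (bessel_coeff n) ((x / 2) ^+ 2) N @[N --> \oo] -->
   (x / 2) ^+ n * limn (pseries (bessel_coeff n) ((x / 2) ^+ 2)).
  by apply: cvgM; [exact: cvg_cst|exact: bessel_coeff_cvg].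
apply: cvg_lim => //; apply: cvg_trans c; apply: near_eq_cvg; apply: nearW => N.
rewrite /pseries /series/= mulr_sumr; apply: eq_bigr => j _.
by rewrite /bessel_coeff mulrCA -exprM -exprD (addnC n).
Qed.

Lemma besselJ_opp k x : besselJ (- k) x = (-1) ^+ `|k|%N * besselJ k x.
Proof.
case: k => [[|n]|n].
- by rewrite oppr0 expr0 mul1r.
- by [].
- by rewrite NegzE opprK /= mulrA -exprMn mulrNN mulr1 expr1n mul1r.
Qed.

(** The factor x keeps the identity valid at x = 0. For n = 0 both sides vanish, as J_(-1) = -J_1;
    otherwise it is [bessel_entire_rec]. *)
Lemma besselJ_sum_nat n x :
  x * (besselJ (n%:Z - 1) x + besselJ (n%:Z + 1) x) = 2 * n%:R * besselJ n%:Z x.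
Proof.
case: n => [|n].
  rewrite sub0r add0r besselJ_opp expr1 mulN1r addNr !mulr0 !mul0r//.
rewrite (_ : n.+1%:Z - 1 = n%:Z); last by lia.
rewrite (_ : n.+1%:Z + 1 = n.+2%:Z); last by lia.
rewrite !besselJ_natE (bessel_entire_rec n) !exprS expr0.
by field.
Qed.

Lemma besselJ_sum k x :
  x * (besselJ (k - 1) x + besselJ (k + 1) x) = 2 * k%:~R * besselJ k x.
Proof.
case: (intP k) => [|n|n]; [exact: (besselJ_sum_nat 0)|exact: (besselJ_sum_nat n.+1)|].
rewrite (_ : - n.+1%:Z - 1 = - n.+2%:Z); last by lia.
rewrite (_ : - n.+1%:Z + 1 = - n%:Z); last by lia.
rewrite !besselJ_opp.
have := besselJ_sum_nat n.+1 x.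
rewrite (_ : n.+1%:Z - 1 = n%:Z); last by lia.
rewrite (_ : n.+1%:Z + 1 = n.+2%:Z); last by lia.
rewrite !absz_nat !exprS rmorphN => h.
transitivity ((-1) ^+ n * (x * (besselJ n x + besselJ n.+2 x))); first by ring.
by rewrite h; ring.
Qed.

Lemma is_derive_besselJ_nat n x :
  is_derive x 1 (besselJ n%:Z) ((besselJ (n%:Z - 1) x - besselJ (n%:Z + 1) x) / 2).
Proof.
rewrite (_ : besselJ n%:Z = (fun x => (x / 2) ^+ n * bessel_entire n ((x / 2) ^+ 2))); last first.
  by apply/funext => y; exact: besselJ_natE.
have dE := is_derive_bessel_entire n ((x / 2) ^+ 2).
have dz : is_derive x 1 (fun x : R => x / 2) (2^-1 : R).
  by apply: is_derive_eq; rewrite ?scaler0 ?add0r ?scale1r// /GRing.scale/= mulr1.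
have dq : is_derive x 1 (fun x : R => (x / 2) ^+ 2) (x / 2).
  by apply: is_derive_eq; rewrite /GRing.scale/=; field.
have dc := @is_derive1_comp R (bessel_entire n) (fun x => (x / 2) ^+ 2) x _ _ dE dq.
have dn := is_deriveX n dz.
have dp := is_deriveM dn dc.
rewrite [X in is_derive _ _ X _](_ : _ = ((fun x : R => x / 2) ^+ n) *
  (bessel_entire n \o (fun x => (x / 2) ^+ 2))); last first.
  by apply/funext => y; rewrite !fctE.
apply: (is_derive_eq dp).
rewrite !fctE /GRing.scale/=; case: n {dE dq dc dn dz dp} => [|n].
  rewrite sub0r add0r besselJ_opp expr1 mulN1r besselJ_natE !expr0 !mulr1 !expr1.
  by field.
rewrite (_ : n.+1%:Z - 1 = n%:Z); last by lia.
rewrite (_ : n.+1%:Z + 1 = n.+2%:Z); last by lia.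
rewrite !besselJ_natE (bessel_entire_rec n) !exprS expr0.
by field.
Qed.

Lemma is_derive_besselJ k x :
  is_derive x 1 (besselJ k) ((besselJ (k - 1) x - besselJ (k + 1) x) / 2).
Proof.
case: (intP k) => [|n|n]; [exact: is_derive_besselJ_nat|exact: is_derive_besselJ_nat|].
rewrite (_ : besselJ _ = (fun x => (-1) ^+ n.+1 * besselJ n.+1%:Z x)); last first.
  by apply/funext => y; rewrite besselJ_opp absz_nat.
have dJ := is_derive_besselJ_nat n.+1 x.
apply: is_derive_eq.
rewrite (_ : - n.+1%:Z - 1 = - n.+2%:Z); last by lia.
rewrite (_ : - n.+1%:Z + 1 = - n%:Z); last by lia.
rewrite (_ : n.+1%:Z - 1 = n%:Z); last by lia.
rewrite (_ : n.+1%:Z + 1 = n.+2%:Z); last by lia.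
rewrite !besselJ_opp !absz_nat /GRing.scale/= !exprS.
by field.
Qed.

Lemma besselJ_continuous k : continuous (besselJ k : R -> R).
Proof.
move=> x; apply: differentiable_continuous; apply/derivable1_diffP.
by have [] := is_derive_besselJ k x.
Qed.

Lemma besselJ0 k : k != 0 -> besselJ k (0 : R) = 0.
Proof.
case: k => [[//|n]|n] _; last rewrite NegzE besselJ_opp.
  by rewrite besselJ_natE mul0r exprS !mul0r.
by rewrite besselJ_natE mul0r exprS !mul0r mulr0.
Qed.

Lemma besselJ00 : besselJ 0 (0 : R) = 1.
Proof. by rewrite besselJ_natE expr0 mul1r mul0r expr0n bessel_entire0 fact0 invr1. Qed.

Lemma besselJ_abs k x : `|besselJ k `|x| | = `|besselJ k x|.
Proof.
have nat n : `|besselJ n%:Z `|x| | = `|besselJ n%:Z x|.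
  rewrite !besselJ_natE !normrM !normrX !normrM normr_id.
  by rewrite !exprMn real_normK// num_real.
case: k => [n|n]; first exact: nat.
by rewrite NegzE !besselJ_opp !normrM nat.
Qed.

(** The bound is uniform on [0, y], and its first factor is a term of the exponential series, so it
    tends to 0 as n grows. *)
Lemma besselJ_nat_le n x y : 0 <= x <= y ->
  `|besselJ n%:Z x| <= exp_coeff (y / 2) n * expR ((y / 2) ^+ 2).
Proof.
move=> /andP[x0 xy]; rewrite besselJ_natE normrM normrX ger0_norm ?divr_ge0//.
rewrite /exp_coeff/= -mulrA.
have h : x / 2 <= y / 2 by rewrite ler_pM2r.
have z0 : 0 <= x / 2 by rewrite divr_ge0.
apply: ler_pM => //; first exact: exprn_ge0.
  by rewrite lerXn2r// nnegrE// (le_trans z0).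
apply: (le_trans (bessel_entire_le _ _)); rewrite ler_wpM2l// ler_expR.
by rewrite ger0_norm ?sqr_ge0// lerXn2r// nnegrE// (le_trans z0).
Qed.

(* The derivatives of the squares telescope, and the tail J_N J_(N+1) tends to
   0; hence J_0^2 + 2 (J_1^2 + J_2^2 + ...) = 1. *)
Lemma besselJ_le1 k x : `|besselJ k x| <= 1.
Proof.
wlog x0 : x / 0 <= x.
  by move=> h; rewrite -besselJ_abs; apply: h.
pose S N y := besselJ 0 y ^+ 2 + 2 * \sum_(i < N) besselJ i.+1%:Z y ^+ 2.
have dS N y : is_derive y 1 (S N) (- 2 * (besselJ N%:Z y * besselJ N.+1%:Z y)).
  elim: N => [|N IH].
    rewrite (_ : S 0%N = (fun y => besselJ 0 y ^+ 2)); last first.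
      by apply/funext => z; rewrite /S big_ord0 mulr0 addr0.
    have d0 := is_derive_besselJ 0 y.
    apply: is_derive_eq; rewrite sub0r add0r besselJ_opp expr1 mulN1r /GRing.scale/=.
    by field.
  rewrite (_ : S N.+1 = (fun y => S N y + 2 * besselJ N.+1%:Z y ^+ 2)); last first.
    by apply/funext => z; rewrite /S big_ord_recr/= mulrDr addrA.
  have d0 := is_derive_besselJ N.+1%:Z y.
  apply: is_derive_eq.
  rewrite (_ : N.+1%:Z - 1 = N%:Z); last by lia.
  rewrite (_ : N.+1%:Z + 1 = N.+2%:Z); last by lia.
  by rewrite /GRing.scale/=; field.
have S0 N : S N 0 = 1.
  by rewrite /S besselJ00 expr1n big1 ?mulr0 ?addr0// => i _; rewrite besselJ0// expr0n.
pose b N := exp_coeff (x / 2) N * expR ((x / 2) ^+ 2).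
have b0 : b N @[N --> \oo] --> (0 : R).
  rewrite -(mul0r (expR ((x / 2) ^+ 2))); apply: cvgM; last exact: cvg_cst.
  exact: cvg_exp_coeff.
(* Mean value theorem on [0, x], starting from the value 1 at 0. *)
have SN N : S N x <= 1 + 2 * (b N * b N.+1) * x.
  have cS : {within `[0, x], continuous (S N)}.
    apply: continuous_subspaceT => y; apply: differentiable_continuous.
    by apply/derivable1_diffP; have [] := dS N y.
  have [c cx] := MVT_segment x0 (fun y _ => dS N y) cS.
  rewrite S0 subr0 => /eqP; rewrite subr_eq addrC => /eqP ->.
  rewrite lerD2l ler_wpM2r// mulNr -mulrN ler_wpM2l//.
  apply: (le_trans (ler_norm _)); rewrite normrN normrM.
  move: cx; rewrite in_itv/= => cx.
  by apply: ler_pM => //; exact: besselJ_nat_le.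
have c1 : 1 + 2 * (b N * b N.+1) * x @[N --> \oo] --> (1 : R).
  rewrite [X in _ --> X](_ : _ = 1 + 2 * (0 * 0) * x); last by rewrite !mulr0 mul0r addr0.
  apply: cvgD; first exact: cvg_cst.
  apply: cvgM; last exact: cvg_cst; apply: cvgM; first exact: cvg_cst.
  by apply: cvgM => //; rewrite (cvg_shiftS b).
have kN : exists2 n : nat, `|besselJ k x| = `|besselJ n%:Z x| & True.
  case: k => [n|n]; first by exists n.
  by exists n.+1 => //; rewrite NegzE besselJ_opp normrM normrX normrN1 expr1n mul1r.
have [n -> _] := kN.
rewrite -(@ler_pXn2r _ 2)// ?nnegrE// expr1n real_normK ?num_real//.
apply: (ler_cvg_to (cvg_cst (besselJ n%:Z x ^+ 2)) c1).
exists n => // N /= nN; apply: le_trans (SN N); rewrite /S.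
have sq (F : 'I_N -> R) : 0 <= \sum_(i < N) F i ^+ 2 by apply: sumr_ge0 => i _; exact: sqr_ge0.
(* J_n^2 is the leading term of [S N] or, with coefficient 2, a term of its sum once n <= N. *)
case: n nN => [|n] nN; first by rewrite lerDl mulr_ge0.
rewrite (bigD1 (Ordinal nN))//=.
have : 0 <= \sum_(i < N | i != Ordinal nN) besselJ i.+1%:Z x ^+ 2.
  by apply: sumr_ge0 => i _; exact: sqr_ge0.
have := sqr_ge0 (besselJ 0 x); have := sqr_ge0 (besselJ n.+1%:Z x).
lra.
Qed.

End BesselSeries.

(** * Gaussian integrals and the Hankel transform of r^K e^(-b r^2) *)

Section GaussianHankel.
Context (R : realType).
Implicit Types (b r rho : R).
Notation leb := (@lebesgue_measure R).
Local Notation gauss b r := (expR (- (b * r ^+ 2))).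

(** With y = b r^2, the exponential series gives e^y >= y^(N+1) / (N+1)!. *)
Lemma expr_gauss_le N b r : 0 < b -> 0 < r ->
  r ^+ N.*2 * gauss b r <= (N.+1)`!%:R / b ^+ N.+1 / r ^+ 2.
Proof.
move=> b0 r0; have y0 : 0 < b * r ^+ 2 by rewrite mulr_gt0 ?exprn_gt0.
have h : (b * r ^+ 2) ^+ N.+1 / (N.+1)`!%:R <= expR (b * r ^+ 2).
  by apply: le_trans (expR_ge1Dxn N (ltW y0)); rewrite lerDr.
have f0 : 0 < (N.+1)`!%:R :> R by rewrite ltr0n fact_gt0.
have rr : r ^+ 2 != 0 by rewrite gt_eqF// exprn_gt0.
have bb : b ^+ N.+1 != 0 by rewrite gt_eqF// exprn_gt0.
rewrite expRN ler_pdivrMr ?expR_gt0//.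
have -> : r ^+ N.*2 = (N.+1)`!%:R / b ^+ N.+1 / r ^+ 2 * ((b * r ^+ 2) ^+ N.+1 / (N.+1)`!%:R).
  rewrite exprMn [(r ^+ 2) ^+ _]exprS -exprM mul2n.
  by field; rewrite gt_eqF//= bb/= gt_eqF.
by rewrite ler_wpM2l// !divr_ge0// ?exprn_ge0// ltW.
Qed.

Lemma expr_gauss_cvg0 N b : 0 < b -> r ^+ N.*2 * gauss b r @[r --> +oo] --> (0 : R).
Proof.
move=> b0; pose C : R := (N.+1)`!%:R / b ^+ N.+1.
have C0 : 0 <= C by rewrite divr_ge0// exprn_ge0// ltW.
apply/cvgrPdist_le => e e0; near=> r.
have r1 : 1 <= r by near: r; exact: nbhs_pinfty_ge.
have r0 : 0 < r by rewrite (lt_le_trans _ r1).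
have rC : C / e <= r by near: r; apply: nbhs_pinfty_ge; rewrite num_real.
rewrite sub0r normrN ger0_norm; last first.
  by rewrite mulr_ge0 ?exprn_ge0 ?expR_ge0// ltW.
apply: (le_trans (expr_gauss_le N b0 r0)); rewrite -/C.
rewrite ler_pdivrMr ?exprn_gt0//; rewrite ler_pdivrMr// in rC.
apply: (le_trans rC); rewrite mulrC; apply: ler_wpM2l; first exact: ltW.
by rewrite expr2; apply: ler_peMr => //; exact: ltW.
Unshelve. all: by end_near. Qed.

(** An antiderivative of r^(2N+1) e^(-b r^2) vanishing at infinity; the recursion is integration by
    parts. *)
Fixpoint gauss_primitive b N r : R :=
  if N is N'.+1 then
    - ((2 * b)^-1 * (r ^+ N.*2 * gauss b r)) + N%:R / b * gauss_primitive b N' r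
  else - ((2 * b)^-1 * gauss b r).

Lemma is_derive_mul (f g : R -> R) (x df dg : R) : is_derive x 1 f df -> is_derive x 1 g dg ->
  is_derive x 1 (fun y => f y * g y) (df * g x + f x * dg).
Proof.
move=> hf hg; apply: (is_derive_eq (is_deriveM hf hg)).
by rewrite /GRing.scale/= addrC mulrC.
Qed.

Lemma is_derive_exprn n (x : R) : is_derive x 1 (fun y => y ^+ n) (n%:R * x ^+ n.-1).
Proof.
have dx : is_derive x 1 (id : R -> R) 1 by exact: is_derive_id.
have := is_deriveX n dx; rewrite [X in is_derive _ _ X _](_ : _ = (fun y => y ^+ n)).
  by move=> h; apply: (is_derive_eq h); rewrite /GRing.scale/= mulr1.
by apply/funext => y; rewrite fctE.
Qed.

Lemma is_derive_gauss b r : is_derive r 1 (fun r => gauss b r) (- (2 * b * r) * gauss b r).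
Proof.
have d1 : is_derive r 1 (fun r => - (b * r ^+ 2)) (- (2 * b * r)).
  by apply: is_derive_eq; rewrite /GRing.scale/=; ring.
apply: (is_derive_eq (@is_derive1_comp R expR (fun r => - (b * r ^+ 2)) _ _ _ (is_derive_expR _) d1)).
by rewrite mulrC.
Qed.

Lemma gauss_continuous b : continuous (fun r => gauss b r).
Proof.
move=> r; apply: differentiable_continuous; apply/derivable1_diffP.
by have [] := is_derive_gauss b r.
Qed.

Lemma is_derive_gauss_primitive b N r : 0 < b ->
  is_derive r 1 (gauss_primitive b N) (r ^+ N.*2.+1 * gauss b r).
Proof.
move=> b0; elim: N => [|N IH].
  have dg := is_derive_gauss b r.
  rewrite [X in is_derive _ _ X _](_ : _ = (fun r => - ((2 * b)^-1 * gauss b r)))//.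
  by apply: is_derive_eq; rewrite /GRing.scale/= double0 expr1; field; rewrite gt_eqF.
have dp := is_derive_mul (is_derive_exprn N.+1.*2 r) (is_derive_gauss b r).
have d1 := is_derive_mul (is_derive_cst (- (2 * b)^-1) r 1) dp.
have d2 := is_derive_mul (is_derive_cst (N.+1%:R / b) r 1) IH.
have d3 := is_deriveD d1 d2.
rewrite [X in is_derive _ _ X _](_ : _ = ((fun r => - (2 * b)^-1 * (r ^+ N.+1.*2 * gauss b r)) +
    (fun r => N.+1%:R / b * gauss_primitive b N r))); last first.
  by apply/funext => y; rewrite fctE mulNr.
apply: (is_derive_eq d3); rewrite !mul0r !add0r doubleS /= !exprS -mul2n -!natr1 natrM.
by field; rewrite gt_eqF.
Qed.

Lemma gauss_primitive0 b N : 0 < b -> gauss_primitive b N 0 = - (N`!%:R / (2 * b ^+ N.+1)).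
Proof.
move=> b0; elim: N => [|N IH] /=.
  by rewrite expr0n mulr0 oppr0 expR0 mulr1 fact0 expr1 mul1r.
rewrite IH expr0n/= mul0r mulr0 oppr0 add0r factS natrM !exprS.
have bn : b != 0 by rewrite gt_eqF.
have bN : b ^+ N != 0 by rewrite expf_neq0.
by field; rewrite bN bn.
Qed.

Lemma gauss_primitive_cvg0 b N : 0 < b -> gauss_primitive b N r @[r --> +oo] --> (0 : R).
Proof.
move=> b0; elim: N => [|N IH] /=.
  rewrite -oppr0 -(mulr0 (2 * b)^-1); apply: cvgN; apply: cvgM; first exact: cvg_cst.
  by have := expr_gauss_cvg0 0 b0; under eq_fun do rewrite expr0 mul1r.
rewrite -[X in _ --> X]addr0; apply: cvgD.
  rewrite -oppr0 -(mulr0 (2 * b)^-1); apply: cvgN; apply: cvgM; first exact: cvg_cst.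
  exact: (expr_gauss_cvg0 N.+1 b0).
by rewrite -(mulr0 (N.+1%:R / b)); apply: cvgM; [exact: cvg_cst|exact: IH].
Qed.

Lemma gaussian_moment b N : 0 < b ->
  (\int[leb]_(r in `]0%R, +oo[) (r ^+ N.*2.+1 * gauss b r)%:E = (N`!%:R / (2 * b ^+ N.+1))%:E)%E.
Proof.
move=> b0.
have df r := is_derive_gauss_primitive N r b0.
have cF : continuous (gauss_primitive b N).
  move=> r; apply: differentiable_continuous; apply/derivable1_diffP.
  by have [] := df r.
have cg : continuous (fun r => gauss b r) by exact: gauss_continuous.
have cf : continuous (fun r => r ^+ N.*2.+1 * gauss b r).
  by move=> r; apply: cvgM; [exact: exprn_continuous|exact: cg].
rewrite integral_itv_obnd_cbnd; last first.
  by apply/measurable_EFinP; apply: measurable_funTS; exact: continuous_measurable_fun.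
rewrite (@ge0_continuous_FTC2y _ _ (gauss_primitive b N) 0 0).
- by rewrite gauss_primitive0// -EFinB sub0r opprK.
- by move=> r r0; rewrite mulr_ge0 ?exprn_ge0// expR_ge0.
- exact: continuous_subspaceT.
- exact: gauss_primitive_cvg0.
- by move=> r _; have [] := df r.
- by apply: cvg_at_right_filter; exact: cF.
- by move=> r _; rewrite derive1E; have [_ ->] := df r.
Qed.

Section Transform.
Variables (K : nat) (b rho : R).
Hypothesis b0 : 0 < b.
Let D : set (measurableTypeR R) := `]0%R, +oo[%classic.
Let a j : R := bessel_coeff R K j * (rho / 2) ^+ (2 * j + K).
Let e j (r : R) : R := r ^+ (j + K).*2.+1 * gauss b r.
Let M j : R := (j + K)`!%:R / (2 * b ^+ (j + K).+1).

Let mD : measurable D. Proof. exact: measurable_itv. Qed.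

Let me j : measurable_fun setT (e j : measurableTypeR R -> R).
Proof.
apply: continuous_measurable_fun => r.
by apply: cvgM; [exact: exprn_continuous|exact: gauss_continuous].
Qed.

Let e0 j r : D r -> 0 <= e j r.
Proof.
rewrite /D/= in_itv/= andbT => r0.
by rewrite mulr_ge0 ?expR_ge0// exprn_ge0// ltW.
Qed.

Let intE j : (\int[leb]_(r in D) (e j r)%:E = (M j)%:E)%E.
Proof. exact: gaussian_moment. Qed.

(** [a j * e j r] is the j-th term of the integrand after expanding J_K(rho r). The factor (j + K)!
    of the Gaussian moment cancels the one in the Bessel coefficient, which leaves an exponential
    series. *)
Let aM j : a j * M j = rho ^+ K / (2 * b) ^+ K.+1 * exp_coeff (- (rho ^+ 2 / (4 * b))) j.
Proof.
rewrite /a /M /bessel_coeff /exp_coeff/= natrM.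
have f1 : ((j + K)`!%:R : R) != 0 by rewrite pnatr_eq0 -lt0n fact_gt0.
have f2 : (j`!%:R : R) != 0 by rewrite pnatr_eq0 -lt0n fact_gt0.
have bn : b != 0 by rewrite gt_eqF.
have bj : b ^+ j != 0 by rewrite expf_neq0.
have bK : b ^+ K != 0 by rewrite expf_neq0.
have dK : (2 : R) ^+ K != 0 by rewrite expf_neq0.
have -> : - (rho ^+ 2 / (4 * b)) = -1 * (rho / 2) ^+ 2 * b^-1 by field.
rewrite exprD exprM !exprMn !exprS exprD !exprVn.
have dj : (2 : R) ^+ j != 0 by rewrite expf_neq0.
by field; rewrite f1 f2 bn bj bK dK dj.
Qed.

Let f (n : nat) r := \sum_(j < n) a j * e j r.

Let fE n r : f n r = r ^+ K * gauss b r * r * ((rho * r / 2) ^+ K *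
  pseries (bessel_coeff R K) ((rho * r / 2) ^+ 2) n).
Proof.
rewrite /f /a /e /pseries /series/= big_mkord !mulr_sumr; apply: eq_bigr => j _.
have -> : r ^+ (j + K).*2.+1 = r * (r ^+ j * r ^+ K) ^+ 2.
  by rewrite exprS -muln2 exprM exprD.
have -> : (rho * r / 2) ^+ 2 ^+ j = (rho / 2) ^+ (2 * j) * (r ^+ j) ^+ 2.
  by rewrite -!exprM mulrAC (mulnC j) -exprMn.
have -> : (rho * r / 2) ^+ K = (rho / 2) ^+ K * r ^+ K by rewrite mulrAC exprMn.
by rewrite exprD; ring.
Qed.

Let f_cvg r : f n r @[n --> \oo] --> r ^+ K * gauss b r * besselJ K%:Z (rho * r) * r.
Proof.
under eq_fun do rewrite fE.
rewrite mulrAC; apply: cvgM; first exact: cvg_cst.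
rewrite besselJ_natE; apply: cvgM; first exact: cvg_cst.
exact: bessel_coeff_cvg.
Qed.

Let ie j : leb.-integrable D (EFin \o e j).
Proof.
apply/integrableP; split; first by apply/measurable_EFinP; exact: measurable_funTS.
rewrite (_ : (\int[leb]_(r in D) _ = \int[leb]_(r in D) (e j r)%:E)%E).
  by rewrite intE ltry.
by apply: eq_integral => r /set_mem Dr; rewrite /= ger0_norm// e0.
Qed.

Let g r : \bar R := (\sum_(0 <= j <oo) (`|a j| * e j r)%:E)%E.

(** The majorant for the termwise integration: by [aM] in absolute value, its integral is a multiple
    of e^(rho^2 / (4b)). *)
Let ig : leb.-integrable D g.
Proof.
have g0 j r : D r -> (0 <= (`|a j| * e j r)%:E)%E.
  by move=> Dr; rewrite lee_fin mulr_ge0// e0.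
have mg j : measurable_fun D (fun r => (`|a j| * e j r)%:E).
  by apply/measurable_EFinP; apply: measurable_funTS; exact: measurable_funM.
apply/integrableP; split.
  have := @ge0_emeasurable_sum _ _ R D (fun j r => (`|a j| * e j r)%:E) predT
    (fun k x Dx _ => g0 k x Dx) (fun k _ => mg k).
  by [].
rewrite (_ : (\int[leb]_(r in D) _ = \int[leb]_(r in D) g r)%E); last first.
  by apply: eq_integral => r /set_mem Dr; rewrite gee0_abs// nneseries_ge0// => j _ _; exact: g0.
rewrite integral_nneseries//.
pose A := `|rho| ^+ K / (2 * b) ^+ K.+1.
have A0 : 0 <= A by rewrite divr_ge0// exprn_ge0// mulr_ge0// ltW.
have EA j : (\int[leb]_(r in D) (`|a j| * e j r)%:E)%E = (A * exp_coeff (rho ^+ 2 / (4 * b)) j)%:E.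
  under eq_integral do rewrite EFinM.
  rewrite integralZl//; last exact: ie.
  rewrite intE -EFinM; congr EFin.
  have M0 : 0 <= M j by rewrite divr_ge0// mulr_ge0// exprn_ge0// ltW.
  rewrite -{1}(ger0_norm M0) -normrM aM normrM [X in _ * X]normrM normrX normrN.
  rewrite (ger0_norm (_ : 0 <= rho ^+ 2 / (4 * b))); last first.
    by rewrite divr_ge0 ?sqr_ge0// mulr_ge0// ltW.
  rewrite normrM normrX normfV normrX (ger0_norm (_ : 0 <= 2 * b)) ?mulr_ge0 ?ltW//.
  by rewrite normfV (ger0_norm (_ : 0 <= j`!%:R)).
under eq_eseriesr do rewrite EA.
apply: (@le_lt_trans _ _ (A * expR (rho ^+ 2 / (4 * b)))%:E); last exact: ltry.
apply: lime_le.
  by apply: is_cvg_nneseries => j _ _; rewrite lee_fin mulr_ge0// exp_coeff_ge0// divr_ge0 ?sqr_ge0// mulr_ge0// ltW.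
apply: nearW => n; rewrite sumEFin lee_fin -mulr_sumr ler_wpM2l//.
apply: nondecreasing_cvgn_le.
  apply/nondecreasing_seqP => k; rewrite /series/= big_nat_recr//= lerDl exp_coeff_ge0//.
  by rewrite divr_ge0 ?sqr_ge0// mulr_ge0// ltW.
exact: is_cvg_series_exp_coeff.
Qed.

Lemma hankel_gaussian :
  (\int[leb]_(r in `]0%R, +oo[) (r ^+ K * gauss b r * besselJ K%:Z (rho * r) * r)%:E =
   (rho ^+ K / (2 * b) ^+ K.+1 * expR (- (rho ^+ 2 / (4 * b))))%:E)%E.
Proof.
have mf n : measurable_fun D (fun r => (f n r)%:E).
  apply/measurable_EFinP; apply: measurable_funTS; apply: measurable_sum => j.
  exact: measurable_funM.
have mJ : measurable_fun D (fun r => (r ^+ K * gauss b r * besselJ K%:Z (rho * r) * r)%:E).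
  apply/measurable_EFinP; apply: measurable_funTS; apply: continuous_measurable_fun => r.
  apply: cvgM; last exact: cvg_id; apply: cvgM.
    by apply: cvgM; [exact: exprn_continuous|exact: gauss_continuous].
  apply: continuous_comp; last exact: besselJ_continuous.
  by apply: cvgM; [exact: cvg_cst|exact: cvg_id].
have cf : {ae leb, forall r, D r -> (f n r)%:E @[n --> \oo] -->
    (r ^+ K * gauss b r * besselJ K%:Z (rho * r) * r)%:E}.
  by apply: nearW => r _; apply: cvg_EFin; [exact: nearW|exact: f_cvg].
have fg : {ae leb, forall r n, D r -> (`|(f n r)%:E| <= g r)%E}.
  apply: nearW => r n Dr.
  apply: (@le_trans _ _ (\sum_(0 <= j < n) (`|a j| * e j r)%:E)%E); last first.
    by apply: nneseries_lim_ge => j _ _; rewrite lee_fin mulr_ge0// e0.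
  rewrite sumEFin lee_fin big_mkord; apply: (le_trans (ler_norm_sum _ _ _)).
  by apply: ler_sum => j _; rewrite normrM ler_wpM2l// ger0_norm// e0.
have [_ _] := dominated_convergence mD mf mJ cf ig fg.
have intf n : (\int[leb]_(r in D) (f n r)%:E = (\sum_(j < n) a j * M j)%:E)%E.
  under eq_integral do rewrite -sumEFin.
  rewrite integral_sum//; last first.
    by move=> j; under eq_fun do rewrite EFinM; apply: integrableZl => //; exact: ie.
  rewrite -sumEFin; apply: eq_bigr => j _.
  under eq_integral do rewrite EFinM.
  by rewrite integralZl// ?intE//; exact: ie.
rewrite (_ : [sequence _]_n = (fun n => (rho ^+ K / (2 * b) ^+ K.+1 * series (exp_coeff (- (rho ^+ 2 / (4 * b)))) n)%:E)); last first.
  apply/funext => n /=; rewrite intf; congr EFin.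
  by rewrite /series/= big_mkord mulr_sumr; apply: eq_bigr => j _; exact: aM.
move=> h; apply: (cvg_unique _ h) => //; apply: cvg_EFin; first exact: nearW.
by apply: cvgM; [exact: cvg_cst|exact: is_cvg_series_exp_coeff].
Qed.

End Transform.

End GaussianHankel.

(** * Iterated differential operators *)

Section RealDerivative.
Context (R : realType) (X : normedModType R[i]).
Implicit Types (f F : R -> X) (r : R) (j k : int).

Definition is_rderive f r (l : X) := diff_quot f r t @[t --> 0^'] --> l.

Lemma is_rderiveP f r l : is_rderive f r l -> rderivable f r /\ rderive f r = l.
Proof.
move=> h; split; first by apply/cvg_ex; exists l.
by apply: cvg_lim => //; exact: norm_hausdorff.
Qed.

Lemma is_rderive_pos f F r l : (forall t, 0 < t -> f t = F t) -> 0 < r ->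
  is_rderive F r l -> is_rderive f r l.
Proof.
move=> fF r0; apply: cvg_trans; apply: near_eq_cvg; near=> t.
rewrite /diff_quot !fF//.
have : `|t| < r by near: t; exact: dnbhs0_lt.
by rewrite ltr_norml => /andP[h _]; lra.
Unshelve. all: by end_near. Qed.

Lemma is_derive_cvg (u : R -> R) r (du : R) : is_derive r 1 u du ->
  t^-1 * (u (r + t) - u r) @[t --> 0^'] --> du.
Proof.
move=> [du1 du2]; have := du1; rewrite /derivable => /cvg_ex[l hl].
move: du2; rewrite /derive (cvg_lim _ hl)// => <-.
move: hl; apply: cvg_trans; apply: near_eq_cvg; apply: nearW => t.
by rewrite /= /GRing.scale/= mulr1 (addrC r t).
Qed.

Lemma is_rderive_scale (u : R -> R) (x : X) r (du : R) : is_derive r 1 u du ->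
  is_rderive (fun t => (u t)%:C *: x) r (du%:C *: x).
Proof.
move=> /is_derive_cvg h; rewrite /is_rderive.
rewrite (_ : diff_quot _ r = (fun t => (t^-1 * (u (r + t) - u r))%:C *: x)).
  by apply: cvg_rscale => //; exact: cvg_cst.
by apply/funext => t; rewrite /diff_quot -scalerBl -rmorphB/= scalerA -rmorphM.
Qed.

Lemma ext0E f F : continuous F -> (forall t, 0 < t -> f t = F t) ->
  forall r, 0 <= r -> ext0 f r = F r.
Proof.
move=> cF fF r r0; rewrite /ext0; have [->|rn0] := eqVneq r 0; last first.
  by rewrite fF// lt_neqAle eq_sym rn0.
apply: cvg_lim; first exact: norm_hausdorff.
have h : F t @[t --> 0^'+] --> F 0 by apply: cvg_at_right_filter; exact: cF.
apply: cvg_trans h; apply: near_eq_cvg; near=> t.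
by rewrite fF//; near: t; exact: nbhs_right_gt.
Unshelve. all: by end_near. Qed.

Lemma within_ext0 f F : continuous F -> (forall t, 0 < t -> f t = F t) ->
  {within `[0, +oo[, continuous (ext0 f)}.
Proof.
move=> cF fF; apply: (@subspace_eq_continuous _ _ _ F); last exact: continuous_subspaceT.
by move=> r; rewrite inE/= in_itv/= andbT => r0; exact/esym/ext0E.
Qed.

(* D_k^i leaves an order k - i where D_(-k+i) expects -k + i; the families C n j
   considered are invariant under j |-> -j because J_(-j) = (-1)^j J_j. *)
Section DmixClass.
Variables (k : int) (m : nat) (C : nat -> int -> (R -> X) -> Prop).
Hypothesis C_derivable : forall n j f, (n < m)%N -> C n j f ->
  forall r, 0 < r -> rderivable f r.
Hypothesis C_Dop : forall n j f, (n < m)%N -> C n j f -> C n.+1 (j - 1) (Dop j f).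
Hypothesis C_opp : forall n j f, C n j f -> C n (- j) f.
Hypothesis C_continuous : forall n j f, (n <= m)%N -> C n j f -> exists F : R -> X,
  [/\ continuous F, forall t, 0 < t -> f t = F t & j != 0 -> F 0 = 0].

Lemma C_Dpow n0 j f n : (n0 + n <= m)%N -> C n0 j f -> C (n0 + n) (j - n%:Z) (Dpow j n f).
Proof.
elim: n => [|n IH] nm Cf; first by rewrite addn0 subr0.
rewrite addnS (_ : j - n.+1%:Z = j - n%:Z - 1); last by lia.
by apply: C_Dop; [rewrite -addnS|apply: IH => //; rewrite addnS in nm; exact: ltnW].
Qed.

(** Index count: i steps lead from k to k - i, reflection gives -k + i, and n - i further steps give
    -k + i - (n - i). *)
Lemma C_Dmix f n i : (i <= n <= m)%N -> C 0 k f ->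
  C n (- (k + n%:Z - 2 * i%:Z)) (Dmix k n i f).
Proof.
move=> /andP[ni nm] Cf; rewrite /Dmix.
have := @C_Dpow 0 k f i (leq_trans ni nm) Cf; rewrite add0n => /C_opp C1.
have := @C_Dpow i (- k + i%:Z) (Dpow k i f) (n - i).
rewrite subnKC// => /(_ nm).
rewrite (_ : - (k - i%:Z) = - k + i%:Z) in C1; last by lia.
move=> /(_ C1); congr C; lia.
Qed.

Lemma C_regular f : {within `[0, +oo[, continuous f} -> C 0 k f -> regular_upto k m f.
Proof.
move=> cf Cf; split => // [n i /andP[ni nm] r r0|n i nim].
  by apply: (C_derivable nm (C_Dmix _ Cf)) => //; rewrite ni ltnW.
have [F [cF fF F0]] := C_continuous (proj2 (andP nim)) (C_Dmix nim Cf).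
split; first exact: within_ext0 fF.
rewrite (ext0E cF fF)//.
have [->|j0] := eqVneq (k + n%:Z - 2 * i%:Z) 0; first by rewrite scale0r.
by rewrite F0 ?scaler0// oppr_eq0.
Qed.

End DmixClass.

End RealDerivative.

(** * Gaussians as test functions *)

Section SchwartzGaussian.
Context (R : realType).
Implicit Types (b r rho : R) (j k : int) (q : {poly R}).
Notation leb := (@lebesgue_measure R).
Local Notation gauss b r := (expR (- (b * r ^+ 2))).

Lemma bounded_expr_gauss N b : 0 < b ->
  exists M : R, forall r, 0 <= r -> r ^+ N * gauss b r <= M.
Proof.
move=> b0; pose C : R := (N.+1)`!%:R / b ^+ N.+1.
have C0 : 0 <= C by rewrite divr_ge0// exprn_ge0// ltW.
exists (1 + C) => r r0; have [r1|r1] := leP r 1.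
  rewrite -[leLHS]addr0 lerD// mulr_ile1 ?exprn_ge0 ?expR_ge0// ?exprn_ile1//.
  by rewrite -expR0 ler_expR oppr_le0 mulr_ge0 ?sqr_ge0// ltW.
have rp : 0 < r by rewrite (lt_trans _ r1).
apply: (@le_trans _ _ (r ^+ N.*2 * gauss b r)).
  rewrite ler_wpM2r ?expR_ge0// -addnn exprD ler_peMr ?exprn_ge0//.
  by rewrite exprn_ege1// ltW.
apply: (le_trans (expr_gauss_le N b0 rp)).
apply: (@le_trans _ _ C); last by rewrite lerDr.
by rewrite -/C ler_pdivrMr ?exprn_gt0// ler_peMr// exprn_ege1// ltW.
Qed.

(** With a = |j| these functions form a class stable under [Dop j], going from j to j - 1. The even
    factor [q] absorbs the polynomials produced by differentiation. *)
Definition gauss_poly b (a : nat) q r : R := r ^+ a * q.[r ^+ 2] * gauss b r.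

Lemma is_derive_gauss_poly b a q r : is_derive r 1 (gauss_poly b a q)
  (gauss_poly b a.-1 (a%:R *: q) r + gauss_poly b a.+1 (2 *: q^`() - (2 * b) *: q) r).
Proof.
have d0 : is_derive r 1 (fun r => r ^+ 2) (2 * r).
  by have := is_derive_exprn 2 r; rewrite expr1.
have d1 : is_derive r 1 (fun r => q.[r ^+ 2]) (q^`().[r ^+ 2] * (2 * r)).
  have dq : is_derive (r ^+ 2) 1 (horner q) q^`().[r ^+ 2].
    exact: is_derive_poly.
  exact: (@is_derive1_comp R (horner q) (fun r => r ^+ 2) r _ _ dq d0).
have d2 := is_derive_mul (is_derive_mul (is_derive_exprn a r) d1) (is_derive_gauss b r).
apply: (is_derive_eq d2); rewrite /gauss_poly hornerZ hornerD hornerN !hornerZ (exprS r a).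
move: (expR _) (q.[_]) (q^`().[_]) => E Q Q'.
by ring.
Qed.

Lemma gauss_poly_continuous b a q : continuous (gauss_poly b a q).
Proof.
move=> r; apply: differentiable_continuous; apply/derivable1_diffP.
by have [] := is_derive_gauss_poly b a q r.
Qed.

Lemma gauss_poly_bounded b a q : 0 < b ->
  exists M : R, forall r, 0 <= r -> `|gauss_poly b a q r| <= M.
Proof.
move=> b0.
suff [M hM] : exists M : R, forall r, 0 <= r ->
    `|\sum_(i < size q) (q`_i * (r ^+ (a + 2 * i) * gauss b r))| <= M.
  exists M => r r0; apply: le_trans (hM r r0); rewrite /gauss_poly horner_coef.
  rewrite mulr_sumr mulr_suml le_eqVlt; apply/orP; left; apply/eqP; congr (`| _ |).
  by apply: eq_bigr => i _; rewrite exprD exprM; ring.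
elim: (size q) => [|n [M hM]]; first by exists 0 => r _; rewrite big_ord0 normr0.
have [M' hM'] := bounded_expr_gauss (a + 2 * n) b0.
exists (M + `|q`_n| * M') => r r0; rewrite big_ord_recr/=.
apply: (le_trans (ler_normD _ _)); rewrite lerD ?hM// normrM ler_wpM2l//.
by rewrite ger0_norm ?hM'// mulr_ge0 ?expR_ge0// exprn_ge0.
Qed.

Variable b : R.
Hypothesis b0 : 0 < b.

Let Cl (n : nat) j (f : R -> R[i]^o) :=
  exists q, forall r, 0 < r -> f r = (gauss_poly b `|j| q r)%:C.

Let realC (u : R -> R) : (fun r => (u r)%:C : R[i]^o) = (fun r => (u r)%:C *: (1 : R[i]^o)).
Proof. by apply/funext => r; rewrite /GRing.scale/= mulr1. Qed.

Let rderC a q (f : R -> R[i]^o) r : (forall r, 0 < r -> f r = (gauss_poly b a q r)%:C) ->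
  0 < r -> is_rderive f r
  (gauss_poly b a.-1 (a%:R *: q) r + gauss_poly b a.+1 (2 *: q^`() - (2 * b) *: q) r)%:C.
Proof.
move=> fE r0; apply: (is_rderive_pos fE r0).
have := @is_rderive_scale _ (R[i]^o : normedModType R[i]) _ 1 _ _ (is_derive_gauss_poly b a q r).
by rewrite -realC /GRing.scale/= mulr1.
Qed.

Let Cl_derivable n j f : Cl n j f -> forall r, 0 < r -> rderivable f r.
Proof. by move=> [q fE] r r0; have [] := is_rderiveP (rderC fE r0). Qed.

(** The term j/r meets the derivative of r^|j|. For j > 0 the two add to 2 j r^(j-1), matching |j -
    1| = |j| - 1; for j < 0 they cancel, and what remains has one more factor r, matching |j - 1| =
    |j| + 1. For j = 0 neither occurs. *)
Let Cl_Dop n j f : Cl n j f -> Cl n.+1 (j - 1) (Dop j f).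
Proof.
move=> [q fE].
have DE r : 0 < r -> Dop j f r = (gauss_poly b `|j|.-1 (`|j|%:R *: q) r +
    gauss_poly b `|j|.+1 (2 *: q^`() - (2 * b) *: q) r + j%:~R / r * gauss_poly b `|j| q r)%:C.
  move=> r0; rewrite /Dop (is_rderiveP (rderC fE r0)).2 fE//.
  by rewrite /GRing.scale/= -rmorphM -rmorphD.
case: (intP j) DE => [|a|a] DE.
- exists (2 *: q^`() - (2 * b) *: q) => r r0; rewrite DE//; congr (_%:C).
  rewrite absz0 scale0r /gauss_poly (_ : `|0 - 1|%N = 1%N)//= horner0.
  by ring.
- exists ((2 * a.+1%:R) *: q + (2 *: ('X * q^`())) - (2 * b) *: ('X * q)) => r r0.
  rewrite DE//; congr (_%:C).
  rewrite (_ : `|a.+1%:Z - 1|%N = a); last by lia.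
  rewrite /gauss_poly absz_nat/= !hornerD !hornerN !hornerZ !hornerM hornerX !(exprS r _.+1) (exprS r a).
  move: (expR _) (q.[_]) (q^`().[_]) (r ^+ a) => E Q Q' A.
  by field; rewrite gt_eqF.
- exists (2 *: q^`() - (2 * b) *: q) => r r0; rewrite DE//; congr (_%:C).
  rewrite (_ : `|- a.+1%:Z - 1|%N = a.+2); last by lia.
  rewrite abszN absz_nat /gauss_poly/= !hornerD !hornerN !hornerZ !(exprS r _.+1) (exprS r a) rmorphN/=.
  move: (expR _) (q.[_]) (q^`().[_]) (r ^+ a) => E Q Q' A.
  by field; rewrite gt_eqF.
Qed.

Let Cl_opp n j f : Cl n j f -> Cl n (- j) f.
Proof. by rewrite /Cl abszN. Qed.

Let Cl_cont a q : continuous (fun r => (gauss_poly b a q r)%:C : R[i]^o).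
Proof.
move=> r; rewrite realC; apply: (@cvg_rscale _ (R[i]^o : normedModType R[i]) _ _ _ (gauss_poly b a q) (fun=> 1)).
  exact: gauss_poly_continuous.
exact: cvg_cst.
Qed.

Let Cl_continuous n j f : Cl n j f -> exists F : R -> R[i]^o,
  [/\ continuous F, forall t, 0 < t -> f t = F t & j != 0 -> F 0 = 0].
Proof.
move=> [q fE]; exists (fun r => (gauss_poly b `|j| q r)%:C); split; [|by []|move=> j0].
  exact: Cl_cont.
by rewrite /gauss_poly expr0n absz_eq0 (negbTE j0) !mul0r.
Qed.

Lemma schwartz_gaussian k : schwartz k (fun r => (r ^+ `|k|%N * gauss b r)%:C).
Proof.
have E : (fun r => (r ^+ `|k|%N * gauss b r)%:C : R[i]^o) = (fun r => (gauss_poly b `|k| 1 r)%:C).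
  by apply/funext => r; rewrite /gauss_poly hornerC mulr1.
rewrite E.
have C0 : Cl 0 k (fun r => (gauss_poly b `|k| 1 r)%:C) by exists 1.
split=> [m|n i l ni].
  apply: (@C_regular _ _ k m Cl) => //.
  - by move=> n j f _; exact: Cl_derivable.
  - by move=> n j f _; exact: Cl_Dop.
  - by move=> n j f _; exact: Cl_continuous.
  - by apply: continuous_subspaceT; exact: Cl_cont.
have [q qE] : Cl n (- (k + n%:Z - 2 * i%:Z)) (Dmix k n i (fun r => (gauss_poly b `|k| 1 r)%:C : R[i]^o)).
  apply: (@C_Dmix _ _ k n Cl) => //; last by rewrite ni leqnn.
  by move=> n' j f _; exact: Cl_Dop.
set a := `|- _|%N in qE.
have [M hM] := gauss_poly_bounded (l + a) q b0.
exists M => r r0; rewrite (ext0E (@Cl_cont a q) qE)//.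
rewrite /rnorm normc_def/= expr0n addr0 sqrtr_sqr; apply: le_trans (hM r r0).
rewrite /gauss_poly exprD -!mulrA [leRHS]normrM (@ger0_norm _ (r ^+ l))//.
exact: exprn_ge0.
Qed.

Lemma hankel_gaussian_complex k rho :
  hankel k (fun r => (r ^+ `|k|%N * gauss b r)%:C) rho =
  ((if (k < 0)%R then (-1) ^+ `|k|%N else 1) * (rho ^+ `|k|%N / (2 * b) ^+ `|k|.+1
     * expR (- (rho ^+ 2 / (4 * b)))))%:C.
Proof.
rewrite /hankel /=; congr Complex; last first.
  rewrite /Rintegral integral0_eq// => r _; by rewrite !mul0r.
set s := (if _ then _ else _).
have JE x : besselJ k x = s * besselJ `|k|%N%:Z x.
  by rewrite /s; case: k {s} => n //=; rewrite mul1r.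
have := @hankel_gaussian _ `|k|%N b rho b0; set v := (rho ^+ _ / _ * _).
move=> IE; rewrite /Rintegral.
under eq_integral do rewrite JE.
clear JE; rewrite {}/s; case: ifP => _; last first.
  rewrite mul1r; transitivity (fine v%:E) => //; rewrite -IE; congr fine.
  by apply: eq_integral => r _; rewrite mul1r.
set F := fun r => (r ^+ `|k| * gauss b r * besselJ `|k|%N (rho * r) * r)%:E.
have -> : (\int[leb]_(x in `]0%R, +oo[) (x ^+ `|k| * gauss b x *
    ((-1) ^+ `|k| * besselJ `|k|%N (rho * x)) * x)%:E =
    ((-1) ^+ `|k|)%:E * \int[leb]_(x in `]0%R, +oo[) F x)%E.
  rewrite -signr_odd; case: (odd _); rewrite ?expr1 ?expr0; last first.
    by rewrite mul1e; apply: eq_integral => x _; rewrite mul1r.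
  rewrite EFinN mulN1e -integralN.
    by apply: eq_integral => x _; rewrite -EFinN; congr (_%:E); ring.
  (* A sign may cross the integral unless both the positive and the negative part have infinite
     integral; the finite value [v] excludes this. *)
  have p0 := @integral_ge0 _ _ _ leb `]0%R, +oo[ (F^\+)%E (fun x _ => funepos_ge0 _ x).
  have n0 := @integral_ge0 _ _ _ leb `]0%R, +oo[ (F^\-)%E (fun x _ => funeneg_ge0 _ x).
  have : (\int[leb]_(x in `]0%R, +oo[) (F^\+)%E x - \int[leb]_(x in `]0%R, +oo[) (F^\-)%E x = v%:E)%E.
    by rewrite -IE [RHS]integralE.
  by case: (\int[leb]_(x in _) (F^\+)%E x)%E p0 => [p||]; case: (\int[leb]_(x in _) (F^\-)%E x)%E n0.
by rewrite IE -EFinM.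
Qed.

End SchwartzGaussian.

(** * The inverse Hankel transform of an integrable function *)

Section BesselIntegrals.
Context (R : realType) (X : completeNormedModType R[i]).
Implicit Types (r rho c : R) (j k : int) (n : nat).
Let leb : {measure set (measurableTypeR R) -> \bar R} := @lebesgue_measure R.
Let D : set (measurableTypeR R) := `]0%R, +oo[%classic.
Let mD : measurable D. Proof. exact: measurable_itv. Qed.

Let D_gt0 rho : D rho -> 0 < rho. Proof. by rewrite /D/= in_itv/= andbT. Qed.

Variable m : nat.

Definition bracket rho : R := Num.sqrt (1 + rho ^+ 2) ^+ m.

Lemma bracket_gt0 rho : 0 < bracket rho.
Proof. by rewrite exprn_gt0// sqrtr_gt0 ltr_pwDl// sqr_ge0. Qed.

Lemma bracket_continuous : continuous bracket.
Proof.
move=> rho; apply: (@continuous_comp R R R (fun x => Num.sqrt (1 + x ^+ 2)) (fun x => x ^+ m)); last exact: exprn_continuous.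
apply: (@continuous_comp R R R (fun x => 1 + x ^+ 2) Num.sqrt); last exact: sqrt_continuous.
by apply: cvgD; [exact: cvg_cst|exact: exprn_continuous].
Qed.

Lemma exprn_le_bracket n rho : (n <= m)%N -> 0 <= rho -> rho ^+ n <= bracket rho.
Proof.
move=> nm rho0; have q1 : 1 <= Num.sqrt (1 + rho ^+ 2).
  by rewrite -[leLHS]sqrtr1 ler_sqrt ?lerDl ?sqr_ge0// addr_ge0// sqr_ge0.
have qr : rho <= Num.sqrt (1 + rho ^+ 2).
  by rewrite -[leLHS](ger0_norm rho0) -sqrtr_sqr ler_sqrt ?lerDr// addr_ge0// sqr_ge0.
apply: (@le_trans _ _ (Num.sqrt (1 + rho ^+ 2) ^+ n)).
  by rewrite lerXn2r// nnegrE ?sqrtr_ge0.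
by rewrite /bracket -(subnK nm) exprD ler_peMl ?exprn_ge0 ?sqrtr_ge0// exprn_ege1.
Qed.

(** Division by [bracket] undoes the factor put into [F], so that integrating [F] against this
    weight gives the integral of c rho^n h J_j(r rho) rho. The coefficient [c] carries the signs of
    J_(-j) = (-1)^|j| J_j. *)
Definition bessel_weight c n j r rho : R :=
  c * (rho ^+ n / bracket rho) * besselJ j (r * rho).

Lemma weight_continuous n : continuous (fun rho => rho ^+ n / bracket rho).
Proof.
move=> rho; apply: cvgM; first exact: exprn_continuous.
by apply: cvgV; [rewrite gt_eqF// bracket_gt0|exact: bracket_continuous].
Qed.

Lemma weight_measurable n : measurable_fun [set: measurableTypeR R] (fun rho => rho ^+ n / bracket rho).
Proof. by apply: continuous_measurable_fun; exact: weight_continuous. Qed.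

Lemma bessel_measurable j : measurable_fun [set: measurableTypeR R] (besselJ j : R -> R).
Proof. by apply: continuous_measurable_fun; exact: besselJ_continuous. Qed.

Lemma bessel_weight_measurable c n j :
  measurable_fun setT (fun p : measurableTypeR R * measurableTypeR R => bessel_weight c n j p.1 p.2).
Proof.
apply: measurable_funM.
  apply: measurable_funM; first exact: measurable_cst.
  exact: (measurableT_comp (weight_measurable n) measurable_snd).
apply: (measurableT_comp (bessel_measurable j)).
by apply: measurable_funM; [exact: measurable_fst|exact: measurable_snd].
Qed.

Lemma bessel_weight_measurable1 c n j r : measurable_fun [set: measurableTypeR R] (bessel_weight c n j r).
Proof.
apply: measurable_funM.
  by apply: measurable_funM; [exact: measurable_cst|exact: weight_measurable].
apply: (measurableT_comp (bessel_measurable j)).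
by apply: measurable_funM; [exact: measurable_cst|exact: measurable_id].
Qed.

Lemma weight_le1 c n rho : `|c| <= 1 -> (n <= m)%N -> D rho ->
  `|c * (rho ^+ n / bracket rho)| <= 1.
Proof.
move=> c1 nm /D_gt0 rho0.
rewrite normrM mulr_ile1// ger0_norm ?divr_ge0 ?exprn_ge0 ?(ltW rho0) ?(ltW (bracket_gt0 _))//.
by rewrite ler_pdivrMr ?bracket_gt0// mul1r exprn_le_bracket// ltW.
Qed.

Lemma bessel_weight_le1 c n j r rho : `|c| <= 1 -> (n <= m)%N -> D rho ->
  `|bessel_weight c n j r rho| <= 1.
Proof. by move=> c1 nm Dr; rewrite normrM mulr_ile1// ?weight_le1// besselJ_le1. Qed.

Lemma bessel_weight_bounded c n j r : `|c| <= 1 -> (n <= m)%N ->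
  bounded_weight D (bessel_weight c n j r).
Proof.
move=> c1 nm; split; first exact: bessel_weight_measurable1.
by exists 1 => rho Dr; exact: bessel_weight_le1.
Qed.

(** The derivative is half the difference of two Bessel values, each at most 1 in absolute value.
    This dominates difference quotients under the integral. *)
Lemma besselJ_lipschitz j (x y : R) : `|besselJ j x - besselJ j y| <= `|x - y|.
Proof.
wlog xy : x y / x <= y => [h|].
  by have [/h//|/ltW/h] := leP x y; rewrite distrC (distrC y).
have [|c _ E] := @MVT_segment _ (besselJ j) _ x y xy (fun z _ => is_derive_besselJ j z).
  by apply: continuous_subspaceT; exact: besselJ_continuous.
rewrite distrC E normrM (distrC x) ler_piMl// normrM (@ger0_norm _ 2^-1)// ler_pdivrMr// mul1r.
by rewrite (le_trans (ler_normB _ _))// -[2]/(1 + 1) lerD ?besselJ_le1.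
Qed.

Variable F : measurableTypeR R -> X.
Hypothesis mF : smeasurable F.
Hypothesis F1 : (L1norm leb D F < +oo)%E.

Definition bessel_int c n j : R -> X := fun r => wint leb D F (bessel_weight c n j r).

Lemma bessel_int_le c n j r : `|c| <= 1 -> (n <= m)%N ->
  rnorm (bessel_int c n j r) <= fine (L1norm leb D F).
Proof.
move=> c1 nm; rewrite -[leRHS]mul1r; apply: (rnorm_wint mD mF F1) => //.
  exact: bessel_weight_measurable1.
by move=> t Dt; exact: bessel_weight_le1.
Qed.

Lemma bessel_int_continuous c n j : `|c| <= 1 -> (n <= m)%N -> continuous (bessel_int c n j).
Proof.
move=> c1 nm r; pose d t := rnorm (bessel_int c n j t - bessel_int c n j r).
have dr : d r = 0 by rewrite /d subrr rnorm0.
(* Dominated convergence is about sequences, so continuity is first stated for the real function [d]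
   and then tested along sequences tending to r. *)
suff /continuous_withinNx : d t @[t --> r^'] --> d r.
  by rewrite /prop_for/= /continuous_at dr => d0; apply/cvg_rnormP.
rewrite dr; apply/cvgr_dnbhsP => u [_ ur].
apply/(cvg_rnormP (fun n0 => bessel_int c n j (u n0))).
apply: (@wint_cvg _ _ _ _ _ _ mD F mF F1 (fun i => bessel_weight c n j (u i)) _ 1).
- by move=> i; exact: bessel_weight_measurable1.
- exact: bessel_weight_measurable1.
- by move=> i t Dt; exact: bessel_weight_le1.
- move=> t Dt; apply: cvgM; first exact: cvg_cst.
  apply: (@cvg_comp _ _ _ (fun i => u i * t) (besselJ j)); last exact: besselJ_continuous.
  by apply: cvgM => //; exact: cvg_cst.
Qed.

Lemma bessel_int_opp c n j :
  bessel_int c n j = bessel_int (c * (-1) ^+ `|j|%N) n (- j).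
Proof.
apply/funext => r; congr wint; apply/funext => rho.
rewrite /bessel_weight besselJ_opp.
move: (_ ^+ `|j|) (sqrr_sign R `|j|) (rho ^+ n / _) => e e1 v.
by rewrite -[LHS]mulr1 -e1; ring.
Qed.

Lemma bessel_int0 c n j : j != 0 -> bessel_int c n j 0 = 0.
Proof.
move=> j0; rewrite /bessel_int (_ : bessel_weight c n j 0 = (fun=> 0 * 0)).
  rewrite (wintZ mD mF F1) ?scale0r//; exact: bounded_weight_cst.
by apply/funext => rho; rewrite /bessel_weight mul0r besselJ0// !mulr0.
Qed.

(** By the Lipschitz bound, the difference quotient of the weight is at most |c| rho^(n+1) /
    bracket, which is at most 1 because n + 1 <= m; [wint_cvg] then applies along every sequence of
    increments. *)
Lemma is_rderive_bessel_int c n j r : `|c| <= 1 -> (n < m)%N -> is_rderive (bessel_int c n j) r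
  (wint leb D F (fun rho => c * (rho ^+ n.+1 / bracket rho) *
    ((besselJ (j - 1) (r * rho) - besselJ (j + 1) (r * rho)) / 2))).
Proof.
move=> c1 nm; set w := (fun rho => _).
apply/cvg_rnormP.
apply/(@cvgr_dnbhsP R (fun t => rnorm (diff_quot (bessel_int c n j) r t - wint leb D F w)) 0 0) => u [u0 ur].
apply/(cvg_rnormP (fun i => diff_quot (bessel_int c n j) r (u i))).
pose W i rho := (u i)^-1 * (bessel_weight c n j (r + u i) rho - bessel_weight c n j r rho).
have bW t : bounded_weight D (bessel_weight c n j t).
  exact: bessel_weight_bounded c1 (ltnW nm).
have mW i : measurable_fun setT (W i).
  apply: measurable_funM; first exact: measurable_cst.
  by apply: measurable_funB; exact: bessel_weight_measurable1.
rewrite (_ : (fun i => _) = (fun i => wint leb D F (W i))); last first.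
  apply/funext => i; rewrite /diff_quot -(wintB mD mF F1)// -(wintZ mD mF F1)//.
  have := bounded_weight_comb 1 (-1) (bW (r + u i)) (bW r).
  by congr bounded_weight; apply/funext => t; rewrite mul1r mulN1r.
apply: (@wint_cvg _ _ _ _ _ _ mD F mF F1 W w 1) => //.
- apply: measurable_funM.
    by apply: measurable_funM; [exact: measurable_cst|exact: weight_measurable].
  apply: measurable_funM; last exact: measurable_cst.
  apply: measurable_funB; (apply: (measurableT_comp (bessel_measurable _));
    by apply: measurable_funM; [exact: measurable_cst|exact: measurable_id]).
- move=> i t Dt; have t0 : 0 < t := D_gt0 Dt.
  rewrite /W /bessel_weight -mulrBr mulrCA normrM.
  apply: (@le_trans _ _ (`|c * (t ^+ n / bracket t)| * `|t|)).
    rewrite ler_wpM2l// normrM normfV ler_pdivrMl ?normr_gt0// -normrM.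
    by rewrite (le_trans (besselJ_lipschitz _ _ _))// mulrDl (addrC (r * t)) addrK.
  rewrite -normrM (_ : c * (t ^+ n / bracket t) * t = c * (t ^+ n.+1 / bracket t)).
    exact: weight_le1.
  by rewrite exprSr -!mulrA (mulrC t).
- move=> t Dt; have t0 : 0 < t := D_gt0 Dt.
  have h := is_derive_cvg (is_derive_besselJ j (r * t)).
  have {}h : (u i * t)^-1 * (besselJ j (r * t + u i * t) - besselJ j (r * t)) @[i --> \oo] -->
      (besselJ (j - 1) (r * t) - besselJ (j + 1) (r * t)) / 2.
    move/cvgr_dnbhsP : h => /(_ (fun i => u i * t)); apply; split.
      by move=> i; rewrite mulf_neq0// gt_eqF.
    by rewrite -[X in _ --> X](mul0r t); apply: cvgM => //; exact: cvg_cst.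
  rewrite (_ : W ^~ t = (fun i => c * (t ^+ n.+1 / bracket t) *
      ((u i * t)^-1 * (besselJ j (r * t + u i * t) - besselJ j (r * t))))).
    by apply: cvgM => //; exact: cvg_cst.
  apply/funext => i; rewrite /W /bessel_weight mulrDl exprS.
  by field; rewrite u0 !gt_eqF// bracket_gt0.
Qed.

(** With x = r rho, J_j' = (J_(j-1) - J_(j+1)) / 2 and (j / x) J_j = (J_(j-1) + J_(j+1)) / 2, so
    adding the term j/r cancels J_(j+1). *)
Lemma Dop_bessel_int c n j f r : (forall t, 0 < t -> f t = bessel_int c n j t) ->
  `|c| <= 1 -> (n < m)%N -> 0 < r -> Dop j f r = bessel_int c n.+1 (j - 1) r.
Proof.
move=> fE c1 nm r0.
have bW c' n' j' : `|c'| <= 1 -> (n' <= m)%N -> bounded_weight D (bessel_weight c' n' j' r).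
  exact: bessel_weight_bounded.
rewrite /Dop (is_rderiveP (is_rderive_pos fE r0 (@is_rderive_bessel_int c n j r c1 nm))).2 (fE r r0).
rewrite /bessel_int -(wintZ mD mF F1); last exact: bW (ltnW nm).
rewrite -(wintD mD mF F1).
- congr wint; apply/funext => rho.
  have := besselJ_sum j (r * rho); rewrite /bessel_weight exprS.
  move: (besselJ _ _) (besselJ (j + 1) _) (besselJ j _) => A B C E.
  rewrite (_ : j%:~R / r * (c * (rho ^+ n / bracket rho) * C) =
    c * (rho ^+ n / bracket rho) / r / 2 * (2 * j%:~R * C)).
    by rewrite -E; field; rewrite !gt_eqF// bracket_gt0.
  by field; rewrite !gt_eqF// bracket_gt0.
- have := bounded_weight_comb (1 / 2) (- 1 / 2) (bW c n.+1 (j - 1) c1 nm) (bW c n.+1 (j + 1) c1 nm).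
  by congr bounded_weight; apply/funext => rho; rewrite /bessel_weight; ring.
- have := bounded_weight_comb (j%:~R / r) 0 (bW c n j c1 (ltnW nm)) (bW c n j c1 (ltnW nm)).
  by congr bounded_weight; apply/funext => rho; ring.
Qed.

Let Cl n j f := exists2 c, `|c| <= 1 & forall t, 0 < t -> f t = bessel_int c n j t.

Let Cl_Dop n j f : (n < m)%N -> Cl n j f -> Cl n.+1 (j - 1) (Dop j f).
Proof.
move=> nm [c c1 fE]; exists c; first exact: c1.
by move=> t t0; exact: (Dop_bessel_int fE c1 nm t0).
Qed.

Let Cl_opp n j f : Cl n j f -> Cl n (- j) f.
Proof.
move=> [c c1 fE]; exists (c * (-1) ^+ `|j|%N); first by rewrite normrM normrX normrN1 expr1n mulr1.
by move=> t t0; rewrite (fE t t0); exact: (congr1 (fun g => g t) (bessel_int_opp c n j)).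
Qed.

Let normr1_le1 : `|1 : R| <= 1. Proof. by rewrite normr1. Qed.

Let Cl0 k : Cl 0 k (bessel_int 1 0 k).
Proof. by exists 1. Qed.

Lemma bessel_int_regular k : regular_upto k m (bessel_int 1 0 k).
Proof.
apply: (@C_regular _ _ k m Cl) => //.
- move=> n j f nm [c c1 fE] r r0.
  by have [] := is_rderiveP (is_rderive_pos fE r0 (@is_rderive_bessel_int c n j r c1 nm)).
- move=> n j f nm [c c1 fE]; exists (bessel_int c n j); split => //.
    exact: bessel_int_continuous.
  exact: bessel_int0.
- by apply: continuous_subspaceT; exact: bessel_int_continuous.
Qed.

Lemma bessel_int_Dmix_le k n i r : (i <= n <= m)%N -> 0 <= r ->
  rnorm (ext0 (Dmix k n i (bessel_int 1 0 k)) r) <= fine (L1norm leb D F).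
Proof.
move=> inm r0; have nm := proj2 (andP inm).
have [c c1 E] := C_Dmix Cl_Dop Cl_opp inm (Cl0 k).
by rewrite (ext0E (bessel_int_continuous c1 nm) E)// bessel_int_le.
Qed.

Lemma bessel_int_Cb k : Cb k m (bessel_int 1 0 k).
Proof.
split; first exact: bessel_int_regular.
by move=> n i inm; exists (fine (L1norm leb D F)) => r r0; exact: bessel_int_Dmix_le.
Qed.

Lemma bessel_int_Cb_norm k : Cb_norm k m (bessel_int 1 0 k) <= fine (L1norm leb D F).
Proof.
have L0 : 0 <= fine (L1norm leb D F) by rewrite fine_ge0// L1norm_ge0.
apply: bigmax_le => // n _; apply: bigmax_le => // i _.
apply: ge_sup.
  by exists (rnorm (ext0 (Dmix k n i (bessel_int 1 0 k)) 0)), 0 => //=; rewrite in_itv/= lexx.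
move=> _ [r /= + <-]; rewrite in_itv/= andbT => r0.
by apply: (bessel_int_Dmix_le k _ r0); apply/andP; split; rewrite -ltnS; exact: ltn_ord.
Qed.

End BesselIntegrals.

(** * Integrability of Gaussians and of powers of 1 + r^2 *)

Section Moments.
Context (R : realType).
Implicit Types (a b r rho : R).
Let leb : {measure set (measurableTypeR R) -> \bar R} := @lebesgue_measure R.
Let D : set (measurableTypeR R) := `]0%R, +oo[%classic.
Let mD : measurable D. Proof. exact: measurable_itv. Qed.

Lemma integral_scale d (T : measurableType d) (mu : {measure set T -> \bar R})
  (E : set T) (mE : measurable E) (f : T -> R) c v : measurable_fun E f ->
  (\int[mu]_(x in E) (f x)%:E = v%:E)%E ->
  (\int[mu]_(x in E) (c * f x)%:E = (c * v)%:E)%E.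
Proof.
move=> mf fv; have iE : mu.-integrable E (EFin \o f).
  have mf' : measurable_fun E (EFin \o f) by apply/measurable_EFinP.
  apply/integrableP; split; first exact: mf'.
  by rewrite (integral_fin_num_abs mu mE mf) fv.
by rewrite EFinM -fv -(integralZl mE iE).
Qed.

(** Only odd powers have the explicit moments, and r^(N+1) <= r + r^(2N+1) for r > 0. *)
Lemma gaussian_integrable N a : 0 < a ->
  leb.-integrable D (fun r => (r ^+ N.+1 * expR (- (a * r ^+ 2)))%:E).
Proof.
move=> a0.
have c n : measurable_fun D (fun r => r ^+ n * expR (- (a * r ^+ 2))).
  apply: measurable_funTS; apply: continuous_measurable_fun => r.
  by apply: cvgM; [exact: exprn_continuous|exact: gauss_continuous].
have i n : leb.-integrable D (fun r => (r ^+ n.*2.+1 * expR (- (a * r ^+ 2)))%:E).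
  have := gaussian_moment n a0; set v := (_ / _) => E.
  apply/integrableP; split; first by apply/measurable_EFinP.
  by rewrite (integral_fin_num_abs leb mD)// E.
have ii := integrableD mD (i 0) (i N).
apply: (le_integrable mD _ _ ii); first by apply/measurable_EFinP.
move=> r; rewrite /D/= in_itv/= andbT => r0.
have g n : 0 <= r ^+ n * expR (- (a * r ^+ 2)) by rewrite mulr_ge0 ?expR_ge0// exprn_ge0// ltW.
rewrite lee_fin !ger0_norm ?addr_ge0//.
rewrite -mulrDl ler_wpM2r ?expR_ge0//.
have [r1|r1] := leP r 1.
  rewrite -[leLHS]addr0 lerD ?exprn_ge0 ?(ltW r0)//.
  by rewrite double0 exprS expr1 ler_piMr ?(ltW r0)// exprn_ile1// ltW.
rewrite -[leLHS]add0r lerD ?exprn_ge0 ?(ltW r0)//.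
by rewrite ler_weXn2l ?(ltW r1)// ltnS -addnn leq_addr.
Qed.

Lemma integral_japanese a : 0 < a ->
  (\int[leb]_(r in D) (r * (1 + r ^+ 2) `^ (- a - 1))%:E = (2 * a)^-1%:E)%E.
Proof.
move=> a0; pose P r : R := - (2 * a)^-1 * (1 + r ^+ 2) `^ (- a).
have p0 r : 0 < 1 + r ^+ 2 by rewrite ltr_pwDl// sqr_ge0.
have dP r : is_derive r 1 P (r * (1 + r ^+ 2) `^ (- a - 1)).
  have d0 : is_derive r 1 (fun r => 1 + r ^+ 2) (2 * r).
    have := is_deriveD (is_derive_cst (1 : R) r 1) (is_derive_exprn 2 r).
    by rewrite add0r expr1.
  have := @is_derive1_comp R (fun x : R => x `^ (- a)) (fun r => 1 + r ^+ 2) r _ _ (is_derive1_powR (- a) (p0 r)) d0.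
  move/(is_deriveZ (- (2 * a)^-1)) => d; apply: (is_derive_eq d).
  by rewrite /GRing.scale/=; field; rewrite gt_eqF.
have cP : continuous P.
  move=> r; apply: differentiable_continuous; apply/derivable1_diffP.
  by have [] := dP r.
have cf : continuous (fun r => r * (1 + r ^+ 2) `^ (- a - 1)).
  move=> r; apply: cvgM; first exact: cvg_id.
  apply: (@continuous_comp R R R (fun x => 1 + x ^+ 2) (fun x : R => x `^ (- a - 1))).
    by apply: cvgD; [exact: cvg_cst|exact: exprn_continuous].
  apply: differentiable_continuous; apply/derivable1_diffP.
  by have [] := is_derive1_powR (- a - 1) (p0 r).
rewrite integral_itv_obnd_cbnd; last first.
  by apply/measurable_EFinP; apply: measurable_funTS; exact: continuous_measurable_fun.
rewrite (@ge0_continuous_FTC2y _ _ P 0 0).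
- by rewrite /P expr0n addr0 powR1 mulr1 -EFinB sub0r opprK.
- by move=> r r0; rewrite mulr_ge0// powR_ge0.
- exact: continuous_subspaceT.
- apply/cvgrPdist_le => e e0; near=> r.
  (* The bound wanted is (1 + r^2)^(-a) <= 2 a e, ensured by r >= (2 a e)^(-1/a) together with r >=
     1. *)
  pose e' := e * (2 * a); have e'0 : 0 < e' by rewrite mulr_gt0// mulr_gt0.
  have r1 : 1 <= r by near: r; apply: nbhs_pinfty_ge; rewrite num_real.
  have re : e' `^ (- a^-1) <= r by near: r; apply: nbhs_pinfty_ge; rewrite num_real.
  rewrite sub0r /P mulNr opprK ger0_norm ?mulr_ge0 ?powR_ge0 ?invr_ge0 ?mulr_ge0 ?(ltW a0)//.
  rewrite ler_pdivrMl ?mulr_gt0// (mulrC _ e) -/e' powRN invf_ple ?posrE ?powR_gt0//.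
  have -> : e'^-1 = (e' `^ (- a^-1)) `^ a.
    by rewrite -powRrM mulNr mulVf ?gt_eqF// powR_inv1// ltW.
  apply: ge0_ler_powR; rewrite ?nnegrE ?powR_ge0 ?(ltW a0) ?(ltW (p0 r))//.
  by rewrite (le_trans re)// -[leLHS]add0r lerD// ler_eXnr.
- by move=> r _; have [] := dP r.
- by apply: cvg_at_right_filter; exact: cP.
- by move=> r _; rewrite derive1E; have [_ ->] := dP r.
Unshelve. all: by end_near. Qed.

End Moments.

(** * A Cauchy-Schwarz inequality with a simple constant *)

Section CauchySchwarz.
Context d (T : measurableType d) (R : realType) (mu : {measure set T -> \bar R}).
Variables (D : set T) (mD : measurable D).

(** Integrating u v <= l u^2 / 2 + v^2 / (2 l) and taking l = sqrt B yields (K + 1) / 2 times sqrt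
    B. *)
Lemma cauchy_schwarz_le (u v w : T -> R) (K B : R) :
  measurable_fun D u -> measurable_fun D v -> measurable_fun D w ->
  (forall t, D t -> 0 <= u t) -> (forall t, D t -> 0 <= v t) -> (forall t, D t -> 0 <= w t) ->
  (\int[mu]_(t in D) (u t ^+ 2 * w t)%:E = K%:E)%E ->
  (\int[mu]_(t in D) (v t ^+ 2 * w t)%:E = B%:E)%E ->
  (\int[mu]_(t in D) (u t * v t * w t)%:E <= ((K + 1) / 2 * Num.sqrt B)%:E)%E.
Proof.
move=> mu_ mv mw u0 v0 w0 uK vB.
have mq (z : T -> R) : measurable_fun D z -> measurable_fun D (fun t => (z t ^+ 2 * w t)%:E).
  move=> mz; apply/measurable_EFinP; apply: measurable_funM => //.
  exact: measurable_funX.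
have q0 (z : T -> R) t : D t -> (0 <= (z t ^+ 2 * w t)%:E)%E.
  by move=> Dt; rewrite lee_fin mulr_ge0 ?sqr_ge0 ?w0.
have K0 : 0 <= K by rewrite -lee_fin -uK integral_ge0// => t; exact: q0.
have B0 : 0 <= B by rewrite -lee_fin -vB integral_ge0// => t; exact: q0.
have amgm (l : R) : 0 < l ->
    (\int[mu]_(t in D) (u t * v t * w t)%:E <= (l / 2 * K + (2 * l)^-1 * B)%:E)%E.
  move=> l0; have l20 : 0 <= l / 2 by rewrite divr_ge0// ltW.
  have l21 : 0 <= (2 * l)^-1 by rewrite invr_ge0 mulr_ge0// ltW.
  rewrite EFinD (EFinM _ K) (EFinM _ B) -uK -vB -!ge0_integralZl//; do ?exact: mq; do ?exact: q0.
  rewrite -ge0_integralD//; last first.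
  - by apply: measurable_funeM; exact: mq.
  - by move=> t Dt; apply: mule_ge0 => //; exact: q0.
  - by apply: measurable_funeM; exact: mq.
  - by move=> t Dt; apply: mule_ge0 => //; exact: q0.
  apply: ge0_le_integral => //.
  - by move=> t Dt; rewrite lee_fin !mulr_ge0 ?u0 ?v0 ?w0.
  - by apply/measurable_EFinP; apply: measurable_funM => //; exact: measurable_funM.
  - by apply: emeasurable_funD; apply: measurable_funeM; exact: mq.
  move=> t Dt; rewrite -!EFinM -EFinD lee_fin -subr_ge0.
  rewrite (_ : _ - _ = (l * u t - v t) ^+ 2 * w t / (2 * l)); last by field; rewrite gt_eqF.
  apply: divr_ge0; last by rewrite mulr_ge0// ltW.
  by apply: mulr_ge0; [exact: sqr_ge0|exact: w0].
have [B_eq0|] := eqVneq B 0; last first.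
  move=> Bn0; have Bp : 0 < B by rewrite lt_neqAle eq_sym Bn0.
  have sB : 0 < Num.sqrt B by rewrite sqrtr_gt0.
  apply: (le_trans (amgm _ sB)); rewrite lee_fin.
  have BE : B = Num.sqrt B ^+ 2 by rewrite sqr_sqrtr.
  rewrite [X in _ + _ * X <= _]BE le_eqVlt; apply/orP; left; apply/eqP.
  by field; rewrite gt_eqF.
rewrite B_eq0 sqrtr0 mulr0; apply/lee_addgt0Pr => e e0; rewrite add0e.
(* For B = 0 the choice l = sqrt B degenerates; this l makes the bound l K / 2 at most e. *)
have l0 : 0 < 2 * e / (K + 1) by rewrite divr_gt0 ?mulr_gt0// ltr_wpDl.
apply: (le_trans (amgm _ l0)); rewrite lee_fin B_eq0 mulr0 addr0.
rewrite (_ : _ * K = e * (K / (K + 1))); last by field; rewrite gt_eqF// ltr_wpDl.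
by rewrite ler_piMr ?(ltW e0)// ler_pdivrMr ?mul1r ?lerDl// ltr_wpDl.
Qed.

End CauchySchwarz.

(** * Identification of f with the inverse transform *)

Section HankelRepresentation.
Context (R : realType) (X : completeNormedModType R[i]).
Implicit Types (a r rho : R).
Let leb : {measure set (measurableTypeR R) -> \bar R} := @lebesgue_measure R.
Let D : set (measurableTypeR R) := `]0%R, +oo[%classic.
Let mD : measurable D. Proof. exact: measurable_itv. Qed.
Let D_gt0 rho : D rho -> 0 < rho. Proof. by rewrite /D/= in_itv/= andbT. Qed.

Variables (k : int) (m : nat) (F f h : measurableTypeR R -> X).
Hypothesis mF : smeasurable F.
Hypothesis F1 : (L1norm leb D F < +oo)%E.
Hypothesis Fh : (fun rho => (rho * bracket m rho)%:C *: h rho) = F %[ae leb in D].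
Hypothesis fh : is_hankel_transform k f h.

Let g := bessel_int m F 1 0 k.
Let eps : R := if (k < 0)%R then (-1) ^+ `|k|%N else 1.
Let K := `|k|%N.
Let gam a r : R := r ^+ K.+1 * expR (- (a * r ^+ 2)).

Let eps2 : eps * eps = 1.
Proof. by rewrite /eps; case: ifP => _; rewrite ?mulr1// -expr2 sqrr_sign. Qed.

Let besselJ_absz x : besselJ k x = eps * besselJ K%:Z x.
Proof. by rewrite /eps /K; case: (k) => n //=; rewrite mul1r. Qed.

Let mgam a : measurable_fun [set: measurableTypeR R] (gam a : measurableTypeR R -> R).
Proof.
apply: continuous_measurable_fun => r.
by apply: cvgM; [exact: exprn_continuous|exact: gauss_continuous].
Qed.

(** Fubini moves the kernel J_k(r rho) onto the Gaussian, where [hankel_gaussian] evaluates the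
    inner integral. The factor eps (2a)^(K+1) cancels the sign of J_k and the constant of that
    transform. *)
Lemma gaussian_fubini a : 0 < a ->
  is_bochner_integral leb D
    (fun r => (eps * (2 * a) ^+ K.+1 * gam a r)%:C *: g r)
    (wint leb D F (fun rho => rho ^+ K * expR (- ((4 * a)^-1 * rho ^+ 2)) / bracket m rho)).
Proof.
move=> a0; set c := eps * _; pose phi rho := rho ^+ K * expR (- ((4 * a)^-1 * rho ^+ 2)) / bracket m rho.
have bp (x : R) : bracket m x != 0 by rewrite gt_eqF// bracket_gt0.
have [M hM] := @bounded_expr_gauss R K (4 * a)^-1 ltac:(by rewrite invr_gt0 mulr_gt0).
apply: (@bochner_fubini _ _ _ _ (@lebesgue_measure R) D mD (fun r => c * gam a r) phi
  (bessel_weight m 1 0 k) 1 M) => //.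
- by apply: measurable_funM; [exact: measurable_cst|exact: mgam].
- rewrite (_ : EFin \o _ = (fun r => c%:E * (gam a r)%:E)%E)//.
  by apply: integrableZl => //; exact: gaussian_integrable.
- apply: continuous_measurable_fun => r; apply: cvgM.
    by apply: cvgM; [exact: exprn_continuous|exact: gauss_continuous].
  by apply: cvgV => //; exact: bracket_continuous.
- exact: bessel_weight_measurable.
- by move=> r t _ Dt; apply: bessel_weight_le1 => //; rewrite normr1.
- move=> t /D_gt0 /ltW t0; rewrite /phi ger0_norm; last first.
    by rewrite divr_ge0 ?mulr_ge0 ?exprn_ge0 ?expR_ge0// ltW// bracket_gt0.
  apply: le_trans (hM t t0); rewrite ler_piMr ?mulr_ge0 ?exprn_ge0 ?expR_ge0//.
  rewrite invf_le1 ?bracket_gt0//.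
  by have := @exprn_le_bracket R m 0 t (leq0n m) t0; rewrite expr0.
- move=> t Dt.
  have := hankel_gaussian K t a0; set v := (_ * expR _) => E.
  have E' : (\int[leb]_(r in D) (c * eps / bracket m t * (r ^+ K * expR (- (a * r ^+ 2)) *
      besselJ K%:Z (t * r) * r))%:E = (c * eps / bracket m t * v)%:E)%E.
    apply: integral_scale => //; apply: measurable_funTS; apply: continuous_measurable_fun => r.
    apply: cvgM => //; apply: cvgM.
      by apply: cvgM; [exact: exprn_continuous|exact: gauss_continuous].
    apply: (@continuous_comp R R R (fun r => t * r) (besselJ K%:Z)); last exact: besselJ_continuous.
    by apply: cvgM => //; exact: cvg_cst.
  transitivity (c * eps / bracket m t * v)%:E; last first.
    congr (_%:E); rewrite (_ : c * eps = (2 * a) ^+ K.+1); last by rewrite /c mulrAC eps2 mul1r.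
    rewrite /phi /v (_ : (4 * a)^-1 * t ^+ 2 = t ^+ 2 / (4 * a)); last exact: mulrC.
    have : (2 * a) ^+ K.+1 != 0 by rewrite expf_neq0// mulf_neq0// gt_eqF.
    move: ((2 * a) ^+ _) (expR _) => A B A0.
    by field; rewrite A0 bp.
  rewrite -E'; apply: eq_integral => r _; congr (_%:E).
  rewrite /bessel_weight besselJ_absz (mulrC r t) /gam exprSr.
  by ring.
- apply: continuous_smeasurable; apply: bessel_int_continuous => //.
  by rewrite normr1.
Qed.

(* With b = 1 / (4 a), the Hankel transform of r^K e^(-b r^2) is a multiple of
   r^K e^(-a r^2). *)
Lemma hankel_moment a : 0 < a ->
  is_bochner_integral leb D (fun r => (gam a r)%:C *: (f r - g r)) 0.
Proof.
move=> a0; pose b := (4 * a)^-1; have b0 : 0 < b by rewrite invr_gt0 mulr_gt0.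
have [i1 i2 E] := fh (schwartz_gaussian b0 k).
set c := eps * (2 * a) ^+ K.+1.
have c0 : c != 0.
  apply: mulf_neq0; last first.
    by apply: expf_neq0; apply: mulf_neq0; [rewrite pnatr_eq0|exact: lt0r_neq0].
  by apply/eqP => e0; move: eps2; rewrite e0 mul0r => /eqP; rewrite eq_sym oner_eq0.
have hE r : hankel k (fun r => (r ^+ `|k|%N * expR (- (b * r ^+ 2)))%:C) r * r%:C =
    (c * gam a r)%:C.
  rewrite (hankel_gaussian_complex b0) -rmorphM; congr (_%:C).
  rewrite -/eps -/K /c /gam /b (_ : r ^+ 2 / (4 * (4 * a)^-1) = a * r ^+ 2); last first.
    by field; rewrite gt_eqF.
  rewrite (_ : 2 * (4 * a)^-1 = (2 * a)^-1); last by field; rewrite gt_eqF.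
  rewrite exprVn invrK (exprSr r K).
  by move: ((2 * a) ^+ _) (expR _) => A B; ring.
have pi0 : (2 * pi)%:C != 0 :> R[i].
  by rewrite fmorph_eq0; apply: lt0r_neq0; apply: mulr_gt0; [rewrite ltr0n|exact: pi_gt0].
move: E; rewrite /dist => /(scalerI pi0) E2.
have I1 := bochner_integralP mD i1; have I2 := bochner_integralP mD i2.
rewrite {}E2 in I1.
set w := bochner_integral _ _ _ in I1 I2.
have I4 := gaussian_fubini a0.
(* The h side of the distributional identity, rewritten over [F]. By uniqueness its value [w] is the
   one in [gaussian_fubini], so the integrals in [I1] and [I4] coincide. *)
have I3 : is_bochner_integral leb D (fun rho => (rho ^+ K * expR (- (b * rho ^+ 2)) / bracket m rho)%:C *: F rho) w.
  apply: (is_bochner_integral_ae mD _ I2); move: Fh; apply: filterS => rho H Dr.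
  rewrite -(H Dr) scalerA -!rmorphM; congr (_%:C *: _).
  by field; rewrite gt_eqF// bracket_gt0.
rewrite /wint -/b (bochner_integralE mD I3) -/c in I4.
have := is_bochner_integral_comb mD c^-1 (- c^-1) I1 I4.
rewrite [X in is_bochner_integral _ _ _ X](_ : _ = 0); last first.
  by rewrite rmorphN scaleNr subrr.
congr is_bochner_integral; apply/funext => r; rewrite hE !scalerA -!rmorphM/=.
by rewrite mulNr mulKf// rmorphN scaleNr scalerBr.
Qed.

(** [G] is f - g times [gam 1], integrable by [hankel_moment] at a = 1. Its Gaussian moments vanish,
    hence so does [G], and [gam 1 r] is nonzero for r > 0. *)
Lemma hankel_ae_eq : strongly_measurable leb D f -> f = g %[ae leb in D].
Proof.
move=> /(strongly_measurableP mD)[ft mft fft].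
have mg : smeasurable (g : measurableTypeR R -> X).
  by apply: continuous_smeasurable; apply: bessel_int_continuous => //; rewrite normr1.
pose G (r : measurableTypeR R) : X := (gam 1 r)%:C *: (ft r - g r).
have mom a : 0 < a -> is_bochner_integral leb D (fun r => (gam a r)%:C *: (ft r - g r)) 0.
  move=> a0; apply: (is_bochner_integral_ae mD _ (hankel_moment a0)).
  by move: fft; apply: filterS => r H Dr; rewrite (H Dr).
have mG : smeasurable G.
  by apply: smeasurableZ; [exact: mgam|exact: smeasurableB].
have G1 : (L1norm leb D G < +oo)%E := bochner_L1norm_lty mD mG (mom _ ltr01).
have G0 := gaussian_moments_eq0 mG G1.
have {}G0 : {ae leb, forall r, D r -> G r = 0}.
  (* The test function e^(-a r^2) times [gam 1] is [gam (1 + a)], whose parameter is positive even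
     for a = 0. *)
  apply: G0 => a a0; rewrite /wint; apply: (bochner_integralE mD).
  have := mom (1 + a) (ltr_wpDr a0 ltr01); congr is_bochner_integral.
  apply/funext => r; rewrite /G scalerA -rmorphM; congr (_%:C *: _).
  by rewrite /gam mulrDl opprD expRD/=; ring.
move: fft G0; apply: filterS2 => r H1 H2 Dr.
rewrite (H1 Dr); apply/eqP; rewrite -subr_eq0; move: (H2 Dr) => /eqP; rewrite /G.
rewrite scaler_eq0 => /orP[|//]; rewrite fmorph_eq0 mulf_eq0 expf_eq0 (gt_eqF (expR_gt0 _)) orbF.
by rewrite gt_eqF// D_gt0.
Qed.

End HankelRepresentation.

(** * Choice of the integrable function and of the embedding constant *)

Theorem lemma3p35 (R : realType) (X : completeNormedModType R[i])
    (k : int) (m : nat) (s : R) (hs : m.+1%:R < s) :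
  exists C : R, 0 <= C /\
    forall f : R -> X, hankel_space k s f ->
      exists g : R -> X,
        [/\ Cb k m g,
            {ae lebesgue_measure, forall r, 0 < r -> f r = g r} &
            Cb_norm k m g <= C * hankel_space_norm k s f].
Proof.
pose leb : {measure set (measurableTypeR R) -> \bar R} := @lebesgue_measure R.
pose D : set (measurableTypeR R) := `]0%R, +oo[%classic.
have mD : measurable D by exact: measurable_itv.
have D_gt0 rho : D rho -> 0 < rho by rewrite /D/= in_itv/= andbT.
pose a : R := s - m.+1%:R; have a0 : 0 < a by rewrite subr_gt0.
(* The integral of (1 + rho^2)^(m - s) rho by [integral_japanese], since m - s = - a - 1. *)
pose K : R := (2 * a)^-1; have K0 : 0 <= K by rewrite invr_ge0 mulr_ge0// ltW.
exists ((K + 1) / 2); split; first by rewrite divr_ge0 ?addr_ge0.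
move=> f [[sf _] fh [sh hlt]].
set h := hankel_transform k f in sh hlt.
have {}fh : is_hankel_transform k f h by case: fh => h' Hh'; exact: (xgetPex _ (ex_intro _ h' Hh')).
have p0 (rho : R) : 0 < 1 + rho ^+ 2 by rewrite ltr_pwDl// sqr_ge0.
(* [H] is an everywhere measurable version of (1 + rho^2)^(s/2) h; [F] is built from it, so its
   relation to h holds almost everywhere only. *)
have [H mH hH] := strongly_measurableP mD sh.
pose u (rho : R) := bracket m rho * (1 + rho ^+ 2) `^ (- (s / 2)).
have cu : continuous u.
  move=> rho; apply: cvgM; first exact: bracket_continuous.
  apply: (@continuous_comp R R R (fun x => 1 + x ^+ 2) (fun x => x `^ (- (s / 2)))).
    by apply: cvgD; [exact: cvg_cst|exact: exprn_continuous].
  apply: differentiable_continuous; apply/derivable1_diffP.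
  by have [] := is_derive1_powR (- (s / 2)) (p0 rho).
have u0 rho : 0 <= u rho by rewrite mulr_ge0 ?powR_ge0// ltW// bracket_gt0.
have mu : measurable_fun [set: measurableTypeR R] (u : measurableTypeR R -> R).
  exact: continuous_measurable_fun.
pose F (rho : measurableTypeR R) : X := (rho * u rho)%:C *: H rho.
have mF : smeasurable F.
  by apply: smeasurableZ => //; apply: measurable_funM.
have uK : (\int[leb]_(rho in D) (u rho ^+ 2 * rho)%:E = K%:E)%E.
  rewrite -integral_japanese//; apply: eq_integral => rho _; congr (_%:E).
  rewrite mulrC; congr (_ * _); rewrite exprMn /bracket exprAC sqr_sqrtr ?(ltW (p0 _))//.
  rewrite -(powR_mulrn m (ltW (p0 rho))) -(powR_mulrn 2 (powR_ge0 _ _)) -powRrM -powRD; last first.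
    by rewrite (gt_eqF (p0 rho)) implybT.
  by congr (_ `^ _); rewrite /a -natr1; field.
have normE rho : rnorm (((1 + rho ^+ 2) `^ (s / 2))%:C *: h rho) ^+ 2 =
    (1 + rho ^+ 2) `^ s * rnorm (h rho) ^+ 2.
  rewrite rnormZ ger0_norm ?powR_ge0// exprMn -(powR_mulrn 2 (powR_ge0 _ (s / 2))) -powRrM.
  by congr (_ `^ _ * _); field.
have sq0 (v : R -> X) rho : D rho -> 0 <= rnorm (v rho) ^+ 2 * rho.
  by move=> /D_gt0 /ltW r0; rewrite mulr_ge0 ?sqr_ge0.
have intE : (\int[leb]_(rho in D) (rnorm (H rho) ^+ 2 * rho)%:E =
    \int[leb]_(rho in D) ((1 + rho ^+ 2) `^ s * rnorm (h rho) ^+ 2 * rho)%:E)%E.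
  transitivity (\int[leb]_(rho in D) (rnorm (((1 + rho ^+ 2) `^ (s / 2))%:C *: h rho) ^+ 2 * rho)%:E)%E.
    apply: integral_ae_eq; [exact: sq0|exact: sq0|].
    by move: hH; apply: filterS => rho E Dr; rewrite (E Dr).
  by apply: eq_integral => rho _; rewrite normE.
have [B HB] : exists B : R, (\int[leb]_(rho in D) (rnorm (H rho) ^+ 2 * rho)%:E = B%:E)%E.
  exists (fine (\int[leb]_(rho in D) (rnorm (H rho) ^+ 2 * rho)%:E)%E); rewrite fineK//.
  rewrite ge0_fin_numE; last by apply: integral_ge0 => t /(sq0 H).
  (* The finiteness hypothesis carries the factor 2 pi of the L2 norm; as it is positive, an
     infinite integral would stay infinite. *)
  rewrite intE ltey; apply/eqP => Ioo; move: hlt; rewrite /L12_normsq.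
  under eq_integral do rewrite normE.
  by rewrite -/leb -/D Ioo gt0_muley// lte_fin mulr_gt0// pi_gt0.
have BE : hankel_space_norm k s f = Num.sqrt B.
  by rewrite /hankel_space_norm -/h -intE HB.
have L1F : (L1norm leb D F <= ((K + 1) / 2 * Num.sqrt B)%:E)%E.
  have := cauchy_schwarz_le mD (measurable_funTS mu) (smeasurable_rnorm mD mH)
    (@measurable_id _ _ D) (fun t _ => u0 t) (fun t _ => rnorm_ge0 _)
    (fun t Dt => ltW (D_gt0 t Dt)) uK HB.
  apply: le_trans; rewrite le_eqVlt; apply/orP; left; apply/eqP.
  apply: eq_integral => rho; rewrite inE => Dr; congr (_%:E).
  rewrite /F rnormZ (ger0_norm (mulr_ge0 (ltW (D_gt0 _ Dr)) (u0 rho))).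
  by rewrite -[LHS]mulrA [LHS]mulrC.
have F1 : (L1norm leb D F < +oo)%E by apply: le_lt_trans L1F _; rewrite ltry.
exists (bessel_int m F 1 0 k); split.
- exact: bessel_int_Cb.
- have Fh : (fun rho => (rho * bracket m rho)%:C *: h rho) = F %[ae leb in D].
    move: hH; apply: filterS => rho E Dr; rewrite /F -(E Dr) scalerA -rmorphM; congr (_%:C *: _).
    by rewrite /u powRN/=; field; rewrite gt_eqF// powR_gt0.
  have := hankel_ae_eq mF F1 Fh fh sf; apply: filterS => r E r0; apply: E.
  by rewrite /D/= in_itv/= andbT.
- rewrite BE; have N : Cb_norm k m (bessel_int m F 1 0 k) <= fine (L1norm leb D F).
    exact: bessel_int_Cb_norm.
  apply: (le_trans N).
  by rewrite -lee_fin fineK// ge0_fin_numE ?L1norm_ge0.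
Qed.
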